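(* Let $X$ be a Banach space, $\alpha\in\mathbb{R}$ with $\alpha\ne0$, $\beta\ge 0$, $0<\mu<\widetilde\mu\le 1$ and $\omega<0$, and assume $\beta+\omega\le 0$. Let $A$ be a closed, densely defined linear operator on $X$ and let $(S_{\alpha,\beta}^\mu(t))_{t\ge0}$ denote the $(\alpha,\beta,\mu)$-resolvent family generated by $A$. (a) If $\alpha>0$ and $A$ is $\omega$-sectorial of angle $\widetilde\mu\frac{\pi}{2}$, then there exists $C>0$ such that $\|S_{\alpha,\beta}^\mu(t)\|\le Ce^{-\beta t}$ for all $t\ge0$. (b) If $\alpha<0$, $\alpha+\beta^\mu\ge|\alpha|$, and $A$ is $\omega$-sectorial of angle $\widetilde\mu\frac{\pi}{2}$, then there exists $C>0$ such that $$\|S_{\alpha,\beta}^\mu(t)\|\le C\left(1+\alpha\omega t^{\mu+1}\right)e^{-\left(\beta-(\alpha\omega)^{\frac{1}{\mu+1}}\right)t}\quad\text{for all } t\ge 0.$$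
   Context: Kernel: $\kappa(t)=\alpha e^{-\beta t}\frac{t^{\mu-1}}{\Gamma(\mu)}$, $t>0$, and $(1\ast\kappa)(t)=\int_0^t\kappa(s)\,ds$. An $(\alpha,\beta,\mu)$-resolvent family generated by $A$ is a family $(S_{\alpha,\beta}^\mu(t))_{t\ge0}$ of bounded linear operators on $X$ such that: $S_{\alpha,\beta}^\mu(0)=I$ and $t\mapsto S_{\alpha,\beta}^\mu(t)$ is strongly continuous on $[0,\infty)$; $S_{\alpha,\beta}^\mu(t)D(A)\subset D(A)$ and $S_{\alpha,\beta}^\mu(t)Ax=AS_{\alpha,\beta}^\mu(t)x$ for $x\in D(A)$, $t\ge0$; and for all $x\in D(A)$, $t\ge 0$, $S_{\alpha,\beta}^\mu(t)x=x+\int_0^t(1+1\ast\kappa)(t-s)AS_{\alpha,\beta}^\mu(s)x\,ds$. For $\omega\in\mathbb{R}$ and an angle $\theta$, $A$ is $\omega$-sectorial of angle $\theta$ if $\omega+\Sigma_\theta:=\{\omega+\lambda:\lambda\in\mathbb{C},\ |\arg\lambda|<\theta+\frac{\pi}{2}\}\subset\rho(A)$ and there is $M>0$ with $\|(\lambda-A)^{-1}\|\le M/|\lambda-\omega|$ for all $\lambda\in(\omega+\Sigma_\theta)\setminus\{\omega\}$. *)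

(* Defs.v *)
From HB Require Import structures.
From mathcomp Require Import all_boot all_order all_algebra.
From mathcomp Require Import all_classical all_reals all_analysis.
From mathcomp.real_closed Require Import complex.
Import Order.TTheory GRing.Theory Num.Theory.
Import numFieldNormedType.Exports.

Set Implicit Arguments.
Unset Strict Implicit.
Unset Printing Implicit Defensive.

Local Open Scope classical_set_scope.
Local Open Scope ring_scope.
Local Open Scope complex_scope.

Section Defs.
Variable R : realType.
Variable X : completeNormedModType R[i].

Definition Gamma (m : R) : R :=
  Rintegral (@lebesgue_measure R) `[0%R, +oo[%classic
    (fun x : R => x `^ (m - 1) * expR (- x)).

Definition kappa (alpha beta mu : R) (t : R) : R :=
  alpha * expR (- (beta * t)) * t `^ (mu - 1) / Gamma mu.

Definition one_conv_kappa (alpha beta mu : R) (t : R) : R :=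
  Rintegral (@lebesgue_measure R) `[0%R, t]%classic (kappa alpha beta mu).

Definition is_riemann_integral (f : R -> X) (a b : R) (v : X) : Prop :=
  forall e : R, 0 < e -> exists2 d : R, 0 < d &
    forall (n : nat) (p xi : nat -> R),
      p 0%N = a -> p n = b ->
      (forall i, (i < n)%N -> p i <= xi i <= p i.+1 /\ p i.+1 - p i < d) ->
      `| \sum_(i < n) ((p i.+1 - p i)%:C *: f (xi i)) - v | < e%:C.

Definition linear_operator (D : set X) (A : X -> X) : Prop :=
  D 0 /\
  (forall (c : R[i]) x y, D x -> D y -> D (c *: x + y)) /\
  (forall (c : R[i]) x y, D x -> D y -> A (c *: x + y) = c *: A x + A y).

Definition closed_operator (D : set X) (A : X -> X) : Prop :=
  closed [set p : X * X | D p.1 /\ p.2 = A p.1].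

Definition densely_defined (D : set X) : Prop := closure D = setT.

Definition bounded_linear (T : X -> X) : Prop :=
  (forall (c : R[i]) x y, T (c *: x + y) = c *: T x + T y) /\
  exists c : R, forall x, `|T x| <= c%:C * `|x|.

(* the sector ω + Σ_θ = {ω + λ : λ ≠ 0, |arg λ| < θ + π/2},
   |arg λ| < φ written in polar form (φ ≤ π here) *)
Definition in_sector (omega theta : R) (z : R[i]) : Prop :=
  exists r psi : R, 0 < r /\ `|psi| < theta + pi / 2 /\
    z - omega%:C = (r * cos psi) +i* (r * sin psi).

Definition is_resolvent (D : set X) (A : X -> X) (l : R[i]) (Rl : X -> X) : Prop :=
  bounded_linear Rl /\
  (forall y, D (Rl y) /\ l *: Rl y - A (Rl y) = y) /\
  (forall x, D x -> Rl (l *: x - A x) = x).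

Definition sectorial (omega theta : R) (D : set X) (A : X -> X) : Prop :=
  exists2 M : R, 0 < M &
    forall l : R[i], in_sector omega theta l ->
      exists Rl : X -> X, is_resolvent D A l Rl /\
        forall y, `|Rl y| <= (M%:C / `|l - omega%:C|) * `|y|.

Definition resolvent_family (alpha beta mu : R) (D : set X) (A : X -> X)
    (S : R -> X -> X) : Prop :=
  (forall x, S 0 x = x) /\
  (forall t, 0 <= t -> bounded_linear (S t)) /\
  (forall x, {within `[0%R, +oo[%classic, continuous (fun t => S t x)}) /\
  (forall t x, 0 <= t -> D x -> D (S t x) /\ S t (A x) = A (S t x)) /\
  (forall t x, 0 <= t -> D x ->
     is_riemann_integral
       (fun s => (1 + one_conv_kappa alpha beta mu (t - s))%:C *: A (S s x))
       0 t (S t x - x)).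

End Defs.

(* Main.v *)
(* Let b = 0 in case (a) and b^(mu+1) = alpha omega in case (b), and put
   v(s) = e^((beta-b)s) S(s) x for x in D(A).  The Laplace transform of v at
   zeta = z - b is F(zeta) = g(z) R(h(z)) x, where g(z) = z^mu / (z^mu + alpha),
   h(z) = (z - beta) g(z) and R is the resolvent of A.  For Re z > b and Im z >= 0,
   the numerator of h(z) - omega lies in the cone 0 <= arg <= (1 + mu) pi / 2 and its
   denominator z^mu + alpha in the first quadrant; hence h(z) is in the sector of A, and
   |F'(zeta)| <= K |x| / |zeta|^2.  With lam = n / t, the coefficient of w^n in
   lam F(lam (1 - w)) is a weighted average of v whose weights concentrate at t, and a
   summation by parts on the circle |w| = 1 - 1/n bounds it by a constant times K |x|;
   so |v(t)| <= C |x|, and D(A) is dense.  Contour integrals are avoided: coefficients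
   are averages over roots of unity, Cauchy's theorem is a telescoping of angular
   increments, and the Laplace transform of v is a Riemann sum. *)

Require Import Defs.
From HB Require Import structures.
From mathcomp Require Import all_boot all_order all_algebra.
From mathcomp Require Import all_classical all_reals all_analysis.
From mathcomp.real_closed Require Import complex.
From mathcomp Require Import measurable_realfun.
From mathcomp Require Import ring lra.
Import Order.TTheory GRing.Theory Num.Theory.
Import numFieldNormedType.Exports.
Local Open Scope classical_set_scope.
Local Open Scope ring_scope.

Set Implicit Arguments.
Unset Strict Implicit.
Unset Printing Implicit Defensive.

(** * Real-valued norm and uniform complex differentiability *)

Section RealNorm.
Context {R : realType}.
Local Notation C := R[i].

(** The resolvent bound gives only F = O(1/|zeta|), for which the inversion integral diverges
    logarithmically. This is why F' is estimated: the factor 1/n produced by the summation by parts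
    cancels the mean of 1/|1 - w|^2 on the circle, which is of order n, and lam drops out. The bound
    is therefore free of n and t and depends on K alone. In case (b) the constant term -alpha omega
    of the numerator is negative, and b is the positive zero of z^(mu+1) - alpha omega: to the right
    of b the numerator regroups into terms of one convex cone. The condition alpha + beta^mu >=
    |alpha| yields b^mu > -alpha, which keeps the denominator away from 0. In both cases beta +
    omega <= 0 makes the coefficient -omega - beta of z^mu nonnegative, and the strict inequality mu
    < mu' lets a closed cone of opening (1 + mu) pi / 2 fit into the open sector of A. *)

Definition nr {V : normedZmodType C} (x : V) : R := complex.Re `|x|.

(** Norms on a space over [R[i]] take values in [R[i]]. Nonnegativity there forces a zero imaginary
    part, so passing to the real number [nr] loses nothing. *)
Lemma nrE (V : normedZmodType C) (x : V) : `|x| = (nr x)%:C%C.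
Proof.
have : 0 <= `|x| by [].
by rewrite /nr; case: `|x| => a b; rewrite lecE /= => /andP[/eqP-> _].
Qed.

Lemma nr_ge0 (V : normedZmodType C) (x : V) : 0 <= nr x.
Proof. by rewrite -ler0c -nrE. Qed.

Lemma nr0 (V : normedZmodType C) : nr (0 : V) = 0.
Proof. by rewrite /nr normr0. Qed.

Lemma nr_eq0 (V : normedZmodType C) (x : V) : (nr x == 0) = (x == 0).
Proof. by rewrite -(inj_eq (@complexI R)) -nrE normr_eq0. Qed.

Lemma nr_gt0 (V : normedZmodType C) (x : V) : (0 < nr x) = (x != 0).
Proof. by rewrite lt0r nr_ge0 andbT nr_eq0. Qed.

Lemma nrN (V : normedZmodType C) (x : V) : nr (- x) = nr x.
Proof. by rewrite /nr normrN. Qed.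

Lemma nrC (V : normedZmodType C) (x y : V) : nr (x - y) = nr (y - x).
Proof. by rewrite /nr distrC. Qed.

Lemma nrD (V : normedZmodType C) (x y : V) : nr (x + y) <= nr x + nr y.
Proof. by rewrite -lecR rmorphD /= -!nrE ler_normD. Qed.

Lemma nrB (V : normedZmodType C) (x y : V) : nr (x - y) <= nr x + nr y.
Proof. by rewrite -(nrN y) nrD. Qed.

Lemma nrZ (V : normedModType C) (c : C) (x : V) : nr (c *: x) = nr c * nr x.
Proof. by have := normrZ c x; rewrite !nrE -rmorphM => /complexI. Qed.

Lemma nrM (x y : C) : nr (x * y) = nr x * nr y.
Proof. by have := normrM x y; rewrite !nrE -rmorphM => /complexI. Qed.

Lemma nrV (x : C) : nr x^-1 = (nr x)^-1.
Proof. by have := normfV x; rewrite !nrE -fmorphV => /complexI. Qed.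

Lemma nrX (x : C) n : nr (x ^+ n) = nr x ^+ n.
Proof. by have := normrX n x; rewrite !nrE -rmorphXn => /complexI. Qed.

Lemma nrR (x : R) : nr (x%:C%C : C) = `|x|.
Proof. by rewrite /nr normc_def /= expr0n /= addr0 sqrtr_sqr. Qed.

Lemma nr1 : nr (1 : C) = 1.
Proof. by rewrite -[1]/(1%:C)%C nrR normr1. Qed.

Lemma nr_sqr (x : C) : nr x ^+ 2 = complex.Re x ^+ 2 + complex.Im x ^+ 2.
Proof. by rewrite /nr normc_def /= sqr_sqrtr // addr_ge0 // sqr_ge0. Qed.

Lemma nr_sum (V : normedZmodType C) (I : Type) (r : seq I) (P : pred I) (F : I -> V) :
  nr (\sum_(i <- r | P i) F i) <= \sum_(i <- r | P i) nr (F i).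
Proof.
elim/big_ind2: _ => //; first by rewrite nr0.
by move=> x1 x2 y1 y2 h1 h2; rewrite (le_trans (nrD _ _)) // lerD.
Qed.

Lemma Re_le_nr (x : C) : `|complex.Re x| <= nr x.
Proof.
rewrite -(@ler_pXn2r _ 2) // ?nnegrE ?nr_ge0 // nr_sqr.
by rewrite real_normK ?num_real // lerDl sqr_ge0.
Qed.

Lemma Im_le_nr (x : C) : `|complex.Im x| <= nr x.
Proof.
rewrite -(@ler_pXn2r _ 2) // ?nnegrE ?nr_ge0 // nr_sqr.
by rewrite real_normK ?num_real // lerDr sqr_ge0.
Qed.

Lemma nr_le_ReIm (x : C) : nr x <= `|complex.Re x| + `|complex.Im x|.
Proof.
rewrite -(@ler_pXn2r _ 2) // ?nnegrE ?nr_ge0 ?addr_ge0 // nr_sqr.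
rewrite sqrrD !real_normK ?num_real // -addrA lerD2l lerDr.
by rewrite mulrn_wge0 // mulr_ge0.
Qed.

Lemma nrBD (V : normedZmodType C) (y x z : V) :
  nr (x - z) <= nr (x - y) + nr (y - z).
Proof. by rewrite (le_trans _ (nrD _ _)) // addrA subrK. Qed.

Lemma nr_le_dist (V : normedZmodType C) (x y : V) : nr x <= nr y + nr (x - y).
Proof. by rewrite (le_trans _ (nrD _ _)) // addrC subrK. Qed.

Lemma nr_le_dist3 (V : normedZmodType C) (a x y z : V) :
  nr a <= nr (x - a) + nr (x - y) + nr (z - y) + nr z.
Proof.
have := nr_le_dist a x; have := nr_le_dist x y; have := nr_le_dist y z.
by rewrite (nrC a) (nrC y); lra.
Qed.

End RealNorm.

(** Additive bookkeeping for the product rule [T2_scale], where the entries are vectors. *)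
Lemma zmod_product_rule (V : zmodType) (a b c d e f : V) :
  a + b + (c + d) - a - (e + f) = c - e + (b - f) + d.
Proof.
rewrite !opprD !addrA [LHS](ACl ((1*5)*(3*6*2*7*4)))/=.
by rewrite subrr add0r.
Qed.

Lemma zmod_sum_rule (V : zmodType) (a b c d e f : V) :
  a + b - (c + d) - (e + f) = (a - c - e) + (b - d - f).
Proof. by rewrite !opprD !addrA [LHS](ACl (1*3*5*2*4*6))/=. Qed.

(** * Uniform second-order Taylor expansions and their calculus *)

Section Taylor.
Context {R : realType}.
Local Notation C := R[i].

(* Second-order Taylor bounds, uniform on [P]: a form of holomorphy for which Cauchy's
   theorem on circles follows from finite sums. *)
Definition T2 {V : normedModType C} (P : set C) (f df : C -> V) : Prop :=
  exists2 L : R, 0 <= L & forall z z', P z -> P z' ->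
    [/\ nr (f z) <= L, nr (df z) <= L, nr (f z' - f z) <= L * nr (z' - z)
      & nr (f z' - f z - (z' - z) *: df z) <= L * nr (z' - z) ^+ 2].

Lemma T2_ext (V : normedModType C) (P : set C) (f df g dg : C -> V) :
  (forall z, P z -> f z = g z) -> (forall z, P z -> df z = dg z) ->
  T2 P f df -> T2 P g dg.
Proof.
move=> fg dfg [L L0 h]; exists L => // z z' Pz Pz'.
by rewrite -!fg // -!dfg //; exact: h.
Qed.

Lemma T2_const (V : normedModType C) (P : set C) (v : V) :
  T2 P (fun=> v) (fun=> 0).
Proof.
exists (nr v); first exact: nr_ge0.
move=> z z' _ _; rewrite subrr scaler0 subr0 nr0.
by split => //; rewrite ?nr_ge0 // mulr_ge0 ?exprn_ge0 ?nr_ge0.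
Qed.

Lemma T2_id (P : set C) (B : R) : (forall z, P z -> nr z <= B) ->
  T2 P (id : C -> C^o) (fun=> 1).
Proof.
move=> hB; exists (Num.max B 1); first by rewrite le_max ler01 orbT.
move=> z z' Pz Pz'; have L1 : 1 <= Num.max B 1 by rewrite le_max lexx orbT.
split.
- by rewrite le_max hB.
- by rewrite [nr _]nr1.
- by rewrite ler_peMl // nr_ge0.
- rewrite -[(z' - z) *: 1]/((z' - z) * 1) mulr1 subrr nr0.
  by rewrite mulr_ge0 ?exprn_ge0 ?nr_ge0 // (le_trans ler01).
Qed.

Lemma T2_add (V : normedModType C) (P : set C) (f df g dg : C -> V) :
  T2 P f df -> T2 P g dg ->
  T2 P (fun z => f z + g z) (fun z => df z + dg z).
Proof.
move=> [L L0 h] [M M0 k]; exists (L + M); first exact: addr_ge0.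
move=> z z' Pz Pz'; have [h1 h2 h3 h4] := h z z' Pz Pz'.
have [k1 k2 k3 k4] := k z z' Pz Pz'.
split; first by rewrite (le_trans (nrD _ _)) // lerD.
- by rewrite (le_trans (nrD _ _)) // lerD.
- by rewrite opprD addrACA mulrDl (le_trans (nrD _ _)) // lerD.
- by rewrite scalerDr zmod_sum_rule mulrDl (le_trans (nrD _ _)) // lerD.
Qed.

Lemma T2_scale (V : normedModType C) (P : set C) (f df : C -> C) (g dg : C -> V) :
  T2 P (f : C -> C^o) df -> T2 P g dg ->
  T2 P (fun z => f z *: g z) (fun z => df z *: g z + f z *: dg z).
Proof.
(* The remainder of a product has three parts: each factor times the remainder of the other, and the
   product of the two increments. *)
move=> [L L0 h] [M M0 k]; exists (3 * L * M).
  by rewrite !mulr_ge0.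
have LM : 0 <= L * M by exact: mulr_ge0.
move=> z z' Pz Pz'; have [h1 h2 h3 h4] := h z z' Pz Pz'.
have [k1 k2 k3 k4] := k z z' Pz Pz'; have [k1' k2' _ _] := k z' z Pz' Pz.
have hM (a b : R) : 0 <= a -> 0 <= b -> a <= L -> b <= M -> a * b <= L * M.
  by move=> *; rewrite ler_pM.
have d0 : 0 <= nr (z' - z) by exact: nr_ge0.
split.
- rewrite nrZ; have := hM _ _ (nr_ge0 (f z)) (nr_ge0 (g z)) h1 k1; lra.
- rewrite (le_trans (nrD _ _)) // !nrZ.
  have := hM _ _ (nr_ge0 (df z)) (nr_ge0 (g z)) h2 k1.
  have := hM _ _ (nr_ge0 (f z)) (nr_ge0 (dg z)) h1 k2; lra.
- have -> : f z' *: g z' - f z *: g z = (f z' - f z) *: g z' + f z *: (g z' - g z).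
    by rewrite scalerBl scalerBr addrA subrK.
  rewrite (le_trans (nrD _ _)) // !nrZ.
  have e1 : nr (f z' - f z) * nr (g z') <= L * nr (z' - z) * M.
    by rewrite ler_pM ?nr_ge0.
  have e2 : nr (f z) * nr (g z' - g z) <= L * (M * nr (z' - z)).
    by rewrite ler_pM ?nr_ge0.
  have : 0 <= L * M * nr (z' - z) by rewrite mulr_ge0.
  lra.
- have -> : f z' *: g z' - f z *: g z - (z' - z) *: (df z *: g z + f z *: dg z) =
     (f z' - f z - (z' - z) * df z) *: g z +
     f z *: (g z' - g z - (z' - z) *: dg z) + (f z' - f z) *: (g z' - g z).
    have [u ->] : exists u, f z' = f z + u by exists (f z' - f z); rewrite addrC subrK.
    have [v ->] : exists v, g z' = g z + v by exists (g z' - g z); rewrite addrC subrK.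
    rewrite !(addrC _ (- f z)) !(addrC _ (- g z)) !addKr.
    rewrite scalerDl !(scalerDr _ (g z)) (scalerDr (z' - z)) (scalerBl u) (scalerBr (f z)) !scalerA.
    rewrite (mulrC (f z)).
    exact: zmod_product_rule.
  rewrite (le_trans (nrD _ _)) // (le_trans (lerD (nrD _ _) (lexx _))) // !nrZ.
  have e1 : nr (f z' - f z - (z' - z) * df z) * nr (g z) <=
      L * nr (z' - z) ^+ 2 * M by exact: ler_pM (nr_ge0 _) (nr_ge0 _) h4 k1.
  have e2 : nr (f z) * nr (g z' - g z - (z' - z) *: dg z) <=
      L * (M * nr (z' - z) ^+ 2) by rewrite ler_pM ?nr_ge0.
  have e3 : nr (f z' - f z) * nr (g z' - g z) <=
      L * nr (z' - z) * (M * nr (z' - z)) by rewrite ler_pM ?nr_ge0.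
  lra.
Qed.

Lemma T2_inv (P : set C) (f df : C -> C) (m : R) : 0 < m ->
  (forall z, P z -> m <= nr (f z)) ->
  T2 P (f : C -> C^o) df ->
  T2 P ((fun z => (f z)^-1) : C -> C^o) (fun z => - df z / f z ^+ 2).
Proof.
move=> m0 hm [L L0 h].
have nrVm z : P z -> nr (f z)^-1 <= m^-1.
  by move=> Pz; rewrite nrV lef_pV2 ?posrE ?hm // (lt_le_trans m0) ?hm.
have nrX2 z : P z -> nr (f z ^+ 2)^-1 <= m^-1 ^+ 2.
  by move=> Pz; rewrite -exprVn nrX lerXn2r ?nnegrE ?nr_ge0 ?nrVm // invr_ge0 ltW.
have fn0 z : P z -> f z != 0 by move=> Pz; rewrite -nr_gt0 (lt_le_trans m0) ?hm.
have mi0 : 0 <= m^-1 by rewrite invr_ge0 ltW.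
(* [m^-1] bounds the value, [L * m^-1 ^+ 2] the derivative, and [L ^+ 2 * m^-1 ^+ 3] the squared
   increment of [f] in the remainder. *)
exists (m^-1 + L * m^-1 ^+ 2 + L ^+ 2 * m^-1 ^+ 3).
  by rewrite !addr_ge0 // ?mulr_ge0 ?exprn_ge0.
move=> z z' Pz Pz'; have [h1 h2 h3 h4] := h z z' Pz Pz'.
have p1 : 0 <= L * m^-1 ^+ 2 by rewrite mulr_ge0 ?exprn_ge0.
have p2 : 0 <= L ^+ 2 * m^-1 ^+ 3 by rewrite mulr_ge0 ?exprn_ge0.
have d0 : 0 <= nr (z' - z) by exact: nr_ge0.
split.
- have := nrVm _ Pz; lra.
- have -> : nr (- df z / f z ^+ 2 : C^o) = nr (df z) * nr (f z ^+ 2)^-1.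
    by rewrite [nr _]nrM nrN.
  have : nr (df z) * nr (f z ^+ 2)^-1 <= L * m^-1 ^+ 2 by rewrite ler_pM ?nr_ge0 ?nrX2.
  lra.
- have -> : (f z')^-1 - (f z)^-1 = - (f z' - f z) * ((f z)^-1 * (f z')^-1).
    by field; rewrite !fn0.
  have -> : nr (- (f z' - f z) * ((f z)^-1 * (f z')^-1) : C^o) =
      nr (f z' - f z) * (nr (f z)^-1 * nr (f z')^-1) by rewrite [nr _]nrM nrN nrM.
  have : nr (f z' - f z) * (nr (f z)^-1 * nr (f z')^-1) <=
      L * nr (z' - z) * (m^-1 * m^-1).
    by rewrite ler_pM ?mulr_ge0 ?nr_ge0 // ler_pM ?nr_ge0 ?nrVm.
  nra.
- have -> : (f z')^-1 - (f z)^-1 - (z' - z) *: (- df z / f z ^+ 2 : C^o) =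
      - (f z' - f z - (z' - z) * df z) * (f z ^+ 2)^-1
      + (f z' - f z) ^+ 2 * ((f z ^+ 2)^-1 * (f z')^-1).
    rewrite -[(z' - z) *: _]/((z' - z) * _).
    by field; rewrite !fn0.
  have -> : forall a b c d e : C, nr (- a * b + c ^+ 2 * (d * e) : C^o) =
      nr (- (a * b) + c ^+ 2 * (d * e)) by move=> *; rewrite mulNr.
  rewrite (le_trans (nrD _ _)) // nrN nrM (nrM ((_ - _) ^+ 2)) (nrM (_ ^-1)) (nrX (_ - _)).
  have e1 : nr (f z' - f z - (z' - z) * df z) * nr (f z ^+ 2)^-1 <=
      L * nr (z' - z) ^+ 2 * m^-1 ^+ 2.
    exact: ler_pM (nr_ge0 _) (nr_ge0 _) h4 (nrX2 _ Pz).
  have e2 : nr (f z' - f z) ^+ 2 * (nr (f z ^+ 2)^-1 * nr (f z')^-1) <=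
      (L * nr (z' - z)) ^+ 2 * (m^-1 ^+ 2 * m^-1).
    rewrite ler_pM ?mulr_ge0 ?exprn_ge0 ?nr_ge0 //.
      by rewrite lerXn2r ?nnegrE ?nr_ge0 // mulr_ge0.
    by rewrite ler_pM ?nr_ge0 ?nrX2 ?nrVm.
  have e3 : 0 <= m^-1 * nr (z' - z) ^+ 2 by rewrite mulr_ge0 ?exprn_ge0.
  rewrite (le_trans (lerD e1 e2)) //; lra.
Qed.

Lemma T2_comp (V : normedModType C) (P Q : set C) (f df : C -> C) (g dg : C -> V) :
  (forall z, P z -> Q (f z)) ->
  T2 P (f : C -> C^o) df -> T2 Q g dg ->
  T2 P (fun z => g (f z)) (fun z => df z *: dg (f z)).
Proof.
move=> PQ [L L0 h] [M M0 k]; exists (M + L * M + L ^+ 2 * M).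
  by rewrite !addr_ge0 ?mulr_ge0 ?exprn_ge0.
have p1 : 0 <= L * M by rewrite mulr_ge0.
have p2 : 0 <= L ^+ 2 * M by rewrite mulr_ge0 ?exprn_ge0.
move=> z z' Pz Pz'; have [h1 h2 h3 h4] := h z z' Pz Pz'.
have [k1 k2 k3 k4] := k (f z) (f z') (PQ _ Pz) (PQ _ Pz').
have d0 : 0 <= nr (z' - z) by exact: nr_ge0.
split.
- lra.
- rewrite nrZ; have : nr (df z) * nr (dg (f z)) <= L * M by rewrite ler_pM ?nr_ge0.
  lra.
- have : M * nr (f z' - f z) <= M * (L * nr (z' - z)) by rewrite ler_wpM2l.
  nra.
- have -> : g (f z') - g (f z) - (z' - z) *: (df z *: dg (f z)) =
      (g (f z') - g (f z) - (f z' - f z) *: dg (f z)) +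
      (f z' - f z - (z' - z) * df z) *: dg (f z).
    by rewrite [X in _ = _ + X]scalerBl addrA subrK scalerA.
  rewrite (le_trans (nrD _ _)) // nrZ.
  have e1 : M * nr (f z' - f z) ^+ 2 <= M * (L * nr (z' - z)) ^+ 2.
    by rewrite ler_wpM2l // lerXn2r ?nnegrE ?nr_ge0 // mulr_ge0.
  have e2 : nr (f z' - f z - (z' - z) * df z) * nr (dg (f z)) <=
      L * nr (z' - z) ^+ 2 * M by exact: ler_pM (nr_ge0 _) (nr_ge0 _) h4 k2.
  have e3 : 0 <= M * nr (z' - z) ^+ 2 by rewrite mulr_ge0 ?exprn_ge0.
  rewrite (le_trans (lerD (le_trans k4 e1) e2)) //; lra.
Qed.

Lemma T2_exp (P : set C) (f df : C -> C) (n : nat) :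
  T2 P (f : C -> C^o) df ->
  T2 P ((fun z => f z ^+ n) : C -> C^o) (fun z => n%:R * df z * f z ^+ n.-1).
Proof.
move=> fT; elim: n => [|n IH].
  by apply: T2_ext (T2_const P (1 : C^o)) => // z _; rewrite !mul0r.
apply: T2_ext (T2_scale fT IH) => z _.
  by rewrite exprS.
case: n {IH} => [|n]; rewrite -!/(_ * _).
  by rewrite -[RHS]/(1 * df z * 1) -[LHS]/(df z * 1 + f z * (0 * df z * 1)); ring.
rewrite -[LHS]/(df z * (f z ^+ n.+1) + f z * (n.+1%:R * df z * f z ^+ n)).
by rewrite /= exprS -(natr1 n.+1); ring.
Qed.

(* A function whose derivative vanishes on a convex set is constant: the
   increments over [N] equal subsegments add up to O(1/N). *)
Lemma T2_der0 (V : normedModType C) (P : set C) (f : C -> V) z0 z1 :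
  (forall s : R, 0 <= s <= 1 -> P (z0 + s%:C%C * (z1 - z0))) ->
  T2 P f (fun=> 0) -> f z1 = f z0.
Proof.
move=> hP [L L0 h]; apply/eqP; rewrite -subr_eq0 -nr_eq0; apply/eqP.
set D := L * nr (z1 - z0) ^+ 2.
have D0 : 0 <= D by rewrite mulr_ge0 ?exprn_ge0 ?nr_ge0.
have key N : nr (f z1 - f z0) <= D / N.+1%:R.
  pose y (i : nat) := z0 + (i%:R / N.+1%:R : R)%:C%C * (z1 - z0).
  have -> : f z1 - f z0 = \sum_(0 <= i < N.+1) (f (y i.+1) - f (y i)).
    rewrite telescope_sumr //; congr (f _ - f _); rewrite /y.
      by rewrite divff ?pnatr_eq0 // mul1r addrC subrK.
    by rewrite mul0r mul0r addr0.
  rewrite big_mkord (le_trans (nr_sum _ _ _)) //.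
  have -> : D / N.+1%:R = \sum_(i < N.+1) (D / N.+1%:R ^+ 2).
    rewrite sumr_const card_ord -mulr_natl; field.
    by rewrite addrC natr1 pnatr_eq0.
  apply: ler_sum => i _.
  have Py j : (j <= N.+1)%N -> P (y j).
    move=> jN; apply: hP; rewrite divr_ge0 //=.
    by rewrite ler_pdivrMr ?ltr0n // mul1r ler_nat.
  have [_ _ _] := h _ _ (Py i (ltnW (ltn_ord i))) (Py i.+1 (ltn_ord i)).
  rewrite scaler0 subr0 => /le_trans; apply.
  have -> : y i.+1 - y i = (N.+1%:R^-1 : R)%:C%C * (z1 - z0).
    rewrite /y opprD addrACA subrr add0r -mulrBl -rmorphB /=.
    by rewrite -mulrBl -natrB // subSnn mul1r.
  by rewrite nrM nrR ger0_norm ?invr_ge0 // exprMn exprVn mulrCA mulrC.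
apply/eqP; rewrite eq_le nr_ge0 andbT; apply/ler_addgt0Pr => e e0; rewrite add0r.
have [N hN] : exists N : nat, D / e < N%:R.
  by exists (Num.bound (D / e)); rewrite archi_boundP // divr_ge0 // ltW.
rewrite (le_trans (key N)) // ler_pdivrMr ?ltr0n // mulrC -ler_pdivrMr //.
by rewrite ltW // (lt_le_trans hN) // ler_nat.
Qed.

End Taylor.

(** * Complex exponential and powers on the right half-plane *)

Section ComplexExp.
Context {R : realType}.
Local Notation C := R[i].

Lemma mvt_le (f df : R -> R) (M : R) :
  (forall x : R, is_derive x (1 : R) f (df x)) -> (forall x, `|df x| <= M) ->
  forall a b, `|f b - f a| <= M * `|b - a|.
Proof.
move=> hd hM a b; wlog ab : a b / a <= b.
  by move=> H; case: (leP a b) => [|/ltW] /H //; rewrite distrC (distrC b).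
have cf : {within `[a, b], continuous f}.
  apply: continuous_subspaceT => x.
  by apply/differentiable_continuous/derivable1_diffP; case: (hd x).
have [c _ ->] := MVT_segment ab (fun x _ => hd x) cf.
by rewrite normrM ler_wpM2r.
Qed.

Lemma sin_le_norm (y : R) : `|sin y| <= `|y|.
Proof.
have := mvt_le (f := sin) (M := 1) (fun x => is_derive_sin x) (@cos_max R) 0 y.
by rewrite sin0 !subr0 mul1r.
Qed.

(** Applied with r = |y| to functions whose derivative is itself O(|y|) on [-|y|, |y|], this gains a
    second factor |y|; the quadratic bounds for cos, sin and the exponential below all arise so. *)
Lemma mvt_le_on (f df : R -> R) (M r : R) :
  (forall x : R, is_derive x (1 : R) f (df x)) -> (forall x, `|x| <= r -> `|df x| <= M) ->
  forall b, `|b| <= r -> `|f b - f 0| <= M * `|b|.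
Proof.
move=> hd hM b br.
have cf x y : {within `[x, y], continuous f}.
  apply: continuous_subspaceT => u.
  by apply/differentiable_continuous/derivable1_diffP; case: (hd u).
case: (leP 0 b) => b0.
  have [c cb ->] := MVT_segment b0 (fun x _ => hd x) (cf _ _).
  rewrite normrM subr0 ler_wpM2r // hM //; move: cb; rewrite in_itv /= => /andP[c0 cb].
  by rewrite ger0_norm // (le_trans cb) // (le_trans _ br) // ler_norm.
have [c cb h] := MVT_segment (ltW b0) (fun x _ => hd x) (cf _ _).
rewrite distrC h normrM sub0r normrN ler_wpM2r // hM //.
move: cb; rewrite in_itv /= => /andP[c0 cb].
by rewrite ler0_norm // (le_trans _ br) // (ltr0_norm b0) lerN2.
Qed.

Lemma cos_sub1 (y : R) : `|cos y - 1| <= y ^+ 2.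
Proof.
have h (x : R) : `|x| <= `|y| -> `|- sin x| <= `|y|.
  by move=> xy; rewrite normrN (le_trans (sin_le_norm x)).
have := mvt_le_on (fun x => is_derive_cos x) h (lexx _).
by rewrite cos0 -expr2 real_normK ?num_real.
Qed.

Lemma cos_sub1_le (y : R) : `|cos y - 1| <= `|y|.
Proof.
have := mvt_le (f := cos) (df := fun x => - sin x) (M := 1)
  (fun x => is_derive_cos x) _ 0 y.
rewrite cos0 !subr0 mul1r; apply => x; rewrite normrN; exact: sin_max.
Qed.

Lemma sin_subid (y : R) : `|sin y - y| <= y ^+ 2.
Proof.
have hd (x : R) : is_derive x 1 (fun x : R => sin x - x) (cos x - 1).
  by apply: is_deriveB.
have h (x : R) : `|x| <= `|y| -> `|cos x - 1| <= `|y|.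
  by move=> xy; rewrite (le_trans (cos_sub1_le x)).
have := mvt_le_on hd h (lexx _).
by rewrite sin0 !subr0 -expr2 real_normK ?num_real.
Qed.

Lemma expR_sub1 (r x : R) : `|x| <= r -> `|expR x - 1| <= expR r * `|x|.
Proof.
move=> xr; rewrite -{1}expR0.
apply: (@mvt_le_on expR expR (expR r) r (fun x => is_derive_expR x)) => // y yr.
by rewrite ger0_norm ?expR_ge0 // ler_expR (le_trans _ yr) // ler_norm.
Qed.

Lemma expR_sub1id (r x : R) : `|x| <= r -> `|expR x - 1 - x| <= expR r * x ^+ 2.
Proof.
move=> xr.
have hd (y : R) : is_derive y 1 (fun x : R => expR x - x) (expR y - 1).
  by apply: is_deriveB.
have h (y : R) : `|y| <= `|x| -> `|expR y - 1| <= expR r * `|x|.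
  move=> yx; rewrite (le_trans (expR_sub1 (le_trans yx xr))) //.
  by rewrite ler_wpM2l ?expR_ge0.
have := mvt_le_on hd h (lexx _).
by rewrite expR0 subr0 -mulrA -expr2 real_normK ?num_real // addrAC.
Qed.

Definition cexp (z : C) : C :=
  ((expR (complex.Re z) * cos (complex.Im z)) +i*
   (expR (complex.Re z) * sin (complex.Im z)))%C.

Lemma cexp0 : cexp 0 = 1.
Proof. by rewrite /cexp /= expR0 cos0 sin0 mulr1 mulr0. Qed.

Lemma cexpD z w : cexp (z + w) = cexp z * cexp w.
Proof.
case: z w => [a b] [c d]; rewrite /cexp /= expRD sinD cosD.
by apply/eqP; rewrite eq_complex /=; apply/andP; split; apply/eqP; ring.
Qed.

Lemma cexpN z : cexp (- z) * cexp z = 1.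
Proof. by rewrite -cexpD addNr cexp0. Qed.

Lemma cexp_neq0 z : cexp z != 0.
Proof.
apply/eqP => h; have := cexpN z; rewrite h mulr0 => /eqP.
by rewrite eq_sym oner_eq0.
Qed.

Lemma cexpX z n : cexp (n%:R * z) = cexp z ^+ n.
Proof.
elim: n => [|n IH]; first by rewrite mul0r cexp0.
by rewrite -(natr1 n) mulrDl mul1r cexpD IH exprSr.
Qed.

Lemma nr_cexp z : nr (cexp z) = expR (complex.Re z).
Proof.
apply/eqP; rewrite -(@eqrXn2 _ 2) ?nr_ge0 ?expR_ge0 // nr_sqr /=.
by rewrite !exprMn -mulrDr cos2Dsin2 mulr1.
Qed.

Lemma cexpR (x : R) : cexp x%:C%C = (expR x)%:C%C.
Proof. by rewrite /cexp /= cos0 sin0 mulr1 mulr0. Qed.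

(** The real and imaginary parts of the remainder split into four products, each at most e^B |z|^2;
    hence the constant 4. *)
Lemma cexp_sub1id (B : R) z : nr z <= B ->
  nr (cexp z - 1 - z) <= 4 * expR B * nr z ^+ 2.
Proof.
move=> zB; have := Re_le_nr z; have := Im_le_nr z.
have e0 : complex.Re (cexp z - 1 - z) =
  (expR (complex.Re z) - 1 - complex.Re z) +
  expR (complex.Re z) * (cos (complex.Im z) - 1).
  case: z {zB} => a b /=; ring.
have e1 : complex.Im (cexp z - 1 - z) =
  expR (complex.Re z) * (sin (complex.Im z) - complex.Im z) +
  (expR (complex.Re z) - 1) * complex.Im z.
  case: z {zB e0} => a b /=; ring.
have n2 := nr_sqr z; set n := nr z in zB n2 *.
set x := complex.Re z in e0 e1 n2 *; set y := complex.Im z in e0 e1 n2 * => yn xn.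
have xB : `|x| <= B by exact: le_trans zB.
have eB : expR x <= expR B by rewrite ler_expR (le_trans _ xB) ?ler_norm.
rewrite (le_trans (nr_le_ReIm _)) // e0 e1.
have x2 : x ^+ 2 <= n ^+ 2 by rewrite n2 lerDl sqr_ge0.
have y2 : y ^+ 2 <= n ^+ 2 by rewrite n2 lerDr sqr_ge0.
have E0 := expR_ge0 B.
have n20 : 0 <= n ^+ 2 by rewrite sqr_ge0.
have a1 : `|expR x - 1 - x| <= expR B * n ^+ 2.
  by rewrite (le_trans (expR_sub1id xB)) // ler_wpM2l.
have a2 : `|expR x * (cos y - 1)| <= expR B * n ^+ 2.
  rewrite normrM ger0_norm ?expR_ge0 // ler_pM ?expR_ge0 //.
  by rewrite (le_trans (cos_sub1 y)).
have a3 : `|expR x * (sin y - y)| <= expR B * n ^+ 2.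
  rewrite normrM ger0_norm ?expR_ge0 // ler_pM ?expR_ge0 //.
  by rewrite (le_trans (sin_subid y)).
have a4 : `|(expR x - 1) * y| <= expR B * n ^+ 2.
  rewrite normrM (le_trans (ler_pM _ _ (expR_sub1 xB) (lexx _))) //.
  rewrite -mulrA ler_wpM2l // expr2 ler_pM //.
rewrite (le_trans (lerD (ler_normD _ _) (ler_normD _ _))) //.
lra.
Qed.

Lemma cexp_sub1 (B : R) z : nr z <= B ->
  nr (cexp z - 1) <= (1 + 4 * expR B * B) * nr z.
Proof.
move=> zB; rewrite (le_trans (nr_le_dist _ z)) // mulrDl mul1r lerD2l.
rewrite (le_trans (cexp_sub1id zB)) // -!mulrA !ler_wpM2l ?expR_ge0 //.
by rewrite expr2 ler_wpM2r ?nr_ge0.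
Qed.

(** Both truncations serve the uniform constants of [T2]: [a] keeps away from the singularity at 0,
    and [B] bounds the powers. *)
Definition rhp (a B : R) : set C := [set z | a <= complex.Re z /\ nr z <= B].

(* The argument on the right half-plane only. *)
Definition carg (z : C) : R := atan (complex.Im z / complex.Re z).
Definition clog (z : C) : C := (ln (nr z) +i* carg z)%C.

Lemma Re_gt0_nr (z : C) : 0 < complex.Re z -> 0 < nr z.
Proof. by move=> z0; rewrite (lt_le_trans z0) // (le_trans _ (Re_le_nr z)) // ler_norm. Qed.

Lemma cos_carg (z : C) : 0 < complex.Re z -> nr z * cos (carg z) = complex.Re z.
Proof.
move=> z0; have n0 := Re_gt0_nr z0.
rewrite /carg cos_atan.
have -> : 1 + (complex.Im z / complex.Re z) ^+ 2 = (nr z / complex.Re z) ^+ 2.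
  by rewrite !expr_div_n nr_sqr; field; rewrite gt_eqF.
rewrite sqrtr_sqr ger0_norm ?divr_ge0 ?ltW // invf_div mulrC divfK //.
by rewrite gt_eqF.
Qed.

Lemma sin_carg (z : C) : 0 < complex.Re z -> nr z * sin (carg z) = complex.Im z.
Proof.
move=> z0; have c0 : cos (carg z) != 0.
  have := cos_carg z0; case: eqP => // ->; rewrite mulr0 => h.
  by rewrite -h ltxx in z0.
have : tan (carg z) = complex.Im z / complex.Re z by rewrite /carg atanK.
rewrite /tan => /(congr1 ( *%R^~ (cos (carg z)))); rewrite divfK // => ->.
by rewrite mulrCA cos_carg // divfK // gt_eqF.
Qed.

Lemma cexp_clog (z : C) : 0 < complex.Re z -> cexp (clog z) = z.
Proof.
move=> z0; rewrite /cexp /clog /= lnK ?posrE ?Re_gt0_nr //.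
by rewrite cos_carg // sin_carg //; case: z {z0}.
Qed.

Lemma ln_lip (a x y : R) : 0 < a -> a <= x -> a <= y -> `|ln y - ln x| <= `|y - x| / a.
Proof.
move=> a0; wlog xy : x y / x <= y.
  move=> H ax ay; case: (leP x y) => [xy|/ltW yx]; first exact: H.
  by rewrite distrC (distrC y) H.
move=> ax ay; have x0 := lt_le_trans a0 ax; have y0 := lt_le_trans a0 ay.
rewrite ger0_norm ?subr_ge0 ?ler_ln ?posrE // -ln_div ?posrE //.
rewrite ger0_norm ?subr_ge0 //.
have -> : y / x = 1 + (y - x) / x by field; rewrite gt_eqF.
have q0 : 0 <= (y - x) / x by rewrite divr_ge0 ?subr_ge0 // ltW.
rewrite (le_trans (le_ln1Dx _)) ?(lt_le_trans _ q0) ?ltrN10 //.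
by rewrite ler_wpM2l ?subr_ge0 // lef_pV2.
Qed.

Lemma atan_lip (x y : R) : `|atan y - atan x| <= `|y - x|.
Proof.
have := mvt_le (f := atan) (M := 1) (fun x => is_derive1_atan x) _ x y.
rewrite mul1r; apply => u; rewrite normfV ger0_norm ?addr_ge0 ?sqr_ge0 //.
by rewrite invf_le1 ?lerDl ?sqr_ge0 // (lt_le_trans ltr01) // lerDl sqr_ge0.
Qed.

(** A Lipschitz bound is all that is asked of the logarithm; the second-order expansion of powers is
    taken from the exponential. *)
Lemma clog_lip (a B : R) : 0 < a -> exists2 K : R, 0 <= K &
  forall z z', rhp a B z -> rhp a B z' -> nr (clog z' - clog z) <= K * nr (z' - z).
Proof.
move=> a0; exists (a^-1 + a^-1 + `|B| / a ^+ 2).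
  by rewrite !addr_ge0 ?divr_ge0 ?exprn_ge0 ?invr_ge0 // ltW.
move=> z z' [az zB] [az' z'B].
have z0 := lt_le_trans a0 az; have z0' := lt_le_trans a0 az'.
have azn : a <= nr z by rewrite (le_trans az) // (le_trans _ (Re_le_nr z)) ?ler_norm.
have azn' : a <= nr z' by rewrite (le_trans az') // (le_trans _ (Re_le_nr z')) ?ler_norm.
rewrite (le_trans (nr_le_ReIm _)) //= -addrA mulrDl.
have dn : `|nr z' - nr z| <= nr (z' - z).
  have := nr_le_dist z z'; have := nr_le_dist z' z; rewrite (nrC z).
  by move=> h1 h2; rewrite ler_norml; apply/andP; split; lra.
apply: lerD.
  rewrite (le_trans (ln_lip a0 azn azn')) // mulrC ler_wpM2l //.
  by rewrite invr_ge0 ltW.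
rewrite (le_trans (atan_lip _ _)) //.
have -> : complex.Im z' / complex.Re z' - complex.Im z / complex.Re z =
   (complex.Im z' - complex.Im z) / complex.Re z' -
   complex.Im z * (complex.Re z' - complex.Re z) / (complex.Re z * complex.Re z').
  by field; rewrite !gt_eqF.
have dI : `|complex.Im z' - complex.Im z| <= nr (z' - z).
  by have := Im_le_nr (z' - z); case: (z) (z') => [? ?] [? ?].
have dR : `|complex.Re z' - complex.Re z| <= nr (z' - z).
  by have := Re_le_nr (z' - z); case: (z) (z') => [? ?] [? ?].
rewrite (le_trans (ler_normB _ _)) // [X in _ <= X]mulrDl; apply: lerD.
  rewrite normrM mulrC ler_pM // normfV ger0_norm ?(ltW z0') //.
  by rewrite lef_pV2.
rewrite !normrM normfV normrM (ger0_norm (ltW z0)) (ger0_norm (ltW z0')).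
rewrite -mulrA [X in _ <= X]mulrAC -[X in _ <= X]mulrA.
apply: ler_pM => //.
- by rewrite mulr_ge0 // invr_ge0 mulr_ge0 // ltW.
- by rewrite (le_trans (Im_le_nr _)) // (le_trans zB) // ler_norm.
- apply: ler_pM => //; first by rewrite invr_ge0 mulr_ge0 // ltW.
  by rewrite lef_pV2 ?posrE ?mulr_gt0 ?exprn_gt0 // expr2 ler_pM // ltW.
Qed.

Definition zpow (m : R) (z : C) : C := cexp (m%:C%C * clog z).

Lemma zpowD m k (z : C) : zpow (m + k) z = zpow m z * zpow k z.
Proof. by rewrite /zpow rmorphD /= mulrDl cexpD. Qed.

Lemma zpowE m (z : C) :
  zpow m z = ((expR (m * ln (nr z)) * cos (m * carg z)) +i*
              (expR (m * ln (nr z)) * sin (m * carg z)))%C.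
Proof. by rewrite /zpow /cexp /= !mul0r subr0 addr0. Qed.

Lemma nr_zpow m (z : C) : 0 < complex.Re z -> nr (zpow m z) = nr z `^ m.
Proof.
move=> /Re_gt0_nr z0; rewrite /zpow nr_cexp /= mul0r subr0 /powR.
by rewrite gt_eqF.
Qed.

(** With d = log z' - log z one has z' = z e^d and z'^m = z^m e^(m d). The remainder is z^m times
    (e^(m d) - 1 - m d) - m (e^d - 1 - d): the terms linear in d cancel, and |d| = O(|z' - z|). *)
Lemma T2_zpow (m a B : R) : 0 < a ->
  T2 (rhp a B) (zpow m : C -> C^o) (fun z => m%:C%C * zpow m z / z).
Proof.
move=> a0; have [K K0 hK] := clog_lip B a0.
pose b := Num.max B a; have b0 : 0 < b by rewrite lt_max a0 orbT.
have nrb z : rhp a B z -> nr z <= b by move=> [_ h]; rewrite le_max h.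
have anr z : rhp a B z -> a <= nr z.
  by move=> [h _]; rewrite (le_trans h) // (le_trans _ (Re_le_nr z)) ?ler_norm.
pose E := expR (`|m| * (`|ln a| + `|ln b|)); have E0 : 0 <= E by exact: expR_ge0.
have hE z : rhp a B z -> nr (zpow m z) <= E.
  move=> Pz; rewrite /zpow nr_cexp /= mul0r subr0 ler_expR.
  rewrite (le_trans (ler_norm _)) // normrM ler_wpM2l //.
  have l1 : ln a <= ln (nr z) by rewrite ler_ln ?posrE ?anr // (lt_le_trans a0) ?anr.
  have l2 : ln (nr z) <= ln b.
    by rewrite ler_ln ?posrE ?nrb // (lt_le_trans a0) ?anr.
  by rewrite ler_norml; apply/andP; split; have := ler_norm (ln b);
    have := ler_norm (- ln a); rewrite normrN; have := normr_ge0 (ln a);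
    have := normr_ge0 (ln b); lra.
pose D := K * (2 * b); have D0 : 0 <= D by rewrite !mulr_ge0 // ltW.
pose D' := `|m| * D; have D'0 : 0 <= D' by rewrite mulr_ge0.
pose c1 := 4 * expR D * K ^+ 2.
pose c2 := 4 * expR D' * (`|m| * K) ^+ 2.
have c10 : 0 <= c1 by rewrite !mulr_ge0 ?expR_ge0 ?exprn_ge0.
have c20 : 0 <= c2 by rewrite !mulr_ge0 ?expR_ge0 ?exprn_ge0 ?mulr_ge0.
pose c3 := E * (`|m| * a^-1).
have c30 : 0 <= c3 by rewrite !mulr_ge0 // invr_ge0 ltW.
pose c4 := E * (c2 + `|m| * c1).
have c40 : 0 <= c4 by rewrite !mulr_ge0 // addr_ge0 // mulr_ge0.
pose c5 := E * ((1 + 4 * expR D' * D') * (`|m| * K)).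
have c50 : 0 <= c5.
  have q : 0 <= 4 * expR D' * D' by rewrite mulr_ge0 // mulr_ge0 ?expR_ge0.
  by rewrite mulr_ge0 // mulr_ge0 ?addr_ge0 // mulr_ge0.
exists (E + c3 + c4 + c5); first by rewrite !addr_ge0.
move=> z z' Pz Pz'.
have z0 : z != 0 by rewrite -nr_gt0 (lt_le_trans a0) ?anr.
have d0 : 0 <= nr (z' - z) by exact: nr_ge0.
have dz : nr (z' - z) <= 2 * b.
  by rewrite (le_trans (nrB _ _)) // mulr_natl mulr2n lerD ?nrb.
pose d := clog z' - clog z.
have hd : nr d <= K * nr (z' - z) by exact: hK.
have dD : nr d <= D by rewrite (le_trans hd) // ler_wpM2l.
have md : nr (m%:C%C * d) <= `|m| * K * nr (z' - z).
  by rewrite nrM nrR -mulrA ler_wpM2l.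
have mdD : nr (m%:C%C * d) <= D' by rewrite nrM nrR ler_wpM2l.
have ez : z' = z * cexp d.
  have R0 w : rhp a B w -> 0 < complex.Re w by move=> [h _]; exact: lt_le_trans h.
  rewrite -{1}(cexp_clog (R0 _ Pz')) -{1}(cexp_clog (R0 _ Pz)) -cexpD.
  by rewrite addrC subrK.
have ep : zpow m z' = zpow m z * cexp (m%:C%C * d).
  by rewrite /zpow -cexpD -mulrDr addrC subrK.
have hnE := hE _ Pz.
split.
- by rewrite (le_trans (hE _ Pz)) // -!addrA lerDl !addr_ge0.
- have -> : nr (m%:C%C * zpow m z / z : C^o) = nr (zpow m z) * (`|m| * (nr z)^-1).
    by rewrite [nr _]nrM nrM nrV nrR; ring.
  have : nr (zpow m z) * (`|m| * (nr z)^-1) <= c3.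
    rewrite ler_pM ?nr_ge0 ?mulr_ge0 ?invr_ge0 ?nr_ge0 //.
    by rewrite ler_wpM2l // lef_pV2 ?posrE ?anr // (lt_le_trans a0) ?anr.
  lra.
- have -> : nr (zpow m z' - zpow m z : C^o) =
      nr (zpow m z) * nr (cexp (m%:C%C * d) - 1).
    by rewrite ep -[X in _ - X]mulr1 -mulrBr [nr _]nrM.
  have : nr (zpow m z) * nr (cexp (m%:C%C * d) - 1) <= c5 * nr (z' - z).
    rewrite -[c5 * _]mulrA ler_pM ?nr_ge0 //.
    rewrite (le_trans (cexp_sub1 mdD)) // -[X in _ <= X]mulrA ler_wpM2l //.
    by rewrite addr_ge0 // mulr_ge0 // mulr_ge0 ?expR_ge0.
  have : 0 <= (E + c3 + c4) * nr (z' - z) by rewrite mulr_ge0 ?addr_ge0.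
  lra.
- pose e1 := cexp d - 1 - d; pose e2 := cexp (m%:C%C * d) - 1 - m%:C%C * d.
  have h1 : nr e1 <= c1 * nr (z' - z) ^+ 2.
    rewrite (le_trans (cexp_sub1id dD)) // /c1 -[X in _ <= X]mulrA -exprMn.
    rewrite ler_wpM2l ?mulr_ge0 ?expR_ge0 //.
    by rewrite lerXn2r ?nnegrE ?nr_ge0 // mulr_ge0.
  have h2 : nr e2 <= c2 * nr (z' - z) ^+ 2.
    rewrite (le_trans (cexp_sub1id mdD)) // /c2 -[X in _ <= X]mulrA -exprMn.
    rewrite ler_wpM2l ?mulr_ge0 ?expR_ge0 //.
    by rewrite lerXn2r ?nnegrE ?nr_ge0 ?mulr_ge0.
  have -> : zpow m z' - zpow m z - (z' - z) *: (m%:C%C * zpow m z / z : C^o) =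
      zpow m z * (e2 - m%:C%C * e1).
    rewrite -[(z' - z) *: _]/((z' - z) * _) ep ez /e1 /e2.
    by field.
  rewrite [nr _]nrM.
  have : nr (e2 - m%:C%C * e1) <= (c2 + `|m| * c1) * nr (z' - z) ^+ 2.
    rewrite (le_trans (nrB _ _)) // nrM nrR mulrDl lerD // -mulrA ler_wpM2l //.
  move=> h3; have := ler_pM (nr_ge0 _) (nr_ge0 _) hnE h3.
  rewrite mulrA -/c4.
  have : 0 <= (E + c3 + c5) * nr (z' - z) ^+ 2.
    by rewrite mulr_ge0 ?addr_ge0 ?exprn_ge0.
  lra.
Qed.

End ComplexExp.

(** * Negative binomial weights and the Post-Widder formula *)

Section NegativeBinomial.
Context {R : realType}.

Lemma natr_bound_le (x : R) n : 0 <= x -> (Num.bound x <= n)%N -> x <= n%:R.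
Proof. by move=> x0 xn; rewrite ltW // (lt_le_trans (archi_boundP x0)) // ler_nat. Qed.

(** The probability that, in independent trials with success rate [p], success number n + 1 occurs
    at trial j + 1; it is 0 for j < n. *)
Definition nbw (n : nat) (p : R) (j : nat) : R :=
  'C(j, n)%:R * p ^+ n.+1 * (1 - p) ^+ (j - n).

(** The probability of at most [n] successes in [N] trials, that is, the mass left out by the first
    [N] weights [nbw n p]. *)
Definition btail (n : nat) (p : R) (N : nat) : R :=
  \sum_(m < n.+1) 'C(N, m)%:R * p ^+ m * (1 - p) ^+ (N - m).

Lemma nbw_ge0 n (p : R) j : 0 <= p <= 1 -> 0 <= nbw n p j.
Proof. by move=> /andP[p0 p1]; rewrite !mulr_ge0 ?exprn_ge0 // subr_ge0. Qed.

Lemma btail_ge0 n (p : R) N : 0 <= p <= 1 -> 0 <= btail n p N.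
Proof.
move=> /andP[p0 p1]; apply: sumr_ge0 => m _.
by rewrite !mulr_ge0 ?exprn_ge0 // subr_ge0.
Qed.

(** Pascal's rule writes each term for N + 1 as 1 - p times the same term for N plus p times the
    preceding one; the sum is the one for N less p times its last term. *)
Lemma btailS n (p : R) N : btail n p N.+1 = btail n p N - nbw n p N.
Proof.
pose a m : R := 'C(N, m)%:R * p ^+ m * (1 - p) ^+ (N - m).
have aS m : 'C(N, m)%:R * p ^+ m * (1 - p) ^+ (N.+1 - m) = (1 - p) * a m.
  rewrite /a; case: (leqP m N) => mN.
    by rewrite subSn // exprS; ring.
  by rewrite bin_small // !mul0r mulr0.
have nE : nbw n p N = p * a n by rewrite /nbw /a exprS; ring.
rewrite /btail big_ord_recl /= bin0 expr0 !mul1r subn0.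
have -> : \sum_(i < n) 'C(N.+1, bump 0 i)%:R * p ^+ bump 0 i *
      (1 - p) ^+ (N.+1 - bump 0 i) =
    \sum_(i < n) (1 - p) * a i.+1 + \sum_(i < n) p * a i.
  rewrite -big_split /=; apply: eq_bigr => i _.
  rewrite /bump leq0n add1n binS natrD mulrDl mulrDl aS; congr (_ + _).
  by rewrite subSS exprS /a; ring.
have -> : (1 - p) ^+ N.+1 = (1 - p) * a 0%N.
  by rewrite /a bin0 expr0 !mul1r subn0 exprS.
rewrite -/(btail n p N) addrA.
have -> : (1 - p) * a 0%N + \sum_(i < n) (1 - p) * a i.+1 =
    \sum_(i < n.+1) (1 - p) * a i by rewrite [RHS]big_ord_recl.
rewrite -!mulr_sumr nE big_ord_recr /=.
rewrite [X in _ = X - _](_ : _ = \sum_(i < n) a i + a n); last first.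
  by rewrite /btail big_ord_recr.
ring.
Qed.

Lemma sum_nbw n (p : R) N : \sum_(j < N) nbw n p j = 1 - btail n p N.
Proof.
elim: N => [|N IH]; last by rewrite big_ord_recr /= IH btailS; ring.
rewrite big_ord0 /btail big_ord_recl /= bin0 expr0 !mulr1 big1 ?addr0 ?subrr //.
by move=> i _; rewrite /bump leq0n add1n bin0n !mul0r.
Qed.

(** A Chernoff bound: 1 <= 2^n / 2^m for m <= n, and the full binomial sum with p / 2 in place of p
    is (1 - p/2)^N. *)
Lemma btail_le n (p : R) N : 0 <= p <= 1 -> btail n p N <= 2 ^+ n * expR (- (p / 2 * N%:R)).
Proof.
move=> /andP[p0 p1].
have q0 : 0 <= 1 - p by rewrite subr_ge0.
pose b m : R := 'C(N, m)%:R * (p / 2) ^+ m * (1 - p) ^+ (N - m).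
have b0 m : 0 <= b m by rewrite !mulr_ge0 ?exprn_ge0 ?divr_ge0.
have sb : \sum_(m < N.+1) b m = (1 - p / 2) ^+ N.
  rewrite (_ : 1 - p / 2 = (1 - p) + p / 2); last by field.
  rewrite exprDn; apply: eq_bigr => m _.
  by rewrite /b -mulr_natl; ring.
apply: (@le_trans _ _ (2 ^+ n * \sum_(m < n.+1) b m)).
  rewrite /btail mulr_sumr; apply: ler_sum => m _.
  rewrite /b expr_div_n.
  have -> : 2 ^+ n * ('C(N, m)%:R * (p ^+ m / 2 ^+ m) * (1 - p) ^+ (N - m)) =
      ('C(N, m)%:R * p ^+ m * (1 - p) ^+ (N - m)) * (2 ^+ n / 2 ^+ m) :> R by ring.
  rewrite ler_peMr // ?mulr_ge0 ?exprn_ge0 //.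
  rewrite ler_pdivlMr ?exprn_gt0 // mul1r ler_weXn2l ?ler1n // -ltnS.
  exact: ltn_ord.
rewrite ler_wpM2l ?exprn_ge0 //.
apply: (@le_trans _ _ (\sum_(m < N.+1) b m)).
  have ext k : \sum_(m < N.+1) b m = \sum_(m < N.+1 + k) b m.
    elim: k => [|k IH]; first by rewrite addn0.
    rewrite addnS [RHS]big_ord_recr /= -IH /b bin_small ?mul0r ?addr0 //.
    by rewrite ltnS leq_addr.
  rewrite (ext n.+1) addnC.
  have : forall k, \sum_(m < n.+1) b m <= \sum_(m < n.+1 + k) b m.
    elim=> [|k IH]; first by rewrite addn0.
    by rewrite addnS [X in _ <= X]big_ord_recr /= (le_trans IH) // lerDl.
  exact.
rewrite sb [leRHS](_ : _ = expR (- (p / 2)) ^+ N); last by rewrite -expRM_natr mulNr.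
rewrite lerXn2r ?nnegrE ?expR_ge0 ?subr_ge0 //; last first.
  by have := expR_ge1Dx (- (p / 2)).
by rewrite ler_pdivrMr // (le_trans p1) // mul1r ler1n.
Qed.

(** Chebyshev's ingredient. The identity (j+1) C(j,n) = (n+1) C(j+1,n+1) turns moments into masses
    with a larger n. The first moment enters with a negative sign and is computed exactly, up to a
    tail; the second is only bounded above, through (j+1)^2 <= (j+1)(j+2). *)
Lemma nbw_moment2 n (p : R) N : 0 <= p <= 1 -> (0 < n)%N ->
  \sum_(j < N) nbw n p j * (j.+1%:R * p / n%:R - 1) ^+ 2 <=
  4 / n%:R + 4 * btail n.+1 p N.+1.
Proof.
move=> p01 n0; have n0' : (n%:R : R) != 0 by rewrite pnatr_eq0 -lt0n.
have s1 j : j.+1%:R * p * nbw n p j = n.+1%:R * nbw n.+1 p j.+1.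
  rewrite /nbw subSS [p ^+ n.+2]exprS -!mulrA ![_%:R * (_ * _)]mulrA.
  rewrite !mulrA -natrM mulrC.
  have := mul_bin_diag j.+1 n; rewrite /= => <-.
  by rewrite natrM; ring.
have le1 k M : \sum_(j < M) nbw k p j <= 1.
  by rewrite sum_nbw gerBl btail_ge0.
have shift k M : \sum_(j < M) nbw k.+1 p j.+1 = \sum_(j < M.+1) nbw k.+1 p j.
  by rewrite [RHS]big_ord_recl /= /nbw bin0n !mul0r add0r.
have m1 : \sum_(j < N) j.+1%:R * p * nbw n p j = n.+1%:R * (1 - btail n.+1 p N.+1).
  by rewrite -sum_nbw -shift mulr_sumr; apply: eq_bigr => j _; rewrite s1.
have m2 : \sum_(j < N) (j.+1%:R * p) ^+ 2 * nbw n p j <= n.+1%:R * n.+2%:R.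
  apply: (@le_trans _ _ (n.+1%:R * n.+2%:R * \sum_(j < N.+2) nbw n.+2 p j)); last first.
    by rewrite ler_piMr // mulr_ge0.
  rewrite -shift big_ord_recl /= [X in X + _](_ : _ = 0); last first.
    by rewrite /nbw bin_small // !mul0r.
  rewrite add0r mulr_sumr; apply: ler_sum => j _.
  rewrite /bump leq0n add1n.
  have -> : n.+1%:R * n.+2%:R * nbw n.+2 p j.+2 =
     j.+2%:R * p * (j.+1%:R * p * nbw n p j).
    rewrite s1.
    have s2 : j.+2%:R * p * nbw n.+1 p j.+1 = n.+2%:R * nbw n.+2 p j.+2.
      rewrite /nbw !subSS [p ^+ n.+3]exprS.
      have := mul_bin_diag j.+2 n.+1; rewrite /= => h.
      have -> : n.+2%:R * ('C(j.+2, n.+2)%:R * (p * p ^+ n.+2) * (1 - p) ^+ (j - n)) =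
        (n.+2 * 'C(j.+2, n.+2))%:R * (p * p ^+ n.+2) * (1 - p) ^+ (j - n).
        by rewrite natrM; ring.
      by rewrite -h natrM; ring.
    by rewrite -mulrA -s2; ring.
  rewrite expr2 -[X in X <= _]mulrA ler_wpM2r //.
    have nn := nbw_ge0 n j p01; case/andP: p01 => p0 _.
    by rewrite mulr_ge0 // mulr_ge0.
  by case/andP: p01 => p0 _; rewrite ler_wpM2r // ler_nat.
have -> : \sum_(j < N) nbw n p j * (j.+1%:R * p / n%:R - 1) ^+ 2 =
    (\sum_(j < N) (j.+1%:R * p) ^+ 2 * nbw n p j) / n%:R ^+ 2
    - 2 / n%:R * (\sum_(j < N) j.+1%:R * p * nbw n p j) + \sum_(j < N) nbw n p j.
  rewrite mulr_suml mulr_sumr -sumrB -big_split /=; apply: eq_bigr => j _.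
  by field.
rewrite m1.
have h0 := le1 n N.
have T0 := btail_ge0 n.+1 N.+1 p01.
have x1 : 1 <= (n%:R : R) by rewrite ler1n.
have x0 : 0 < (n%:R : R) by rewrite ltr0n.
have h2 : (\sum_(j < N) (j.+1%:R * p) ^+ 2 * nbw n p j) / n%:R ^+ 2 <=
   n.+1%:R * n.+2%:R / n%:R ^+ 2.
  by rewrite ler_wpM2r // invr_ge0 exprn_ge0.
apply: (le_trans (lerD (lerD h2 (lexx _)) h0)).
rewrite -(natr1 n) -(natr1 n.+1) -(natr1 n).
set x : R := n%:R in n0' x1 x0 *; set T := btail _ _ _ in T0 *.
have -> : (x + 1) * (x + 1 + 1) / x ^+ 2 - 2 / x * ((x + 1) * (1 - T)) + 1 =
   (x + 2) / x / x + 2 * T * (1 + 1 / x) by field.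
have i1 : 1 / x <= 1 by rewrite ler_pdivrMr // mul1r.
have i2 : (x + 2) / x <= 3 by rewrite ler_pdivrMr //; lra.
have i3 : (x + 2) / x / x <= 3 / x by rewrite ler_wpM2r // invr_ge0 ltW.
have i4 : 3 / x <= 4 / x by rewrite ler_wpM2r // ?invr_ge0 ?ltW //; lra.
have i5 : 2 * T * (1 + 1 / x) <= 2 * T * 2.
  by rewrite ler_wpM2l ?mulr_ge0 //; lra.
lra.
Qed.

Lemma natr_mul_expR_small (c e : R) : 0 < c -> 0 < e ->
  exists n0 : nat, forall n, (n0 <= n)%N -> n%:R * expR (- (c * n%:R)) <= e.
Proof.
move=> c0 e0.
exists (Num.bound (2 / (c ^+ 2 * e))).+1 => n hn.
have n0 : 0 < (n%:R : R) by rewrite ltr0n (leq_trans _ hn).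
have x0 : 0 < c * n%:R by rewrite mulr_gt0.
have h : (c * n%:R) ^+ 2 / 2 <= expR (c * n%:R).
  by rewrite (le_trans _ (expR_ge1Dxn 1 (ltW x0))) // lerDr.
rewrite expRN ler_pdivrMr ?expR_gt0 //.
apply: (le_trans _ (ler_wpM2l (ltW e0) h)).
have hb : 2 / (c ^+ 2 * e) <= n%:R.
  by rewrite natr_bound_le 1?ltnW // divr_ge0 // mulr_ge0 ?exprn_ge0 // ltW.
have ce0 : 0 < c ^+ 2 * e by rewrite mulr_gt0 // exprn_gt0.
rewrite ler_pdivrMr // in hb.
have -> : e * ((c * n%:R) ^+ 2 / 2) = n%:R * (n%:R * (c ^+ 2 * e)) / 2 by field.
rewrite -[X in X <= _]mulr1 -[X in _ <= X]mulrA ler_wpM2l ?(ltW n0) //.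
by rewrite ler_pdivlMr // mul1r.
Qed.

(** 2^n is the cost of dividing by w^n on the circle |w| = 1/2, and e^(-n) the gain of cutting the
    Laplace integral at 2 t; the gain wins because 2 < e. *)
Lemma natr_exp2_expR_small (e : R) : 0 < e ->
  exists n0 : nat, forall n, (n0 <= n)%N -> n%:R * (2 ^+ n * expR (- n%:R)) <= e.
Proof.
move=> e0; pose c : R := 1 - ln 2.
have c0 : 0 < c.
  rewrite subr_gt0 -ltr_expR lnK ?posrE //.
  by have := @expR_gt1Dx R 1 (oner_neq0 _); rewrite -[1 + 1]/(2%:R).
have [n0 h] := natr_mul_expR_small c0 e0.
exists n0 => n /h; congr (_ * _ <= _).
have -> : (2 : R) ^+ n = expR (ln 2 * n%:R) by rewrite expRM_natr lnK ?posrE.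
by rewrite -expRD; congr expR; rewrite /c; ring.
Qed.

End NegativeBinomial.

(** * Concentration of the weights at t *)

Section PostWidder.
Context {R : realType}.
Local Notation C := R[i].

(* With [lam = n / t], [p = lam * delta] and [delta = 2 * t / N] the weights
   [nbw n p j] are the coefficients of [w ^ n] in
   [lam * delta * (1 - lam * (1 - w) * delta) ^ j]. *)
Lemma post_widder (V : normedModType C) (v : R -> V) (t B : R) : 0 < t ->
  (forall s : R, 0 <= s <= 2 * t -> nr (v s) <= B) ->
  (forall e : R, 0 < e -> exists2 d : R, 0 < d &
     forall s : R, 0 <= s -> `|s - t| < d -> nr (v s - v t) <= e) ->
  forall e : R, 0 < e -> exists n0 : nat, forall n, (n0 <= n)%N ->
  exists N0 : nat, forall N, (N0 <= N)%N ->
   nr (\sum_(j < N) (nbw n (2 * n%:R / N%:R) j)%:C%C *: v (j%:R * (2 * t / N%:R)) - v t)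
     <= e.
Proof.
move=> t0 hB hc e e0.
have B0 : 0 <= B.
  by rewrite (le_trans (nr_ge0 (v 0))) // hB // lexx mulr_ge0 // ltW.
have [d d0 hd] := hc (e / 4) (divr_gt0 e0 (ltr0n _ 4)).
(* Chebyshev factor: a node at distance at least [d] from [t] has relative deviation at least d / (2
   t), half of [d] being given up for the shift from j to j + 1, so [k] times its square is at least
   1. *)
pose k := (2 * t / d) ^+ 2; have k0 : 0 <= k by rewrite exprn_ge0 // !mulr_ge0 ?invr_ge0 // ltW.
pose A := 2 * B * k; have A0 : 0 <= A by rewrite mulr_ge0 // mulr_ge0.
(* The total error comes to e / 4 + 12 A e' + B e'. *)
pose e' := e / (16 * (A + B + 1)).
have e'0 : 0 < e' by rewrite divr_gt0 // mulr_gt0 // ltr_wpDl // addr_ge0.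
have [n1 h1] := natr_exp2_expR_small e'0.
exists (maxn n1.+1 (Num.bound e'^-1)) => n hn.
have nn1 : (n1 < n)%N by rewrite (leq_trans _ hn) // leq_maxl.
have n0 : (0 < n)%N by exact: leq_ltn_trans nn1.
have nR1 : 1 <= (n%:R : R) by rewrite ler1n.
have hni : 4 / n%:R <= 4 * e'.
  rewrite ler_wpM2l // -[leRHS]invrK lef_pV2 ?posrE ?ltr0n ?invr_gt0 //.
  rewrite natr_bound_le ?invr_ge0 ?(ltW e'0) //.
  by rewrite (leq_trans _ hn) // leq_maxr.
have a0 : 0 <= 2 ^+ n * expR (- n%:R) :> R by rewrite mulr_ge0 ?exprn_ge0 ?expR_ge0.
have ha : 2 ^+ n * expR (- n%:R) <= e' by rewrite (le_trans _ (h1 _ (ltnW nn1))) // ler_peMl.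
(* The first entry makes p <= 1, the second makes the step 2 t / N at most d / 2. *)
exists (maxn (2 * n).+1 (Num.bound (4 * t / d))) => N hN.
have NN : (2 * n < N)%N by rewrite (leq_trans _ hN) // leq_maxl.
have N0 : 0 < (N%:R : R) by rewrite ltr0n (leq_ltn_trans _ NN).
have Nn0 : (N%:R : R) != 0 by rewrite gt_eqF.
set p := 2 * n%:R / N%:R; set dl := 2 * t / N%:R.
have p01 : 0 <= p <= 1.
  rewrite divr_ge0 ?mulr_ge0 //= ler_pdivrMr // mul1r -natrM ler_nat.
  exact: ltnW.
have dl0 : 0 < dl by rewrite divr_gt0 // mulr_gt0.
have dld : dl <= d / 2.
  rewrite /dl ler_pdivrMr //.
  have : 4 * t / d <= N%:R.
    rewrite natr_bound_le ?(leq_trans _ hN) ?leq_maxr //.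
    by rewrite !mulr_ge0 // ?invr_ge0 ltW.
  by rewrite ler_pdivrMr //; lra.
have T1 : btail n p N <= e'.
  rewrite (le_trans (btail_le _ _ p01)) //.
  by have -> : p / 2 * N%:R = n%:R by rewrite /p; field.
have T2 : btail n.+1 p N.+1 <= 2 * e'.
  rewrite (le_trans (btail_le _ _ p01)) // exprS -mulrA ler_wpM2l //.
  rewrite (le_trans _ ha) // ler_wpM2l ?exprn_ge0 // ler_expR lerN2.
  rewrite -(natr1 N) mulrDr mulr1.
  have -> : p / 2 * N%:R = n%:R by rewrite /p; field.
  by rewrite lerDl divr_ge0 //; case/andP: p01.
have M2 := nbw_moment2 N p01 n0.
have sW := sum_nbw n p N.
have t2t : 0 <= t <= 2 * t by rewrite ltW //= ler_peMl ?ler1n // ltW.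
have -> : \sum_(j < N) (nbw n p j)%:C%C *: v (j%:R * dl) - v t =
   \sum_(j < N) (nbw n p j)%:C%C *: (v (j%:R * dl) - v t)
   - (btail n p N)%:C%C *: v t.
  under [in RHS]eq_bigr do rewrite scalerBr.
  rewrite sumrB -scaler_suml -rmorph_sum /= sW rmorphB /= rmorph1 scalerBl scale1r.
  by rewrite opprB addrA addrAC addrK.
rewrite (le_trans (nrB _ _)) // nrZ nrR (ger0_norm (btail_ge0 _ _ p01)).
have hB2 : btail n p N * nr (v t) <= e' * B.
  by rewrite ler_pM ?btail_ge0 ?nr_ge0 // hB.
have hj (j : 'I_N) : nr (v (j%:R * dl) - v t) <=
    e / 4 + A * (j.+1%:R * p / n%:R - 1) ^+ 2.
  have jd0 : 0 <= j%:R * dl by rewrite mulr_ge0 // ltW.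
  case: (ltP `|j%:R * dl - t| d) => hjd.
    by rewrite (le_trans (hd _ jd0 hjd)) // lerDl mulr_ge0 // sqr_ge0.
  have jB : nr (v (j%:R * dl) - v t) <= 2 * B.
    rewrite (le_trans (nrB _ _)) // [leRHS]mulr_natl [leRHS]mulr2n lerD ?hB // jd0 /=.
    rewrite /dl mulrA ler_pdivrMr // mulrC ler_wpM2l ?mulr_ge0 ?(ltW t0) //.
    by rewrite ler_nat ltnW.
  rewrite (le_trans jB) // -[leLHS]add0r lerD ?divr_ge0 ?(ltW e0) //.
  rewrite /A -mulrA ler_peMr ?mulr_ge0 // /k -exprMn.
  rewrite -[X in _ <= X]real_normK ?num_real // exprn_ege1 //.
  have -> : 2 * t / d * (j.+1%:R * p / n%:R - 1) = 2 / d * (j.+1%:R * dl - t).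
    by rewrite /p /dl; field; rewrite Nn0 !gt_eqF // ltr0n.
  rewrite normrM ger0_norm ?divr_ge0 ?(ltW d0) //.
  rewrite mulrAC ler_pdivlMr // mul1r mulrC -ler_pdivrMr //.
  have -> : j.+1%:R * dl - t = (j%:R * dl - t) + dl by rewrite -natr1; ring.
  have := ler_normB ((j%:R * dl - t) + dl) dl; rewrite addrK (ger0_norm (ltW dl0)); lra.
have hS : nr (\sum_(j < N) (nbw n p j)%:C%C *: (v (j%:R * dl) - v t)) <=
    e / 4 + A * (4 / n%:R + 4 * btail n.+1 p N.+1).
  rewrite (le_trans (nr_sum _ _ _)) //.
  apply: (@le_trans _ _ (\sum_(j < N) (nbw n p j * (e / 4) +
      A * (nbw n p j * (j.+1%:R * p / n%:R - 1) ^+ 2)))).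
    apply: ler_sum => j _; rewrite nrZ nrR ger0_norm ?nbw_ge0 //.
    by rewrite [X in _ <= _ + X]mulrCA -mulrDr ler_wpM2l ?nbw_ge0.
  rewrite big_split /= -mulr_suml -mulr_sumr lerD //; last by rewrite ler_wpM2l.
  rewrite ler_piMl ?divr_ge0 ?(ltW e0) // sW gerBl; exact: btail_ge0.
have hA : A * (4 / n%:R + 4 * btail n.+1 p N.+1) <= A * (12 * e').
  by rewrite ler_wpM2l //; lra.
have eE : e = 16 * (A * e' + B * e' + e').
  by rewrite /e'; field; rewrite gt_eqF // ltr_wpDl // addr_ge0.
have Ae : 0 <= A * e' by rewrite mulr_ge0 // ltW.
have Be : 0 <= B * e' by rewrite mulr_ge0 // ltW.
lra.
Qed.

End PostWidder.

(** * Averages over roots of unity *)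

Section Circle.
Context {R : realType}.
Local Notation C := R[i].

Definition om (M : nat) : C := cexp (0 +i* (2 * pi / M%:R))%C.

Lemma nr_om M : nr (om M) = 1.
Proof. by rewrite nr_cexp /= expR0. Qed.

Lemma om_neq0 M : om M != 0.
Proof. exact: cexp_neq0. Qed.

Lemma omX M k : om M ^+ k = cexp (0 +i* (k%:R * (2 * pi / M%:R)))%C.
Proof.
rewrite -cexpX; congr cexp.
have -> : (k%:R : C) = (k%:R : R)%:C%C by rewrite rmorph_nat.
by apply/eqP; rewrite eq_complex /= !mul0r mulr0 subr0 addr0 !eqxx.
Qed.

Lemma nr_omX M k : nr (om M ^+ k) = 1.
Proof. by rewrite nrX nr_om expr1n. Qed.

Lemma om_unity M : (0 < M)%N -> om M ^+ M = 1.
Proof.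
move=> M0; rewrite omX mulrC divfK ?pnatr_eq0 -?lt0n // /cexp /= expR0 !mul1r.
by rewrite mulr_natl cos2pi sin2pi.
Qed.

(** Otherwise cos (2 theta) = 1, hence sin theta = 0, for theta = k pi / M strictly between 0 and
    pi. *)
Lemma om_prim M k : (0 < k < M)%N -> om M ^+ k != 1.
Proof.
move=> /andP[k0 kM]; apply/eqP; rewrite omX => /(congr1 (@complex.Re R)).
rewrite /cexp /= expR0 mul1r.
have M0 : 0 < (M%:R : R) by rewrite ltr0n (ltn_trans k0).
set th : R := k%:R * pi / M%:R.
have -> : k%:R * (2 * pi / M%:R) = th *+ 2 by rewrite /th -mulr_natl; ring.
rewrite cos_mulr2n cos2sin2 => h.
have : 0 < sin th.
  apply: sin_gt0_pi; rewrite /th; apply/andP; split.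
    by rewrite divr_gt0 // mulr_gt0 ?pi_gt0 // ltr0n.
  by rewrite ltr_pdivrMr // mulrC ltr_pM2l ?pi_gt0 // ltr_nat.
move=> s0; have : 0 < sin th ^+ 2 by rewrite exprn_gt0.
by move: h; rewrite -mulr_natl; lra.
Qed.

Lemma sum_unity (M : nat) (z : C) : z ^+ M = 1 -> z != 1 -> \sum_(k < M) z ^+ k = 0.
Proof.
move=> zM z1; apply/eqP; rewrite -(mulrI_eq0 _ (@mulfI _ (z - 1) _)) ?subr_eq0 //.
by rewrite -subrX1 zM subrr.
Qed.

(** Discrete stand-in for the mean over the circle of radius [s]; with a factor w^(-n) inside [f] it
    extracts the coefficient of w^n. *)
Definition cavg {V : lmodType C} (M : nat) (f : C -> V) (s : R) : V :=
  (M%:R : C)^-1 *: \sum_(k < M) f (s%:C%C * om M ^+ k).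

(* Aliasing: averaging over [M] nodes recovers the coefficient of [w ^ n] up to
   the coefficients of [w ^ (n + M)], [w ^ (n + 2 M)], ... *)
Lemma cavg_binomial (p s : R) (n M j : nat) : 0 <= p <= 1 -> 0 < s <= 1 -> (n < M)%N ->
  nr (cavg M ((fun w => (1 - p%:C%C + p%:C%C * w) ^+ j / w ^+ n) : C -> C^o) s -
      ('C(j, n)%:R * p ^+ n * (1 - p) ^+ (j - n))%:C%C) <= s ^+ M.
Proof.
move=> /andP[p0 p1] /andP[s0 s1] nM.
have M0 : (0 < M)%N by exact: leq_ltn_trans nM.
pose c m : R := 'C(j, m)%:R * p ^+ m * (1 - p) ^+ (j - m).
have c0 m : 0 <= c m by rewrite !mulr_ge0 ?exprn_ge0 ?subr_ge0.
have sc : \sum_(m < j.+1) c m = 1.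
  rewrite -[RHS](expr1n _ j) -[in RHS](subrK p 1) exprDn; apply: eq_bigr => m _.
  by rewrite /c -mulr_natl; ring.
(* The weight with which the coefficient of w^m enters the average: 1 for m = n, 0 for any other m <
   n + M, because m and n then differ modulo M, and at most 1 in modulus beyond. *)
pose a m : C := (M%:R)^-1 * \sum_(k < M) (om M ^+ m / om M ^+ n) ^+ k.
have M0C : (M%:R : C) != 0 by rewrite pnatr_eq0 -lt0n.
have an : a n = 1.
  rewrite /a divff ?expf_neq0 ?om_neq0 //.
  under eq_bigr do rewrite expr1n.
  by rewrite sumr_const card_ord mulVf.
have a0 m : (m < n + M)%N -> m != n -> a m = 0.
  move=> mM mn; rewrite /a sum_unity ?mulr0 //.
    by rewrite expr_div_n -!exprM ![(_ * M)%N]mulnC !exprM om_unity // !expr1n divr1.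
  apply/eqP => /(congr1 ( *%R^~ (om M ^+ n))); rewrite divfK ?expf_neq0 ?om_neq0 // mul1r.
  case: (ltngtP m n) mn => // h _ /eqP.
    rewrite -(subnK (ltnW h)) exprD -{1}[om M ^+ m]mul1r.
    rewrite (inj_eq (mulIf (expf_neq0 _ (om_neq0 _)))) eq_sym; apply/negP.
    by rewrite om_prim // subn_gt0 h /= (leq_ltn_trans (leq_subr _ _)).
  rewrite -(subnK (ltnW h)) exprD -{2}[om M ^+ n]mul1r.
  rewrite (inj_eq (mulIf (expf_neq0 _ (om_neq0 _)))); apply/negP.
  by rewrite om_prim // subn_gt0 h /= ltn_subLR // ltnW.
have an1 m : nr (a m) <= 1.
  rewrite /a nrM nrV.
  have -> : nr (M%:R : C) = M%:R by rewrite -(rmorph_nat (@real_complex R)) nrR ger0_norm.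
  rewrite mulrC ler_pdivrMr ?ltr0n // mul1r (le_trans (nr_sum _ _ _)) //.
  apply: (@le_trans _ _ (\sum_(k < M) 1)); last by rewrite sumr_const card_ord.
  apply: ler_sum => k _; rewrite nrX nrM nrV !nr_omX invr1 mulr1 expr1n //.
have s0C : (s%:C%C : C) != 0 by rewrite (inj_eq (@complexI R)) gt_eqF.
have E : cavg M ((fun w => (1 - p%:C%C + p%:C%C * w) ^+ j / w ^+ n) : C -> C^o) s =
    \sum_(m < j.+1) (c m * (s ^+ m / s ^+ n))%:C%C * a m.
  rewrite /cavg -[LHS]/(_ * _).
  under [in RHS]eq_bigr do rewrite /a mulrCA mulr_sumr.
  rewrite -mulr_sumr; congr (_ * _); rewrite exchange_big /=.
  apply: eq_bigr => k _; rewrite exprDn mulr_suml; apply: eq_bigr => m _.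
  rewrite /c -mulr_natr !rmorphM fmorphV !rmorphXn rmorphB rmorph_nat rmorph1 /=.
  rewrite !exprMn !exprVn -!exprM [(m * k)%N]mulnC [(n * k)%N]mulnC.
  by field; rewrite !expf_neq0 ?om_neq0.
rewrite E -/(c n).
have -> : \sum_(m < j.+1) (c m * (s ^+ m / s ^+ n))%:C%C * a m - (c n)%:C%C =
   \sum_(m < j.+1 | (nat_of_ord m) != n) (c m * (s ^+ m / s ^+ n))%:C%C * a m.
  case: (ltnP n j.+1) => nj.
    rewrite (bigD1 (Ordinal nj)) //= an divff ?expf_neq0 ?gt_eqF // !mulr1.
    by rewrite addrAC subrr add0r.
  have -> : c n = 0 by rewrite /c bin_small // !mul0r.
  rewrite rmorph0 subr0; apply: eq_bigl => m; symmetry; apply/eqP => mn.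
  by have := ltn_ord m; rewrite mn ltnNge nj.
rewrite (le_trans (nr_sum _ _ _)) //.
apply: (@le_trans _ _ (\sum_(m < j.+1 | (nat_of_ord m) != n) c m * s ^+ M)).
  apply: ler_sum => m mn; rewrite nrM nrR.
  case: (ltnP m (n + M)) => mM.
    by rewrite a0 // nr0 mulr0 mulr_ge0 ?exprn_ge0 // ltW.
  have sn0 : s ^+ n != 0 by rewrite expf_neq0 // gt_eqF.
  have -> : s ^+ m / s ^+ n = s ^+ (m - n).
    rewrite -{1}(subnK (leq_trans (leq_addr _ _) mM)) exprD mulfK //.
  have cs : 0 <= c m * s ^+ (m - n) by rewrite mulr_ge0 // exprn_ge0 // ltW.
  rewrite ger0_norm // -[leRHS]mulr1.
  apply: ler_pM => //; [exact: nr_ge0|rewrite ler_wpM2l //].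
  by rewrite ler_wiXn2l ?(ltW s0) // leq_subRL // (leq_trans _ mM) // leq_addr.
rewrite -mulr_suml ler_piMl ?exprn_ge0 ?(ltW s0) // -sc.
rewrite [leRHS](bigID (fun m : 'I__ => nat_of_ord m != n)) /= lerDl.
by apply: sumr_ge0.
Qed.

Lemma sum_shift_periodic (V : zmodType) (H : nat -> V) M : H M = H 0%N ->
  \sum_(k < M) H k.+1 = \sum_(k < M) H k.
Proof.
move=> hM; apply/eqP; rewrite -subr_eq0 -sumrB.
by rewrite -(big_mkord xpredT (fun k => H k.+1 - H k)) telescope_sumr // hM subrr.
Qed.

Lemma om_sub1id M n : (0 < M)%N -> 2 * pi * n%:R <= (M%:R : R) ->
  nr (om M ^+ n - 1 - (0 +i* (2 * pi * n%:R / M%:R))%C) <=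
  4 * expR 1 * (2 * pi * n%:R / M%:R) ^+ 2.
Proof.
move=> M0 nM; rewrite omX.
have -> : n%:R * (2 * pi / M%:R) = 2 * pi * n%:R / M%:R :> R by ring.
set x : R := 2 * pi * n%:R / M%:R.
have x0 : 0 <= x by rewrite !mulr_ge0 ?invr_ge0 ?pi_ge0.
have nx : nr (0 +i* x)%C = x.
  by rewrite /nr normc_def /= expr0n add0r sqrtr_sqr ger0_norm.
have := @cexp_sub1id R 1 (0 +i* x)%C; rewrite nx; apply.
by rewrite /x ler_pdivrMr ?ltr0n // mul1r.
Qed.

Lemma om_sub1_le M : (0 < M)%N -> 2 * pi <= (M%:R : R) ->
  nr (om M - 1) <= (1 + 4 * expR 1) * (2 * pi / M%:R).
Proof.
move=> M0 hM; have := @om_sub1id M 1 M0; rewrite mulr1 expr1 => /(_ hM).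
set x : R := 2 * pi / M%:R => h.
have x0 : 0 <= x by rewrite !mulr_ge0 ?invr_ge0 ?pi_ge0.
have x1 : x <= 1 by rewrite /x ler_pdivrMr ?ltr0n // mul1r.
have nx : nr (0 +i* x)%C = x.
  by rewrite /nr normc_def /= expr0n add0r sqrtr_sqr ger0_norm.
have := nr_le_dist (om M - 1) (0 +i* x)%C; rewrite nx.
have : 4 * expR 1 * x ^+ 2 <= 4 * expR 1 * x.
  by rewrite ler_wpM2l ?mulr_ge0 ?expR_ge0 // expr2 ler_piMl.
lra.
Qed.

(** Chords against arcs: the defect is at most 4 e x^2 for an arc x, hence at most x / 3 once 12 e x
    <= 1. The threshold is taken for n + 1 so that it covers the arcs of both 1 and n steps. *)
Lemma om_sub1_bounds n : exists M0 : nat, forall M, (M0 <= M)%N ->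
  [/\ (0 < M)%N, 2 * pi <= (M%:R : R),
   nr (om M - 1) <= (1 + 4 * expR 1) * (2 * pi / M%:R),
   nr (om M - 1) <= 4 / 3 * (2 * pi / M%:R) &
   2 / 3 * (2 * pi * n%:R / M%:R) <= nr (om M ^+ n - 1)].
Proof.
pose k : R := 12 * expR 1 * (2 * pi * n.+1%:R).
have p0 : 0 < 2 * pi :> R by rewrite mulr_gt0 // pi_gt0.
have k0 : 0 <= k by rewrite /k !mulr_ge0 ?expR_ge0 ?pi_ge0.
have e1 : 1 <= expR 1 :> R by rewrite (le_trans _ (expR_ge1Dx 1)) // lerDl.
exists (Num.bound k).+1 => M hM.
have kM : k <= M%:R by rewrite natr_bound_le // ltnW.
have M0 : (0 < M)%N by exact: leq_trans hM.
have MR : 0 < (M%:R : R) by rewrite ltr0n.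
have n1 : 2 * pi * n.+1%:R <= k.
  rewrite /k ler_peMl ?mulr_ge0 ?pi_ge0 //; lra.
have h1 : 2 * pi <= (M%:R : R).
  rewrite (le_trans _ kM) // (le_trans _ n1) // ler_peMr ?(ltW p0) // ler1n //.
have h2 : 2 * pi * n%:R <= (M%:R : R).
  by rewrite (le_trans _ kM) // (le_trans _ n1) // ler_wpM2l ?(ltW p0) // ler_nat.
have nI (x : R) : 0 <= x -> nr (0 +i* x)%C = x.
  by move=> x0; rewrite /nr normc_def /= expr0n add0r sqrtr_sqr ger0_norm.
have gen m : (m <= n.+1)%N -> 4 * expR 1 * (2 * pi * m%:R / M%:R : R) ^+ 2 <=
    1 / 3 * (2 * pi * m%:R / M%:R).
  move=> mn; set x : R := 2 * pi * m%:R / M%:R.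
  have x0 : 0 <= x by rewrite !mulr_ge0 ?invr_ge0 ?pi_ge0.
  rewrite expr2 mulrA ler_wpM2r //.
  rewrite /x mulrA ler_pdivrMr //.
  have : k <= M%:R by []. rewrite /k.
  have : expR 1 * (2 * pi * m%:R) <= expR 1 * (2 * pi * n.+1%:R) :> R.
    by rewrite ler_wpM2l ?expR_ge0 // ler_wpM2l ?(ltW p0) // ler_nat.
  lra.
split => //; first exact: om_sub1_le.
- have := @om_sub1id M 1 M0; have := gen 1%N isT; rewrite mulr1 expr1 => g /(_ h1) h.
  have x0 : 0 <= 2 * pi / M%:R :> R by rewrite !mulr_ge0 ?invr_ge0 ?pi_ge0.
  have := nr_le_dist (om M - 1) (0 +i* (2 * pi / M%:R))%C; rewrite nI //; lra.
- have := gen n (leqnSn n); have := @om_sub1id M n M0 h2.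
  set x : R := 2 * pi * n%:R / M%:R => h g.
  have x0 : 0 <= x by rewrite !mulr_ge0 ?invr_ge0 ?pi_ge0.
  have := nr_le_dist (0 +i* x)%C (om M ^+ n - 1); rewrite nI // (nrC (0 +i* x)%C); lra.
Qed.

End Circle.

(** * Inversion of the Laplace transform *)

Section Inversion.
Context {R : realType}.
Local Notation C := R[i].

Lemma bernoulli_le (x : R) M : 0 <= x -> 1 + M%:R * x <= (1 + x) ^+ M.
Proof.
move=> x0; elim: M => [|M IH]; first by rewrite mul0r addr0.
rewrite exprS -natr1.
have : (1 + x) * (1 + M%:R * x) <= (1 + x) * (1 + x) ^+ M.
  by rewrite ler_wpM2l // addr_ge0.
have : 0 <= M%:R * (x * x) by rewrite mulr_ge0 // mulr_ge0.
lra.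
Qed.

Lemma expr_small (r e : R) : 0 < r < 1 -> 0 < e ->
  exists M0 : nat, forall M, (M0 <= M)%N -> r ^+ M <= e.
Proof.
move=> /andP[r0 r1] e0; pose x := r^-1 - 1.
have x0 : 0 < x by rewrite subr_gt0 invf_gt1.
exists (Num.bound (e^-1 / x)) => M hM.
have h : e^-1 / x <= M%:R by rewrite natr_bound_le // divr_ge0 ?invr_ge0 ?ltW.
have := bernoulli_le M (ltW x0).
have -> : 1 + x = r^-1 by rewrite /x addrC subrK.
move=> hb.
rewrite -[r]invrK exprVn -[e]invrK lef_pV2 ?posrE ?invr_gt0 ?exprn_gt0 ?invr_gt0 //.
by rewrite (le_trans _ hb) // ler_wpDl // -ler_pdivrMr.
Qed.

Lemma finite_eventually (P : nat -> nat -> Prop) M :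
  (forall k, exists N0 : nat, forall N, (N0 <= N)%N -> P k N) ->
  exists N0 : nat, forall N, (N0 <= N)%N -> forall k, (k < M)%N -> P k N.
Proof.
move=> h; elim: M => [|M [N1 h1]]; first by exists 0%N.
have [N2 h2] := h M; exists (maxn N1 N2) => N hN k.
rewrite ltnS leq_eqVlt => /orP[/eqP->|kM].
  by apply: h2; rewrite (leq_trans _ hN) // leq_maxr.
by apply: h1 => //; rewrite (leq_trans _ hN) // leq_maxl.
Qed.

(* Discrete form of Cauchy's theorem: passing from the circle of radius [s] to
   the one of radius [s * q], the radial increments of [f] are, up to second
   order, a constant multiple of its angular increments, which telescope. *)
Lemma circle_step (V : normedModType C) (f df : C -> V) (a b L s q : R) M :
  (0 < M)%N -> om M != 1 :> C ->
  (forall z z', a <= nr z <= b -> a <= nr z' <= b ->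
     nr (f z' - f z - (z' - z) *: df z) <= L * nr (z' - z) ^+ 2) ->
  0 <= L -> 0 < a -> a <= s -> 1 <= q -> s * q <= b ->
  nr (cavg M f (s * q) - cavg M f s) <=
    L * b ^+ 2 * (q - 1) * ((q - 1) + nr (om M - 1 : C)).
Proof.
move=> M0 o1 hf L0 a0 as_ q1 sqb.
have s0 : 0 < s by exact: lt_le_trans as_.
have sb : s <= b by rewrite (le_trans _ sqb) // ler_peMr // ltW.
have q0 : 0 <= q - 1 by rewrite subr_ge0.
have o10 : om M - 1 != 0 :> C by rewrite subr_eq0.
(* With this ratio the radial increment (q - 1) w equals [c] times the angular increment (om - 1) w,
   so the terms in [df] cancel in [e k]. *)
pose c : C := (q - 1)%:C%C / (om M - 1).
pose w (k : nat) : C := s%:C%C * om M ^+ k.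
have nw k : nr (w k) = s by rewrite nrM nr_omX mulr1 nrR ger0_norm // ltW.
have Pw k : a <= nr (w k) <= b by rewrite nw as_ sb.
pose e k := f ((s * q)%:C%C * om M ^+ k) - f (w k) - c *: (f (w k.+1) - f (w k)).
have he k : nr (e k) <= L * b ^+ 2 * (q - 1) * ((q - 1) + nr (om M - 1 : C)).
  have d1 : (s * q)%:C%C * om M ^+ k - w k = (q - 1)%:C%C * w k :> C.
    by rewrite /w rmorphM rmorphB rmorph1 /=; ring.
  have d2 : w k.+1 - w k = (om M - 1) * w k by rewrite /w exprS; ring.
  have Pq : a <= nr ((s * q)%:C%C * om M ^+ k : C) <= b.
    rewrite nrM nr_omX mulr1 nrR ger0_norm ?mulr_ge0 ?(ltW s0) ?(le_trans _ q1) //.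
    by rewrite sqb andbT (le_trans as_) // ler_peMr // ltW.
  have h1 := hf _ _ (Pw k) Pq; have h2 := hf _ _ (Pw k) (Pw k.+1).
  rewrite d1 in h1; rewrite d2 in h2.
  rewrite (nrM _ (w k)) nw nrR ger0_norm // exprMn in h1.
  rewrite (nrM _ (w k)) nw exprMn in h2.
  have -> : e k = (f ((s * q)%:C%C * om M ^+ k) - f (w k) - ((q - 1)%:C%C * w k) *: df (w k))
     - c *: (f (w k.+1) - f (w k) - ((om M - 1) * w k) *: df (w k)).
    rewrite /e [in RHS]scalerBr scalerA.
    have -> : c * ((om M - 1) * w k) = (q - 1)%:C%C * w k.
      by rewrite mulrA divfK.
    by rewrite [in RHS]opprB addrA subrK.
  rewrite (le_trans (nrB _ _)) // nrZ.
  have nc : nr c = (q - 1) / nr (om M - 1 : C) by rewrite nrM nrV nrR ger0_norm.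
  have nn0 : 0 < nr (om M - 1 : C) by rewrite nr_gt0.
  have h3 : nr c * nr (f (w k.+1) - f (w k) - ((om M - 1) * w k) *: df (w k)) <=
     nr c * (L * (nr (om M - 1 : C) ^+ 2 * s ^+ 2)) by rewrite ler_wpM2l ?nr_ge0.
  have E3 : nr c * (L * (nr (om M - 1 : C) ^+ 2 * s ^+ 2)) =
      L * s ^+ 2 * (q - 1) * nr (om M - 1 : C).
    by rewrite nc; field; rewrite gt_eqF.
  rewrite E3 in h3.
  apply: (le_trans (lerD h1 h3)).
  have -> : L * ((q - 1) ^+ 2 * s ^+ 2) + L * s ^+ 2 * (q - 1) * nr (om M - 1 : C) =
    s ^+ 2 * (L * (q - 1) * ((q - 1) + nr (om M - 1 : C))) by ring.
  have -> : L * b ^+ 2 * (q - 1) * (q - 1 + nr (om M - 1 : C)) =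
    b ^+ 2 * (L * (q - 1) * ((q - 1) + nr (om M - 1 : C))) by ring.
  have qo : 0 <= q - 1 + nr (om M - 1 : C) by rewrite addr_ge0 // nr_ge0.
  rewrite ler_wpM2r //; first by rewrite mulr_ge0 // mulr_ge0.
  by rewrite lerXn2r ?nnegrE ?(ltW s0) // (le_trans _ sb) // ltW.
have -> : cavg M f (s * q) - cavg M f s = (M%:R : C)^-1 *: \sum_(k < M) e k.
  rewrite /cavg -scalerBr; congr (_ *: _).
  have sh : \sum_(k < M) f (w k.+1) = \sum_(k < M) f (w k).
    apply: (sum_shift_periodic (H := fun k => f (w k))).
    by rewrite /w om_unity // expr0.
  by rewrite /e !sumrB -scaler_sumr sumrB sh subrr scaler0 subr0.
rewrite nrZ nrV.
have -> : nr (M%:R : C) = M%:R by rewrite -(rmorph_nat (@real_complex R)) nrR ger0_norm.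
rewrite mulrC ler_pdivrMr ?ltr0n // (le_trans (nr_sum _ _ _)) //.
rewrite mulr_natr -[X in _ *+ X](card_ord M) -sumr_const.
by apply: ler_sum => k _.
Qed.

(** The annulus is crossed in M radial steps of ratio q = (b / a)^(1/M). Both q - 1 and |om - 1| are
    O(1/M), so each step costs O(1/M^2) and all of them O(1/M). *)
Lemma discrete_cauchy (V : normedModType C) (f df : C -> V) (a b : R) :
  0 < a -> a <= b -> T2 [set w | a <= nr w <= b] f df ->
  forall e : R, 0 < e -> exists M0 : nat, forall M, (M0 <= M)%N ->
  nr (cavg M f b - cavg M f a) <= e.
Proof.
move=> a0 ab [L L0 hL] e e0; have b0 := lt_le_trans a0 ab.
pose La := ln (b / a).
have La0 : 0 <= La by rewrite ln_ge0 // ler_pdivlMr // mul1r.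
pose k1 := expR La * La; have k10 : 0 <= k1 by rewrite mulr_ge0 ?expR_ge0.
pose k2 : R := (1 + 4 * expR 1) * (2 * pi).
have k20 : 0 <= k2 by rewrite !mulr_ge0 ?pi_ge0 // addr_ge0 // mulr_ge0 // expR_ge0.
pose K := L * b ^+ 2 * k1 * (k1 + k2).
have K0 : 0 <= K by rewrite mulr_ge0 ?addr_ge0 // mulr_ge0 // mulr_ge0 // exprn_ge0 // ltW.
have [M1 h1] := @om_sub1_bounds R 1.
exists (maxn M1 (Num.bound (K / e))) => M hM.
have [M0 hpi ho _ ho1] := h1 M (leq_trans (leq_maxl _ _) hM).
have MR : 0 < (M%:R : R) by rewrite ltr0n.
have o1 : om M != 1 :> C.
  rewrite -subr_eq0 -nr_gt0 -[om M]expr1 (lt_le_trans _ ho1) //.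
  by rewrite !mulr_gt0 ?invr_gt0 ?pi_gt0.
pose q := expR (La / M%:R).
have q1 : 1 <= q by rewrite -expR0 ler_expR divr_ge0.
have qk : q - 1 <= k1 / M%:R.
  have LM : La / M%:R <= La by rewrite ler_pdivrMr // ler_peMr // ler1n.
  have := @expR_sub1 R La (La / M%:R); rewrite ger0_norm ?divr_ge0 // => /(_ LM).
  rewrite ger0_norm ?subr_ge0 // /k1 -mulrA //.
have qX j : (j <= M)%N -> a * q ^+ j <= b.
  move=> jM; rewrite mulrC -ler_pdivlMr // -[b / a]lnK ?posrE ?divr_gt0 //.
  rewrite -/La /q -expRM_natr ler_expR -mulrA ler_piMr // mulrC ler_pdivrMr //.
  by rewrite mul1r ler_nat.
have E : cavg M f b - cavg M f a =
    \sum_(0 <= j < M) (cavg M f (a * q ^+ j.+1) - cavg M f (a * q ^+ j)).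
  rewrite telescope_sumr // expr0 mulr1; congr (cavg M f _ - _).
  rewrite /q -expRM_natr divfK ?gt_eqF // lnK ?posrE ?divr_gt0 // mulrC divfK //.
  by rewrite gt_eqF.
have step j : (j < M)%N ->
   nr (cavg M f (a * q ^+ j.+1) - cavg M f (a * q ^+ j)) <= K / M%:R ^+ 2.
  move=> jM; rewrite exprSr mulrA.
  have hf z z' : a <= nr z <= b -> a <= nr z' <= b ->
     nr (f z' - f z - (z' - z) *: df z) <= L * nr (z' - z) ^+ 2.
    by move=> Pz Pz'; have [] := hL z z' Pz Pz'.
  have qj1 : a <= a * q ^+ j by rewrite ler_peMr ?(ltW a0) // exprn_ege1.
  have sq : a * q ^+ j * q <= b by rewrite -mulrA -exprSr qX.
  apply: (le_trans (circle_step M0 o1 hf L0 a0 qj1 q1 sq)).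
  have -> : K / M%:R ^+ 2 = L * b ^+ 2 * (k1 / M%:R) * (k1 / M%:R + k2 / M%:R).
    by rewrite /K; field; rewrite gt_eqF.
  have q0 : 0 <= q - 1 by rewrite subr_ge0.
  have LB : 0 <= L * b ^+ 2 by rewrite mulr_ge0 // exprn_ge0 // ltW.
  apply: ler_pM; [exact: mulr_ge0|by rewrite addr_ge0 // nr_ge0|by rewrite ler_wpM2l|].
  by rewrite lerD // /k2 -mulrA.
rewrite E big_mkord (le_trans (nr_sum _ _ _)) //.
apply: (@le_trans _ _ (\sum_(j < M) K / M%:R ^+ 2)).
  by apply: ler_sum => j _; exact: step.
rewrite sumr_const card_ord.
have -> : K / M%:R ^+ 2 *+ M = K / M%:R by rewrite -[LHS]mulr_natr; field; rewrite gt_eqF.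
rewrite ler_pdivrMr // mulrC -ler_pdivrMr // natr_bound_le ?divr_ge0 ?(ltW e0) //.
by rewrite (leq_trans _ hM) // leq_maxr.
Qed.

(** Discrete mean of the Poisson kernel: 1/|1 - w|^2 = (2 Re (1/(1 - w)) - 1) / (1 - |w|^2), and the
    sum of 1/(1 - w) over the nodes is M / (1 - r^M), since w^M is the same at all nodes and only
    the term of degree 0 of the finite geometric sum survives. *)
Lemma sum_inv_sqr_circle (r : R) M : (0 < M)%N -> 0 < r < 1 ->
  \sum_(k < M) (nr (1 - r%:C%C * om M ^+ k : C) ^+ 2)^-1 =
  M%:R * (2 / (1 - r ^+ M) - 1) / (1 - r ^+ 2).
Proof.
move=> M0 /andP[r0 r1].
pose w (k : nat) : C := r%:C%C * om M ^+ k.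
have nw k : nr (w k) = r by rewrite nrM nr_omX mulr1 nrR ger0_norm // ltW.
have w1 k : 1 - w k != 0.
  apply/eqP => /eqP; rewrite subr_eq0 => /eqP h; have := nw k; rewrite -h nr1 => e1.
  by rewrite -e1 ltxx in r1.
have rM : 1 - r ^+ M != 0 by rewrite subr_eq0 eq_sym lt_eqF // exprn_ilt1 ?(ltW r0) // -lt0n.
have r2 : 1 - r ^+ 2 != 0 by rewrite subr_eq0 eq_sym lt_eqF // exprn_ilt1 ?(ltW r0).
have wM k : w k ^+ M = (r ^+ M)%:C%C.
  by rewrite exprMn -exprM mulnC exprM om_unity // expr1n mulr1 rmorphXn.
have rMC : ((1 - r ^+ M)%:C%C : C) != 0 by rewrite (inj_eq (@complexI R)).
have inv k : (1 - w k)^-1 = ((1 - r ^+ M)%:C%C)^-1 * \sum_(j < M) w k ^+ j.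
  have h : (1 - w k) * \sum_(j < M) w k ^+ j = (1 - r ^+ M)%:C%C.
    by rewrite -opprB mulNr -subrX1 wM opprB rmorphB rmorph1.
  apply: (mulfI (w1 k)); rewrite divff // mulrCA h mulVf //.
have S : \sum_(k < M) (1 - w k)^-1 = (M%:R / (1 - r ^+ M))%:C%C.
  under eq_bigr do rewrite inv.
  rewrite -mulr_sumr exchange_big /= -(prednK M0) big_ord_recl /= (prednK M0).
  under eq_bigr do rewrite expr0.
  rewrite sumr_const card_ord big1 ?addr0.
    by rewrite rmorphM fmorphV rmorph_nat mulrC.
  move=> j _; rewrite /bump leq0n add1n.
  under eq_bigr do rewrite exprMn -exprM mulnC exprM.
  rewrite -mulr_sumr sum_unity ?mulr0 //.
    by rewrite -exprM mulnC exprM om_unity // expr1n.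
  by apply: om_prim => //=; rewrite -[X in (_ < X)%N](prednK M0) ltnS.
have key k : (nr (1 - w k) ^+ 2)^-1 = (2 * complex.Re (1 - w k)^-1 - 1) / (1 - r ^+ 2).
  have := nr_sqr (w k); rewrite nw => e1.
  have e2 := nr_sqr (1 - w k).
  have n0 : nr (1 - w k) ^+ 2 != 0 by rewrite expf_neq0 // nr_eq0.
  have -> : complex.Re (1 - w k)^-1 = complex.Re (1 - w k) / nr (1 - w k) ^+ 2.
    by rewrite e2; case: (1 - w k) => x y.
  apply: (mulfI n0); rewrite divff //.
  have e3 : nr (1 - w k) ^+ 2 = 1 - 2 * complex.Re (w k) + r ^+ 2.
    by rewrite e2 e1; case: (w k) => x y /=; ring.
  have e4 : complex.Re (1 - w k) = 1 - complex.Re (w k) by case: (w k).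
  rewrite e4; rewrite e3 in n0 *; field.
  by rewrite r2 /=.
under eq_bigr do rewrite key.
rewrite -mulr_suml sumrB -mulr_sumr sumr_const card_ord.
have -> : \sum_(i < M) complex.Re (1 - w i)^-1 = complex.Re (\sum_(i < M) (1 - w i)^-1).
  by rewrite (raddf_sum (@complex.Re R : Rcomplex R -> R)).
by rewrite S /=; ring.
Qed.

(** Summation by parts on the nodes: om^n - 1 times the sum of om^(-nk) F(z_k) is the sum of
    om^(-nk) (F(z_(k+1)) - F(z_k)). Increments are controlled by dF, their sum by the Poisson mean,
    and the division by |om^n - 1| supplies 1/n. The tolerance e absorbs the second-order part of
    the increments. *)
Lemma cavg_derivative_bound (V : normedModType C) (F dF : C -> V) (K lam r : R) n :
  0 <= K -> 0 < lam -> 0 < r < 1 -> (0 < n)%N ->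
  (forall a B : R, 0 < a -> T2 (rhp a B) F dF) ->
  (forall z, 0 < complex.Re z -> nr (dF z) <= K / nr z ^+ 2) ->
  forall e : R, 0 < e -> exists M0 : nat, forall M, (M0 <= M)%N ->
  nr (cavg M (fun w => (w ^+ n)^-1 *: F (lam%:C%C * (1 - w))) r) <=
  (r ^+ n)^-1 * (6 * K / (n%:R * lam * (1 - r ^+ 2)) + e).
Proof.
move=> K0 l0 /andP[r0 r1] n0 hT hK e e0.
have nR : 0 < (n%:R : R) by rewrite ltr0n.
have a0 : 0 < lam * (1 - r) by rewrite mulr_gt0 // subr_gt0.
have [L L0 hL] := hT _ (lam * 2) a0.
have [M1 h1] := @om_sub1_bounds R n.
have [M2 h2] : exists M2 : nat, forall M, (M2 <= M)%N -> r ^+ M <= 1 / 2.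
  by apply: expr_small; rewrite ?r0 ?r1 ?divr_gt0.
pose kk := 2 * (L * lam ^+ 2) * (4 / 3 * (2 * pi)).
have k0 : 0 <= kk.
  have pp : 0 <= 4 / 3 * (2 * pi) :> R by rewrite !mulr_ge0 ?pi_ge0.
  by rewrite mulr_ge0 // mulr_ge0 // mulr_ge0 // exprn_ge0 // ltW.
exists (maxn (maxn M1 M2) (Num.bound (kk / e))) => M hM.
have hM12 : (maxn M1 M2 <= M)%N by rewrite (leq_trans _ hM) // leq_maxl.
have [M0 hpi _ hd hD] := h1 M (leq_trans (leq_maxl _ _) hM12).
have hr := h2 M (leq_trans (leq_maxr _ _) hM12).
have MR : 0 < (M%:R : R) by rewrite ltr0n.
have hke : kk / e <= M%:R.
  by rewrite natr_bound_le ?divr_ge0 ?(ltW e0) // (leq_trans _ hM) // leq_maxr.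
set d := nr (om M - 1) in hd; have d0 : 0 <= d by exact: nr_ge0.
pose x : R := 2 * pi / M%:R; rewrite -/x in hd.
have x0 : 0 < x by rewrite !mulr_gt0 ?pi_gt0 ?invr_gt0.
have r2 : 0 < 1 - r ^+ 2 by rewrite subr_gt0 exprn_ilt1 // ltW.
(* 3 bounds 2 / (1 - r^M) - 1 as soon as r^M <= 1/2. The ratio of the chord constants 4/3 and 2/3
   contributes the further factor 2, hence the 6 of the statement. *)
pose T := 3 * K / (lam * (1 - r ^+ 2)).
have T0 : 0 <= T by rewrite divr_ge0 // ?mulr_ge0 // ltW // mulr_gt0.
pose z (k : nat) : C := lam%:C%C * (1 - r%:C%C * om M ^+ k).
have nrw k : nr (r%:C%C * om M ^+ k : C) = r.
  by rewrite nrM nr_omX mulr1 nrR ger0_norm // ltW.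
have Rz k : lam * (1 - r) <= complex.Re (z k).
  have := Re_le_nr (r%:C%C * om M ^+ k); rewrite nrw /z.
  case: (r%:C%C * om M ^+ k) => a b /= h; rewrite mul0r subr0 ler_pM2l //.
  by have := ler_norm a; lra.
have nz k : nr (z k) = lam * nr (1 - r%:C%C * om M ^+ k : C).
  by rewrite nrM nrR ger0_norm // ltW.
have Pz k : rhp (lam * (1 - r)) (lam * 2) (z k).
  split => //; rewrite nz ler_pM2l // (le_trans (nrB _ _)) // nr1 nrw; lra.
have n1 k : 0 < nr (1 - r%:C%C * om M ^+ k : C).
  by have := Re_gt0_nr (lt_le_trans a0 (Rz k)); rewrite nz pmulr_rgt0.
have hG k : nr (F (z k.+1) - F (z k)) <=
    lam * d * (K / lam ^+ 2 * (nr (1 - r%:C%C * om M ^+ k : C) ^+ 2)^-1)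
    + L * (lam * d) ^+ 2.
  have [_ _ _ h4] := hL _ _ (Pz k) (Pz k.+1).
  have nD : nr (z k.+1 - z k) <= lam * d.
    have -> : z k.+1 - z k = - (lam%:C%C * (r%:C%C * om M ^+ k) * (om M - 1)).
      by rewrite /z exprS; ring.
    rewrite nrN (nrM (_ * (_ * _))) (nrM lam%:C%C) nrw nrR (ger0_norm (ltW l0)) -/d.
    by rewrite ler_wpM2r // ler_piMr // ltW.
  have nD0 := nr_ge0 (z k.+1 - z k).
  have l2 : 0 <= lam * d by rewrite mulr_ge0 // ltW.
  have h3 : nr (z k.+1 - z k) * nr (dF (z k)) <=
      lam * d * (K / lam ^+ 2 * (nr (1 - r%:C%C * om M ^+ k : C) ^+ 2)^-1).
    apply: ler_pM => //; first exact: nr_ge0.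
    rewrite (le_trans (hK _ _)) ?(lt_le_trans a0 (Rz k)) // nz exprMn.
    by rewrite invfM mulrA.
  have h5 : L * nr (z k.+1 - z k) ^+ 2 <= L * (lam * d) ^+ 2.
    by rewrite ler_wpM2l // lerXn2r ?nnegrE.
  rewrite (le_trans (nr_le_dist _ ((z k.+1 - z k) *: dF (z k)))) // nrZ.
  by rewrite lerD // (le_trans h4).
pose y : C := (om M ^+ n)^-1.
have o0 : om M ^+ n != 0 :> C by rewrite expf_neq0 // om_neq0.
pose S := \sum_(k < M) y ^+ k *: F (z k).
have hS : (om M ^+ n - 1) *: S = \sum_(k < M) y ^+ k *: (F (z k.+1) - F (z k)).
  rewrite scalerBl scale1r.
  rewrite -{1}/S /S -(sum_shift_periodic (H := fun k => y ^+ k *: F (z k))) /=; last first.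
    rewrite /z om_unity // expr0 /y exprVn -exprM mulnC exprM om_unity //.
    by rewrite expr1n invr1.
  rewrite scaler_sumr (sum_shift_periodic (H := fun k => y ^+ k *: F (z k))); last first.
    rewrite /z om_unity // expr0 /y exprVn -exprM mulnC exprM om_unity //.
    by rewrite expr1n invr1.
  rewrite -sumrB; apply: eq_bigr => j _.
  by rewrite scalerA exprS mulrA divff // mul1r scalerBr.
have nS : nr S * (2 / 3 * (n%:R * x)) <= M%:R * (2 * T / n%:R + e) * (2 / 3 * (n%:R * x)).
  apply: (@le_trans _ _ (nr S * nr (om M ^+ n - 1 : C))).
    rewrite ler_wpM2l ?nr_ge0 //; move: hD; rewrite /x.
    by have -> : 2 * pi * n%:R / M%:R = n%:R * (2 * pi / M%:R) :> R by ring.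
  rewrite mulrC -nrZ hS (le_trans (nr_sum _ _ _)) //.
  apply: (@le_trans _ _ (\sum_(k < M) (lam * d * (K / lam ^+ 2 *
     (nr (1 - r%:C%C * om M ^+ k : C) ^+ 2)^-1) + L * (lam * d) ^+ 2))).
    by apply: ler_sum => j _; rewrite nrZ /y -exprVn !nrX nrV nr_om invr1 !expr1n mul1r.
  rewrite big_split /=.
  have -> : \sum_(k < M) L * (lam * d) ^+ 2 = M%:R * (L * (lam * d) ^+ 2).
    by rewrite sumr_const card_ord mulr_natl.
  rewrite -!mulr_sumr sum_inv_sqr_circle ?r0 ?r1 //.
  have i1 : M%:R * (2 / (1 - r ^+ M) - 1) / (1 - r ^+ 2) <= M%:R * 3 / (1 - r ^+ 2).
    rewrite ler_wpM2r ?invr_ge0 ?(ltW r2) // ler_wpM2l //.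
    rewrite lerBlDr ler_pdivrMr; lra.
  have i2 : lam * d * (K / lam ^+ 2 * (M%:R * (2 / (1 - r ^+ M) - 1) / (1 - r ^+ 2)))
     <= M%:R * (d * T).
    have -> : M%:R * (d * T) = lam * d * (K / lam ^+ 2 * (M%:R * 3 / (1 - r ^+ 2))).
      by rewrite /T; field; rewrite !gt_eqF.
    rewrite ler_wpM2l ?mulr_ge0 ?(ltW l0) // ler_wpM2l // divr_ge0 //.
    by rewrite exprn_ge0 // ltW.
  have i3 : L * lam ^+ 2 * d <= e / 2.
    apply: (@le_trans _ _ (L * lam ^+ 2 * (4 / 3 * x))).
      by rewrite ler_wpM2l // mulr_ge0 // exprn_ge0 // ltW.
    have -> : L * lam ^+ 2 * (4 / 3 * x) = kk / M%:R / 2.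
      by rewrite /kk /x; field; rewrite gt_eqF.
    rewrite ler_wpM2r // ler_pdivrMr // mulrC -ler_pdivrMr //.
  apply: (@le_trans _ _ (M%:R * (d * (T + e / 2)))).
    apply: (le_trans (lerD i2 (lexx _))); rewrite -mulrDr ler_wpM2l // mulrDr lerD2l.
    have -> : L * (lam * d) ^+ 2 = d * (L * lam ^+ 2 * d) by ring.
    by rewrite ler_wpM2l.
  have -> : M%:R * (2 * T / n%:R + e) * (2 / 3 * (n%:R * x)) =
     M%:R * (4 / 3 * x * (T + n%:R * e / 2)) by field; rewrite gt_eqF.
  have Te : 0 <= T + e / 2 by rewrite addr_ge0 // divr_ge0 // ltW.
  rewrite ler_wpM2l //; apply: ler_pM => //.
  by rewrite lerD2l ler_wpM2r // ler_peMl ?(ltW e0) // ler1n.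
have nxp : 0 < 2 / 3 * (n%:R * x) by rewrite mulr_gt0 // mulr_gt0.
rewrite ler_pM2r // in nS.
have -> : cavg M (fun w => (w ^+ n)^-1 *: F (lam%:C%C * (1 - w))) r =
    ((r ^+ n)^-1 / M%:R)%:C%C *: S.
  rewrite /cavg rmorphM !fmorphV rmorphXn rmorph_nat mulrC -scalerA; congr (_ *: _).
  rewrite /S scaler_sumr; apply: eq_bigr => j _; rewrite scalerA; congr (_ *: _).
  by rewrite exprMn invfM -exprM mulnC exprM /y exprVn.
rewrite nrZ nrR ger0_norm ?mulr_ge0 ?invr_ge0 ?exprn_ge0 ?(ltW r0) // -[leLHS]mulrA.
rewrite ler_wpM2l ?invr_ge0 ?exprn_ge0 ?(ltW r0) // mulrC ler_pdivrMr //.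
rewrite (le_trans nS) // mulrC ler_wpM2r // lerD2r /T.
rewrite le_eqVlt; apply/orP; left; apply/eqP; field.
by rewrite !gt_eqF.
Qed.

(* A Riemann sum, with step [T / N], of the Laplace integral of [v] over [[0, T]]. *)
Definition disc_laplace {V : lmodType C} (v : R -> V) (T : R) (N : nat) (z : C) : V :=
  \sum_(j < N) ((T / N%:R)%:C%C * (1 - z * (T / N%:R)%:C%C) ^+ j) *: v (j%:R * (T / N%:R)).

(** Two circles meet opposite demands. On |w| = 1/2 the real part of lam (1 - w) is at least lam /
    2, so the cut at 2 t costs e^(-n) against |w|^(-n) = 2^n. On |w| = r close to 1 the factor
    r^(-n) stays below e and the bound on [dF] is used. [discrete_cauchy] passes from one to the
    other. As lam grows with n, [E0] has to be common to all z. *)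
Theorem inversion_bound (V : normedModType C) (F dF : C -> V) (v : R -> V)
    (t K B E0 x0 : R) : 0 < t -> 0 <= K -> 0 <= E0 ->
  (forall a B : R, 0 < a -> T2 (rhp a B) F dF) ->
  (forall z, 0 < complex.Re z -> nr (dF z) <= K / nr z ^+ 2) ->
  (forall s : R, 0 <= s <= 2 * t -> nr (v s) <= B) ->
  (forall e : R, 0 < e -> exists2 d : R, 0 < d &
     forall s : R, 0 <= s -> `|s - t| < d -> nr (v s - v t) <= e) ->
  (forall z, x0 <= complex.Re z -> forall e : R, 0 < e ->
     exists N0 : nat, forall N, (N0 <= N)%N ->
     nr (disc_laplace v (2 * t) N z - F z) <= E0 * expR (- (2 * t * complex.Re z)) + e) ->
  nr (v t) <= 12 * expR 1 * K.
Proof.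
move=> t0 K0 E00 hT hK hB hc hU.
(* Five errors share [e']: the concentration of the weights, the aliasing, the cut-off with
   discretisation, the change of circle, and the tolerance in the derivative bound. *)
apply/ler_addgt0Pr => e' e'0; pose e := e' / 5; have e0 : 0 < e by rewrite divr_gt0.
have B0 : 0 <= B.
  by rewrite (le_trans (nr_ge0 (v 0))) // hB // lexx mulr_ge0 // ltW.
have [n1 hn1] := post_widder t0 hB hc e0.
(* The cut-off error is lam 2^n (E0 + 1) e^(-n) with lam = n / t, that is (E0 + 1) / t times the
   quantity that this threshold bounds. *)
have q0 : 0 < e * t / (E0 + 1) by rewrite divr_gt0 ?mulr_gt0 // ltr_wpDl.
have [n2 hn2] := natr_exp2_expR_small q0.
(* The last entry gives lam / 2 >= x0, so that [hU] applies at every node of the circle of radius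
   1/2. *)
pose n := maxn (maxn n1 n2) (Num.bound (`|x0| * 2 * t)).+1.
have nn12 : (maxn n1 n2 <= n)%N by rewrite leq_maxl.
have n0 : (0 < n)%N by rewrite (leq_trans _ (leq_maxr _ _)).
have nR : 0 < (n%:R : R) by rewrite ltr0n.
pose lam := n%:R / t; have l0 : 0 < lam by rewrite divr_gt0.
have lx : x0 <= lam / 2.
  rewrite (le_trans (ler_norm _)) // /lam ler_pdivlMr // ler_pdivlMr //.
  by rewrite natr_bound_le ?mulr_ge0 ?(ltW t0) // ltnW // leq_maxr.
have [N1 hN1] := hn1 n (leq_trans (leq_maxl _ _) nn12).
have sm := hn2 n (leq_trans (leq_maxr _ _) nn12).
(* This radius balances two factors: r^(-n) = (1 + 1/n)^n <= e, and 1 - r^2 >= 1/(n + 1), which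
   turns 6 K / (n lam (1 - r^2)) into at most 12 K / lam. *)
pose r : R := (1 + n%:R^-1)^-1.
have nV0 : 0 < (n%:R^-1 : R) by rewrite invr_gt0.
have r1' : 1 < 1 + n%:R^-1 :> R by rewrite ltrDl.
have r0 : 0 < r by rewrite invr_gt0 (lt_trans ltr01).
have r1 : r < 1 by rewrite invf_lt1 // (lt_trans ltr01).
have rh : 1 / 2 <= r.
  rewrite div1r lef_pV2 ?posrE ?(lt_trans ltr01) ?ltr1n //.
  by rewrite -[2]/(1 + 1) lerD2l invf_le1 // ler1n.
have rn : (r ^+ n)^-1 <= expR 1.
  rewrite -exprVn invrK -[X in expR X](@mulVf _ (n%:R : R)) ?gt_eqF // expRM_natr.
  by rewrite lerXn2r ?nnegrE ?expR_ge0 ?(le_trans ler01) ?(ltW r1') // expR_ge1Dx.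
have r2 : 6 * K / (n%:R * lam * (1 - r ^+ 2)) <= 12 * K / lam.
  have h : (n%:R + 1)^-1 <= 1 - r ^+ 2.
    have -> : (n%:R + 1)^-1 = 1 - r.
      rewrite /r; field; rewrite !gt_eqF // ?addr_gt0 // ?ltr_pwDl //.
    by rewrite lerD2l lerN2 expr2 ler_piMr // ltW.
  have r20 : 0 < 1 - r ^+ 2 by rewrite (lt_le_trans _ h) // invr_gt0 addr_gt0.
  rewrite ler_pdivrMr; last by rewrite mulr_gt0 // mulr_gt0.
  have -> : 12 * K / lam * (n%:R * lam * (1 - r ^+ 2)) =
     6 * K * (2 * n%:R * (1 - r ^+ 2)) by field; rewrite gt_eqF.
  rewrite ler_peMr ?mulr_ge0 //.
  have : 2 * n%:R * (n%:R + 1)^-1 <= 2 * n%:R * (1 - r ^+ 2).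
    by rewrite ler_wpM2l // mulr_ge0.
  apply: le_trans; rewrite ler_pdivlMr ?addr_gt0 //.
  by rewrite mul1r mulrDl mul1r lerD2l ler1n.
have e1 : 0 < e / (lam * expR 1) by rewrite divr_gt0 // mulr_gt0 // expR_gt0.
have r01 : 0 < r < 1 by rewrite r0 r1.
have [Ma hMa] := cavg_derivative_bound K0 l0 r01 n0 hT hK e1.
have e2 : 0 < e / lam by rewrite divr_gt0.
pose f w := (w ^+ n)^-1 *: F (lam%:C%C * (1 - w)).
have [df hf] : exists df, T2 [set w | 1 / 2 <= nr w <= r] f df.
  have P1 : T2 [set w : C | 1 / 2 <= nr w <= r] (id : C -> C^o) (fun=> 1).
    by apply: (@T2_id _ _ r) => z /= /andP[].
  have h1 := T2_exp n P1.
  have h2 : T2 [set w : C | 1 / 2 <= nr w <= r] ((fun z : C => (z ^+ n)^-1) : C -> C^o)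
     (fun z => - (n%:R * 1 * z ^+ n.-1) / (z ^+ n) ^+ 2).
    apply: (T2_inv (m := (1 / 2) ^+ n)) h1; first by rewrite exprn_gt0 // divr_gt0.
    move=> z /= /andP[hz _]; rewrite nrX lerXn2r ?nnegrE ?nr_ge0 //.
  have h3 : T2 [set w : C | 1 / 2 <= nr w <= r] ((fun z : C => lam%:C%C * (1 - z)) : C -> C^o)
     (fun z => - lam%:C%C).
    have h := T2_add (T2_const [set w : C | 1 / 2 <= nr w <= r] (lam%:C%C : C^o))
      (T2_scale (T2_const [set w : C | 1 / 2 <= nr w <= r] ((- lam%:C%C) : C^o)) P1).
    apply: T2_ext h => z _; rewrite -!/(_ * _).
      by rewrite -[LHS]/(lam%:C%C + - lam%:C%C * z); ring.
    by rewrite -[LHS]/(0 + (0 * z + - lam%:C%C * 1)); ring.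
  have a0 : 0 < lam * (1 - r) by rewrite mulr_gt0 // subr_gt0.
  have h4 := T2_comp (P := [set w : C | 1 / 2 <= nr w <= r]) _ h3 (hT _ (lam * 2) a0).
  eexists; apply: (T2_scale h2 (h4 _)) => z /= /andP[_ zr]; split.
    have := Re_le_nr z; case: z zr => a b /= zr h; rewrite mul0r subr0 ler_pM2l //.
    have h5 := ler_norm a; clear -zr h h5; lra.
  rewrite nrM nrR (ger0_norm (ltW l0)) ler_pM2l // (le_trans (nrB _ _)) // nr1.
  clear -zr r1; lra.
have h20 : 0 < 1 / 2 :> R by rewrite divr_gt0.
have [Mb hMb] := discrete_cauchy h20 rh hf e2.
have e3 : 0 < e / (lam * (2 * t * B + 1)).
  by rewrite divr_gt0 // mulr_gt0 // ltr_wpDl // !mulr_ge0 // ltW.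
have h21 : 0 < (1 / 2 : R) < 1 by rewrite h20 /= ltr_pdivrMr // mul1r ltr1n.
have [Mc hMc] := expr_small h21 e3.
pose M := (maxn (maxn Ma Mb) (maxn Mc n.+1)).
have Mab : (maxn Ma Mb <= M)%N by rewrite leq_maxl.
have Mcn : (maxn Mc n.+1 <= M)%N by rewrite leq_maxr.
have nM : (n < M)%N by exact: leq_trans (leq_maxr _ _) Mcn.
have M0 : (0 < M)%N by exact: leq_ltn_trans nM.
have hA := hMa M (leq_trans (leq_maxl _ _) Mab); rewrite -/f in hA.
have hBb := hMb M (leq_trans (leq_maxr _ _) Mab).
have hC := hMc M (leq_trans (leq_maxl _ _) Mcn).
pose z (k : nat) : C := lam%:C%C * (1 - (1 / 2)%:C%C * om M ^+ k).
have Rz k : lam / 2 <= complex.Re (z k).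
  have := Re_le_nr ((1 / 2 : R)%:C%C * om M ^+ k).
  rewrite nrM nr_omX mulr1 nrR (ger0_norm (ltW h20)) /z.
  case: ((1 / 2)%:C%C * om M ^+ k) => a b /= h; rewrite mul0r subr0 ler_pM2l //.
  have h5 := ler_norm a; clear -h h5; lra.
have en : 0 < expR (- n%:R) :> R by exact: expR_gt0.
(* [N] is chosen after [M], because the transform must be approximated at all [M] nodes at once. *)
have [N2 hN2] : exists N0 : nat, forall N, (N0 <= N)%N -> forall k, (k < M)%N ->
    nr (disc_laplace v (2 * t) N (z k) - F (z k)) <=
      E0 * expR (- (2 * t * complex.Re (z k))) + expR (- n%:R).
  by apply: finite_eventually => k; apply: hU => //; exact: le_trans lx (Rz k).
pose N := maxn (maxn N1 N2) (2 * n).+1.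
have N12 : (maxn N1 N2 <= N)%N by rewrite leq_maxl.
have NR : 0 < (N%:R : R) by rewrite ltr0n (leq_trans _ (leq_maxr _ _)).
have hpw := hN1 N (leq_trans (leq_maxl _ _) N12).
have hUN := hN2 N (leq_trans (leq_maxr _ _) N12).
pose p : R := 2 * n%:R / N%:R; pose dl : R := 2 * t / N%:R.
have dl0 : 0 <= dl by rewrite divr_ge0 // mulr_ge0 // ltW.
have p01 : 0 <= p <= 1.
  rewrite divr_ge0 ?mulr_ge0 //= ler_pdivrMr // mul1r -natrM ler_nat.
  by rewrite ltnW // leq_maxr.
rewrite -/p -/dl in hpw.
pose a := \sum_(j < N) (dl * ('C(j, n)%:R * p ^+ n * (1 - p) ^+ (j - n)))%:C%C *: v (j%:R * dl).
have pE : p = lam * dl by rewrite /p /lam /dl; field; rewrite !gt_eqF.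
have aE : \sum_(j < N) (nbw n p j)%:C%C *: v (j%:R * dl) = lam%:C%C *: a.
  rewrite /a scaler_sumr; apply: eq_bigr => j _; rewrite scalerA -rmorphM.
  by congr (_%:C%C *: _); rewrite /nbw exprS {1}pE; ring.
pose U w := (w ^+ n)^-1 *: disc_laplace v (2 * t) N (lam%:C%C * (1 - w)).
(* As lam dl = p, every factor 1 - z dl becomes 1 - p + p w, and [cavg_binomial] reads off the
   coefficient of w^n in its powers. *)
have hUa : nr (cavg M U (1 / 2) - a) <= 2 * t * B * (1 / 2) ^+ M.
  pose b (j : nat) : C -> C^o := fun w => (1 - p%:C%C + p%:C%C * w) ^+ j / w ^+ n.
  have -> : cavg M U (1 / 2) - a = \sum_(j < N) (dl%:C%C *
      (cavg M (b j) (1 / 2) -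
       ('C(j, n)%:R * p ^+ n * (1 - p) ^+ (j - n))%:C%C)) *: v (j%:R * dl).
    have -> : cavg M U (1 / 2) = \sum_(j < N) (dl%:C%C * cavg M (b j) (1 / 2)) *: v (j%:R * dl).
      rewrite /cavg.
      have -> : \sum_(k < M) U ((1 / 2)%:C%C * om M ^+ k) = \sum_(k < M) \sum_(j < N)
         (dl%:C%C * b j ((1 / 2)%:C%C * om M ^+ k)) *: v (j%:R * dl).
        apply: eq_bigr => k _; rewrite /U /disc_laplace -/dl scaler_sumr.
        apply: eq_bigr => j _; rewrite scalerA; congr (_ *: _).
        have -> : 1 - lam%:C%C * (1 - (1 / 2)%:C%C * om M ^+ k) * dl%:C%C =
            1 - p%:C%C + p%:C%C * ((1 / 2)%:C%C * om M ^+ k).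
          have -> : (p%:C%C : C) = lam%:C%C * dl%:C%C by rewrite pE rmorphM.
          ring.
        by rewrite /b mulrC -mulrA.
      rewrite exchange_big /= scaler_sumr; apply: eq_bigr => j _.
      rewrite -scaler_suml scalerA; congr (_ *: _).
      by rewrite -[M%:R^-1 *: (\sum_(i < M) b j _)]/(M%:R^-1 * (\sum_(i < M) b j _)) -mulr_sumr mulrCA.
    rewrite -sumrB; apply: eq_bigr => j _; rewrite -scalerBl; congr (_ *: _).
    by rewrite [RHS]mulrBr; congr (_ - _); exact: rmorphM.
  rewrite (le_trans (nr_sum _ _ _)) //.
  apply: (@le_trans _ _ (\sum_(j < N) dl * (1 / 2) ^+ M * B)).
    apply: ler_sum => j _; rewrite nrZ nrM nrR (ger0_norm dl0).
    apply: ler_pM; [by apply: mulr_ge0 => //; exact: nr_ge0|exact: nr_ge0| |].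
      apply: ler_wpM2l => //; apply: cavg_binomial => //.
      by rewrite h20 /= ler_pdivrMr // mul1r ler1n.
    have jdl : 0 <= j%:R * dl by rewrite mulr_ge0.
    apply: hB; rewrite jdl /= /dl mulrA ler_pdivrMr // mulrC.
    by rewrite ler_wpM2l ?mulr_ge0 ?(ltW t0) // ler_nat ltnW.
  rewrite sumr_const card_ord -mulr_natl.
  rewrite le_eqVlt; apply/orP; left; apply/eqP; rewrite /dl; field.
  by rewrite gt_eqF.
have hUf : nr (cavg M U (1 / 2) - cavg M f (1 / 2)) <= 2 ^+ n * ((E0 + 1) * expR (- n%:R)).
  have -> : cavg M U (1 / 2) - cavg M f (1 / 2) = cavg M (fun w => U w - f w) (1 / 2).
    by rewrite /cavg -scalerBr -sumrB.
  have h k : (k < M)%N -> nr (U ((1 / 2)%:C%C * om M ^+ k) - f ((1 / 2)%:C%C * om M ^+ k))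
     <= 2 ^+ n * ((E0 + 1) * expR (- n%:R)).
    move=> kM; rewrite /U /f -scalerBr nrZ.
    have -> : nr (((1 / 2)%:C%C * om M ^+ k : C) ^+ n)^-1 = 2 ^+ n.
      rewrite nrV nrX nrM nr_omX mulr1 nrR ger0_norm ?(ltW h20) //.
      by rewrite -exprVn invf_div divr1.
    rewrite ler_wpM2l ?exprn_ge0 // (le_trans (hUN k kM)) // [leRHS]mulrDl mul1r lerD2r.
    rewrite ler_wpM2l // ler_expR lerN2.
    have -> : n%:R = 2 * t * (lam / 2) :> R by rewrite /lam; field; rewrite gt_eqF.
    by rewrite ler_wpM2l ?mulr_ge0 ?(ltW t0).
  rewrite nrZ nrV.
  have -> : nr (M%:R : C) = M%:R by rewrite -(rmorph_nat (@real_complex R)) nrR ger0_norm.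
  rewrite mulrC ler_pdivrMr ?ltr0n // (le_trans (nr_sum _ _ _)) //.
  apply: (@le_trans _ _ (\sum_(k < M) 2 ^+ n * ((E0 + 1) * expR (- n%:R)))).
    by apply: ler_sum => k _; exact: h.
  by rewrite sumr_const card_ord mulr_natr.
have hla : lam * nr a <= 12 * expR 1 * K + 4 * e.
  have t1 : nr a <= nr (cavg M U (1 / 2) - a) + nr (cavg M U (1 / 2) - cavg M f (1 / 2))
     + nr (cavg M f r - cavg M f (1 / 2)) + nr (cavg M f r).
    exact: nr_le_dist3.
  have t2 : lam * (2 * t * B * (1 / 2) ^+ M) <= e.
    have c0 : 0 <= 2 * t * B by rewrite !mulr_ge0 // ltW.
    have : lam * (2 * t * B * (1 / 2) ^+ M) <= lam * ((2 * t * B + 1) * (e / (lam * (2 * t * B + 1)))).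
      rewrite ler_wpM2l ?(ltW l0) // ler_pM ?exprn_ge0 ?(ltW h20) //.
      by rewrite lerDl.
    move=> /le_trans; apply; rewrite le_eqVlt; apply/orP; left; apply/eqP; field.
    by rewrite !gt_eqF // ltr_wpDl.
  have t3 : lam * (2 ^+ n * ((E0 + 1) * expR (- n%:R))) <= e.
    have -> : lam * (2 ^+ n * ((E0 + 1) * expR (- n%:R))) =
       (E0 + 1) / t * (n%:R * (2 ^+ n * expR (- n%:R))).
      by rewrite /lam; field; rewrite gt_eqF.
    apply: (le_trans (ler_wpM2l _ sm)); first by rewrite divr_ge0 ?addr_ge0 // ltW.
    rewrite le_eqVlt; apply/orP; left; apply/eqP; field.
    by rewrite !gt_eqF // ltr_wpDl.
  have t4 : lam * nr (cavg M f r - cavg M f (1 / 2)) <= e.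
    by rewrite mulrC -ler_pdivlMr.
  have t5 : lam * nr (cavg M f r) <= 12 * expR 1 * K + e.
    apply: (le_trans (ler_wpM2l (ltW l0) hA)).
    have : lam * ((r ^+ n)^-1 * (6 * K / (n%:R * lam * (1 - r ^+ 2)) + e / (lam * expR 1))) <=
       lam * (expR 1 * (12 * K / lam + e / (lam * expR 1))).
      rewrite ler_wpM2l ?(ltW l0) // ler_pM ?invr_ge0 ?exprn_ge0 ?(ltW r0) //; last first.
        by rewrite lerD2r.
      have s0 : 0 <= 1 - r ^+ 2 by rewrite subr_ge0 expr_le1 ?(ltW r0) ?(ltW r1).
      have nl : 0 <= n%:R * lam by rewrite mulr_ge0 // ltW.
      by rewrite addr_ge0 ?(ltW e1) // divr_ge0 // mulr_ge0.
    move=> /le_trans; apply; rewrite le_eqVlt; apply/orP; left; apply/eqP; field.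
    by rewrite expR_eq0 gt_eqF.
  have t12 := le_trans (ler_wpM2l (ltW l0) hUa) t2.
  have t13 := le_trans (ler_wpM2l (ltW l0) hUf) t3.
  apply: (le_trans (ler_wpM2l (ltW l0) t1)); rewrite !mulrDr.
  apply: (le_trans (lerD (lerD (lerD t12 t13) t4) t5)).
  by rewrite le_eqVlt; apply/orP; left; apply/eqP; ring.
rewrite aE in hpw.
have := nr_le_dist (v t) (lam%:C%C *: a); rewrite (nrC (v t)) nrZ nrR (ger0_norm (ltW l0)).
move=> /le_trans; apply; apply: (le_trans (lerD hla hpw)).
by rewrite le_eqVlt; apply/orP; left; apply/eqP; rewrite /e; field.
Qed.

End Inversion.

(** * Laplace transform of a power *)

Section ComplexIntegral.
Context {R : realType} {d : measure_display} {T : measurableType d}.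
Context (mu : {measure set T -> \bar R}).
Local Notation C := R[i].

Definition cint (D : set T) (f : T -> C) : C :=
  (Rintegral mu D (fun s => complex.Re (f s)) +i*
   Rintegral mu D (fun s => complex.Im (f s)))%C.

Definition cintegrable (D : set T) (f : T -> C) : Prop :=
  mu.-integrable D (EFin \o (fun s => complex.Re (f s))) /\
  mu.-integrable D (EFin \o (fun s => complex.Im (f s))).

Lemma integrable_le (D : set T) (f g : T -> R) : measurable D ->
  measurable_fun D f -> mu.-integrable D (EFin \o g) ->
  (forall s, D s -> `|f s| <= g s) -> mu.-integrable D (EFin \o f).
Proof.
move=> mD mf ig fg; apply: (@le_integrable _ _ _ _ _ mD _ (EFin \o g)) => //; last first.
- by move=> s Ds /=; rewrite lee_fin (le_trans (fg _ Ds)) // ler_norm.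
- exact/measurable_EFinP.
Qed.

Lemma cintegrable_le (D : set T) (f : T -> C) (g : T -> R) : measurable D ->
  measurable_fun D (fun s => complex.Re (f s)) ->
  measurable_fun D (fun s => complex.Im (f s)) ->
  mu.-integrable D (EFin \o g) -> (forall s, D s -> nr (f s) <= g s) ->
  cintegrable D f.
Proof.
move=> mD mR mI ig fg; split.
  apply: (integrable_le mD mR ig) => s Ds.
  by rewrite (le_trans (Re_le_nr _)) // fg.
apply: (integrable_le mD mI ig) => s Ds.
by rewrite (le_trans (Im_le_nr _)) // fg.
Qed.

Lemma cintegrableS (D E : set T) (f : T -> C) : measurable D -> measurable E -> E `<=` D ->
  cintegrable D f -> cintegrable E f.
Proof. by move=> mD mE ED [h1 h2]; split; [apply: integrableS h1|apply: integrableS h2]. Qed.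

Lemma ReD (x y : C) : complex.Re (x + y) = complex.Re x + complex.Re y.
Proof. by case: x y => [? ?] []. Qed.
Lemma ImD (x y : C) : complex.Im (x + y) = complex.Im x + complex.Im y.
Proof. by case: x y => [? ?] []. Qed.
Lemma ReM (x y : C) : complex.Re (x * y) =
  complex.Re x * complex.Re y - complex.Im x * complex.Im y.
Proof. by case: x y => [? ?] []. Qed.
Lemma ImM (x y : C) : complex.Im (x * y) =
  complex.Re x * complex.Im y + complex.Im x * complex.Re y.
Proof. by case: x y => [? ?] []. Qed.

Lemma integrable_scale (D : set T) (f : T -> R) (a : R) : measurable D ->
  mu.-integrable D (EFin \o f) -> mu.-integrable D (EFin \o (fun s => a * f s)).
Proof. by move=> mD; exact: integrableZl. Qed.

Lemma integrable_lin (D : set T) (f g : T -> R) (a b : R) : measurable D ->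
  mu.-integrable D (EFin \o f) -> mu.-integrable D (EFin \o g) ->
  mu.-integrable D (EFin \o (fun s => a * f s + b * g s)).
Proof.
move=> mD i1 i2.
have h := integrableD mD (integrableZl mD a i1) (integrableZl mD b i2).
by apply: (eq_integrable mD _ _ _ h) => s _ /=; rewrite EFinD !EFinM.
Qed.

Lemma Rintegral_lin (D : set T) (f g : T -> R) (a b : R) : measurable D ->
  mu.-integrable D (EFin \o f) -> mu.-integrable D (EFin \o g) ->
  Rintegral mu D (fun s => a * f s + b * g s) =
  a * Rintegral mu D f + b * Rintegral mu D g.
Proof.
move=> mD i1 i2; rewrite RintegralD // ?RintegralZl //.
  exact: integrableZl i1.
exact: integrableZl i2.
Qed.

Lemma cintegrableD (D : set T) (f g : T -> C) : measurable D ->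
  cintegrable D f -> cintegrable D g -> cintegrable D (fun s => f s + g s).
Proof.
move=> mD [f1 f2] [g1 g2]; split.
  apply: (eq_integrable mD _ _ _ (integrable_lin 1 1 mD f1 g1)) => s _ /=.
  by rewrite !mul1r ReD.
apply: (eq_integrable mD _ _ _ (integrable_lin 1 1 mD f2 g2)) => s _ /=.
by rewrite !mul1r ImD.
Qed.

Lemma cintegrableZ (D : set T) (c : C) (f : T -> C) : measurable D ->
  cintegrable D f -> cintegrable D (fun s => c * f s).
Proof.
move=> mD [f1 f2]; split.
  apply: (eq_integrable mD _ _ _ (integrable_lin (complex.Re c) (- complex.Im c) mD f1 f2)) => s _ /=.
  by rewrite ReM mulNr.
apply: (eq_integrable mD _ _ _ (integrable_lin (complex.Re c) (complex.Im c) mD f2 f1)) => s _ /=.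
by rewrite ImM.
Qed.

Lemma cintD (D : set T) (f g : T -> C) : measurable D ->
  cintegrable D f -> cintegrable D g -> cint D (fun s => f s + g s) = cint D f + cint D g.
Proof.
move=> mD [f1 f2] [g1 g2]; apply/eqP; rewrite eq_complex /=; apply/andP; split; apply/eqP.
  by rewrite -RintegralD //; apply: eq_Rintegral => s _; rewrite ReD.
by rewrite -RintegralD //; apply: eq_Rintegral => s _; rewrite ImD.
Qed.

Lemma cintZ (D : set T) (c : C) (f : T -> C) : measurable D ->
  cintegrable D f -> cint D (fun s => c * f s) = c * cint D f.
Proof.
move=> mD [f1 f2]; apply/eqP; rewrite eq_complex ReM ImM /=.
apply/andP; split; apply/eqP.
  rewrite -mulNr -Rintegral_lin //.
  by apply: eq_Rintegral => s _; rewrite ReM mulNr.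
by rewrite -Rintegral_lin //; apply: eq_Rintegral => s _; rewrite ImM.
Qed.

(** The two parts are bounded separately, whence the factor 2, which affects only auxiliary
    constants. *)
Lemma nr_cint_le (D : set T) (f : T -> C) (g : T -> R) : measurable D -> cintegrable D f ->
  mu.-integrable D (EFin \o g) -> (forall s, D s -> nr (f s) <= g s) ->
  nr (cint D f) <= 2 * Rintegral mu D g.
Proof.
move=> mD [f1 f2] ig fg; rewrite (le_trans (nr_le_ReIm _)) //= mulr_natl mulr2n.
apply: lerD; (apply: le_trans; first exact: le_normr_Rintegral);
  (apply: le_Rintegral => //; first exact: integrable_norm).
  by move=> s Ds /=; rewrite (le_trans (Re_le_nr _)) // fg.
by move=> s Ds /=; rewrite (le_trans (Im_le_nr _)) // fg.
Qed.

End ComplexIntegral.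

(** * The Gamma integrand with a complex rate: integrability and differentiation *)

Section GammaIntegral.
Context {R : realType}.
Local Notation C := R[i].
Local Notation mu := (@lebesgue_measure R).

Definition gam (m x s : R) : R := s `^ (m - 1) * expR (- (x * s)).

Lemma gam_ge0 m x s : 0 <= gam m x s.
Proof. by rewrite mulr_ge0 ?powR_ge0 ?expR_ge0. Qed.

Lemma gamS (m x s : R) : 0 < m -> 0 <= s -> gam (m + 1) x s = s * gam m x s.
Proof. by move=> m0 s0; rewrite /gam addrK mulrA mulr_powRB1. Qed.

Lemma measurable_gam D m x : measurable_fun D (gam m x).
Proof.
apply: measurable_funTS; apply: measurable_funM; first exact: measurable_powR.
apply: (measurableT_comp (@measurable_expR R)).
by apply: (measurableT_comp (@oppr_measurable R setT)); exact: mulrl_measurable.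
Qed.

(** A single term of the exponential series, of integer degree above |m|, suffices. *)
Lemma powR_le_expR (m x : R) : 0 < x -> exists2 K : R, 0 < K &
  forall s, 1 <= s -> s `^ m <= K * expR (x * s).
Proof.
move=> x0; pose k := Num.bound `|m|.
have mk : m <= k.+1%:R.
  rewrite (le_trans (ler_norm _)) // natr_bound_le //.
pose K : R := k.+1`!%:R * x^-1 ^+ k.+1.
have K0 : 0 < K by rewrite mulr_gt0 ?exprn_gt0 ?invr_gt0 // ltr0n fact_gt0.
exists K => // s s1; have s0 : 0 <= s by rewrite (le_trans ler01).
rewrite (le_trans (ler_powR s1 mk)) // powR_mulrn //.
have h := expR_ge1Dxn k (mulr_ge0 (ltW x0) s0).
apply: (@le_trans _ _ (K * ((x * s) ^+ k.+1 / k.+1`!%:R))); last first.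
  by rewrite ler_wpM2l ?(ltW K0) // (le_trans _ h) // lerDr.
rewrite le_eqVlt; apply/orP; left; apply/eqP; rewrite /K exprMn exprVn; field.
by rewrite pnatr_eq0 -lt0n fact_gt0 expf_neq0 // gt_eqF.
Qed.

Lemma is_derive_powR_div (m s : R) : 0 < m -> 0 < s ->
  is_derive s (1 : R) (fun u => u `^ m / m) (s `^ (m - 1)).
Proof.
move=> m0 s0.
have h : is_derive s (1 : R) (fun u => u `^ m) (m * s `^ (m - 1)) by exact: is_derive1_powR.
have -> : (fun u : R => u `^ m / m) = m^-1 \*: (fun u : R => u `^ m).
  by apply/funext => u /=; rewrite mulrC.
by apply: is_derive_eq; rewrite /GRing.scale /= mulrA mulVf ?mul1r // gt_eqF.
Qed.

(** The integrand is singular at 0 for m < 1: the primitive s^m / m bounds the integrals over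
    [1/(n+1), 1] by 1/m, and monotone convergence does the rest. *)
Lemma powR_integrable m : 0 < m ->
  mu.-integrable `[0, 1] (EFin \o (fun s : R => s `^ (m - 1))).
Proof.
move=> m0.
pose f := fun s : R => s `^ (m - 1).
have mf D : measurable_fun D (EFin \o f).
  by apply/measurable_EFinP; apply: measurable_funTS; exact: measurable_powR.
apply/integrableP; split; first exact: mf.
under eq_integral do rewrite /= ger0_norm ?powR_ge0 //.
rewrite -integral_itv_obnd_cbnd; last exact: mf.
rewrite itv_open_bnd_bigcup.
pose F n := `[0 + n.+1%:R^-1, 1]%classic : set (measurableTypeR R).
rewrite (_ : \bigcup_n _ = \bigcup_n F n) //.
apply: (le_lt_trans _ (ltry (m^-1))).
have h : (\int[mu]_(x in F i) (EFin \o f) x)%E @[i --> \oo] -->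
    (\int[mu]_(x in \bigcup_i F i) (EFin \o f) x)%E.
  apply: ge0_nondecreasing_set_cvg_integral.
  - move=> a b ab; rewrite subsetEset => s; rewrite /F /= !in_itv /= !add0r => /andP[h ->].
    by rewrite andbT (le_trans _ h) // lef_pV2 ?posrE ?ltr0n // ler_nat ltnS.
  - by move=> i; exact: measurable_itv.
  - by move=> i; exact: mf.
  - by move=> i s _; rewrite lee_fin powR_ge0.
apply: (cvge_le _ h); apply: nearW => n; rewrite /F add0r.
set e : R := n.+1%:R^-1; have e0 : 0 < e by rewrite invr_gt0.
have e1 : e <= 1 by rewrite invf_le1 // ler1n.
move: e1; rewrite le_eqVlt => /predU1P[->|e1].
  by rewrite set_itv1 integral_set1 lee_fin invr_ge0 ltW.
rewrite (@continuous_FTC2 _ f (fun u => u `^ m / m)) //.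
- by rewrite -EFinB lee_fin powR1 mul1r gerBl divr_ge0 ?powR_ge0 ?(ltW m0).
- apply: derivable_within_continuous => s; rewrite in_itv /= => /andP[es _].
  by apply: derivable_powR; rewrite in_itv /= andbT (lt_le_trans e0).
- have dd s : 0 < s -> derivable (fun u : R => u `^ m / m) s 1.
    by move=> s0; case: (is_derive_powR_div m0 s0).
  have cc s : 0 < s -> {for s, continuous (fun u : R => u `^ m / m)}.
    by move=> /dd /derivable1_diffP /differentiable_continuous.
  split.
  + by move=> s; rewrite in_itv /= => /andP[es _]; apply: dd; exact: lt_trans es.
  + by apply: cvg_at_right_filter; apply: cc.
  + by apply: cvg_at_left_filter; apply: cc.
- move=> s; rewrite in_itv /= => /andP[es _].
  by have [_] := is_derive_powR_div m0 (lt_trans e0 es); rewrite derive1E.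
Qed.

(** Comparison with s^(m-1) on [0, 1] and with an exponential density of rate x / 2 beyond 1. *)
Lemma gam_integrable m x : 0 < m -> 0 < x -> mu.-integrable `[0, +oo[ (EFin \o gam m x).
Proof.
move=> m0 x0.
have i1 := powR_integrable m0.
have i2 : mu.-integrable `]1, +oo[ (EFin \o gam m x).
  have x2 : 0 < x / 2 by rewrite divr_gt0.
  have [K K0 hK] := powR_le_expR (m - 1) x2.
  have ie := integrable_exponential_pdf x2.
  pose g s := K / (x / 2) * exponential_pdf (x / 2) s.
  have ig : mu.-integrable `]1, +oo[ (EFin \o g).
    have h := @integrableS _ _ _ mu setT `]1, +oo[%classic _ measurableT (measurable_itv _) (@subsetT _ _) ie.
    by apply: integrable_scale => //; exact: measurable_itv.
  apply: (integrable_le _ _ ig); [exact: measurable_itv|exact: measurable_gam|move=> s /=].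
  rewrite in_itv /= andbT => s1; rewrite ger0_norm ?gam_ge0 // /g.
  rewrite exponential_pdfE ?(le_trans ler01) ?(ltW s1) // mulrA divfK ?gt_eqF //.
  have -> : expR (- (x / 2) * s) = expR (x / 2 * s) * expR (- (x * s)).
    by rewrite -expRD; congr expR; field.
  by rewrite /gam mulrA ler_wpM2r ?expR_ge0 // hK // ltW.
have i1' : mu.-integrable `[0, 1] (EFin \o gam m x).
  apply: (integrable_le _ _ i1); [exact: measurable_itv|exact: measurable_gam|move=> s /=].
  rewrite in_itv /= => /andP[s0 s1]; rewrite ger0_norm ?gam_ge0 //.
  by rewrite /gam ler_piMr ?powR_ge0 // expR_le1 oppr_le0 mulr_ge0 // ltW.
apply/integrableP; split; first by apply/measurable_EFinP; exact: measurable_gam.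
have -> : `[0, +oo[%classic = `[0, 1]%classic `|` `]1, +oo[%classic :> set (measurableTypeR R).
  by rewrite -itv_bndbnd_setU // bnd_simp.
rewrite ge0_integral_setU //=.
- by case/integrableP: i1' => _ h1; case/integrableP: i2 => _ h2; rewrite lte_add_pinfty.
- by apply/measurable_EFinP; apply: measurableT_comp => //; exact: measurable_gam.
- by apply/disj_setPLR => s /=; rewrite !in_itv /= andbT => /andP[_ s1]; apply/negP; rewrite -leNgt.
Qed.

Definition cgam (m : R) (z : C) (s : R) : C :=
  (s `^ (m - 1))%:C%C * cexp (- (z * s%:C%C)).

Lemma cgam_Re m z s : complex.Re (cgam m z s) =
  gam m (complex.Re z) s * cos (complex.Im z * s).
Proof.
case: z => x y; rewrite /cgam /gam /cexp /= !mulr0 !mul0r !subr0 !add0r.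
by rewrite cosN mulrA.
Qed.

Lemma cgam_Im m z s : complex.Im (cgam m z s) =
  - (gam m (complex.Re z) s * sin (complex.Im z * s)).
Proof.
case: z => x y; rewrite /cgam /gam /cexp /= !mulr0 !mul0r !subr0 !addr0 !add0r.
by rewrite sinN !mulrN mulrA.
Qed.

Lemma nr_cgam m z s : nr (cgam m z s) = gam m (complex.Re z) s.
Proof.
rewrite /cgam nrM nrR ger0_norm ?powR_ge0 // nr_cexp /gam; congr (_ * expR _).
by case: z => x y; rewrite /= mulr0 subr0.
Qed.

Lemma measurable_cgam_Re D m z : measurable_fun D (fun s => complex.Re (cgam m z s)).
Proof.
rewrite (_ : (fun s => _) = gam m (complex.Re z) \* (cos \o *%R (complex.Im z))).
  apply: measurable_funM; first exact: measurable_gam.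
  apply: (measurableT_comp (f := cos)); last exact: mulrl_measurable.
  by apply: continuous_measurable_fun; exact: continuous_cos.
by apply/funext => s; rewrite cgam_Re.
Qed.

Lemma measurable_cgam_Im D m z : measurable_fun D (fun s => complex.Im (cgam m z s)).
Proof.
rewrite (_ : (fun s => _) = (gam m (complex.Re z) \* (-%R \o (sin \o *%R (complex.Im z))))).
  apply: measurable_funM; first exact: measurable_gam.
  apply: (measurableT_comp (@oppr_measurable R setT)).
  apply: (measurableT_comp (f := sin)); last exact: mulrl_measurable.
  by apply: continuous_measurable_fun; exact: continuous_sin.
by apply/funext => s; rewrite cgam_Im /= mulrN.
Qed.

Lemma cgam_integrable m z : 0 < m -> 0 < complex.Re z ->
  cintegrable mu `[0, +oo[ (cgam m z).
Proof.
move=> m0 z0; apply: cintegrable_le (gam_integrable m0 z0) _.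
- exact: measurable_itv.
- exact: measurable_cgam_Re.
- exact: measurable_cgam_Im.
- by move=> s _; rewrite nr_cgam.
Qed.

Lemma gam_le (m x y s : R) : 0 <= s -> x <= y -> gam m y s <= gam m x s.
Proof.
move=> s0 xy; rewrite /gam ler_wpM2l ?powR_ge0 // ler_expR lerN2.
by rewrite ler_wpM2r.
Qed.

(** If |z' - z| <= a/2, the Taylor bound of the exponential applies and half of the decay rate
    absorbs its factor e^(a s / 2). If |z' - z| > a/2, the three terms are estimated separately,
    since constants and first powers are then dominated by |z' - z|^2. *)
Lemma cgam_taylor (m a : R) (z z' : C) (s : R) : 0 < m -> 0 < a ->
  a <= complex.Re z -> a <= complex.Re z' -> 0 <= s ->
  nr (cgam m z' s - cgam m z s + (z' - z) * cgam (m + 1) z s) <=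
  (4 + 8 / a ^+ 2 + 2 / a) * nr (z' - z) ^+ 2 *
  (gam m (a / 2) s + gam (m + 1) (a / 2) s + gam (m + 1 + 1) (a / 2) s).
Proof.
move=> m0 a0 az az' s0; set dl := nr (z' - z).
have dl0 : 0 <= dl by exact: nr_ge0.
have m10 : 0 < m + 1 by rewrite addr_gt0.
rewrite !gamS // -/(gam m (a / 2) s).
set G := gam m (a / 2) s; have G0 : 0 <= G by exact: gam_ge0.
pose d : C := - ((z' - z) * s%:C%C).
have nd : nr d = dl * s by rewrite nrN nrM nrR ger0_norm.
have E1 : cgam (m + 1) z s = s%:C%C * cgam m z s.
  by rewrite /cgam addrK mulrA -rmorphM /= mulr_powRB1.
have E2 : cgam m z' s = cgam m z s * cexp d.
  by rewrite /cgam -mulrA -cexpD /d; congr (_ * cexp _); ring.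
have nz : nr (cgam m z s) = gam m (complex.Re z) s by exact: nr_cgam.
have a2 : a / 2 <= complex.Re z by rewrite (le_trans _ az) // ler_pdivrMr // ler_peMr ?(ltW a0) // ler1n.
have a2' : a / 2 <= complex.Re z' by rewrite (le_trans _ az') // ler_pdivrMr // ler_peMr ?(ltW a0) // ler1n.
have d2 : 0 <= dl ^+ 2 by rewrite exprn_ge0.
have sG : 0 <= s * G by rewrite mulr_ge0.
have ssG : 0 <= s * (s * G) by rewrite mulr_ge0.
have ia : 0 <= 2 / a by rewrite divr_ge0 // ltW.
have ia2 : 0 <= 8 / a ^+ 2 by rewrite divr_ge0 // exprn_ge0 // ltW.
case: (leP dl (a / 2)) => hdl.
  have -> : cgam m z' s - cgam m z s + (z' - z) * cgam (m + 1) z s =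
      cgam m z s * (cexp d - 1 - d) by rewrite E1 E2 /d; ring.
  rewrite nrM nz.
  have hB : nr d <= a / 2 * s by rewrite nd ler_wpM2r.
  have h := cexp_sub1id hB; rewrite nd exprMn in h.
  have h2 : gam m (complex.Re z) s * expR (a / 2 * s) <= G.
    rewrite /G /gam -mulrA -expRD ler_wpM2l ?powR_ge0 // ler_expR.
    have : a * s <= complex.Re z * s by rewrite ler_wpM2r.
    lra.
  apply: (@le_trans _ _ (4 * dl ^+ 2 * (s * (s * G)))).
    apply: (le_trans (ler_wpM2l (gam_ge0 _ _ _) h)).
    have -> : gam m (complex.Re z) s * (4 * expR (a / 2 * s) * (dl ^+ 2 * s ^+ 2)) =
       4 * dl ^+ 2 * s ^+ 2 * (gam m (complex.Re z) s * expR (a / 2 * s)) by ring.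
    have -> : 4 * dl ^+ 2 * (s * (s * G)) = 4 * dl ^+ 2 * s ^+ 2 * G by ring.
    by rewrite ler_wpM2l // !mulr_ge0.
  apply: ler_pM => //; [by rewrite mulr_ge0|by rewrite ler_wpM2r //; lra|lra].
rewrite (le_trans (nrD _ _)) // (le_trans (lerD (nrB _ _) (lexx _))) // E1 (nrM (_ - _)) (nrM s%:C%C) nrR.
rewrite !nr_cgam (ger0_norm s0) -/dl.
have g1 : gam m (complex.Re z) s <= G by exact: gam_le.
have g2 : gam m (complex.Re z') s <= G by exact: gam_le.
have q1 : 1 <= 4 / a ^+ 2 * dl ^+ 2.
  have -> : 4 / a ^+ 2 * dl ^+ 2 = (dl / (a / 2)) ^+ 2 by field; rewrite gt_eqF.
  by rewrite exprn_ege1 // ler_pdivlMr ?divr_gt0 // mul1r ltW.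
have q2 : dl <= 2 / a * dl ^+ 2.
  have -> : 2 / a * dl ^+ 2 = dl * (dl / (a / 2)) by field; rewrite gt_eqF.
  by rewrite ler_peMr // ler_pdivlMr ?divr_gt0 // mul1r ltW.
have b1 : G <= 4 / a ^+ 2 * dl ^+ 2 * G by rewrite ler_peMl.
have b2 : dl * (s * gam m (complex.Re z) s) <= 2 / a * dl ^+ 2 * (s * G).
  by apply: ler_pM => //; [rewrite mulr_ge0 // gam_ge0|rewrite ler_wpM2l].
have c1 : 0 <= dl ^+ 2 * G by rewrite mulr_ge0.
have c2 : 0 <= dl ^+ 2 * (s * G) by rewrite mulr_ge0.
have c3 : 0 <= dl ^+ 2 * (s * (s * G)) by rewrite mulr_ge0.
have c4 := mulr_ge0 ia c1. have c5 := mulr_ge0 ia c2. have c6 := mulr_ge0 ia c3.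
have c7 := mulr_ge0 ia2 c1. have c8 := mulr_ge0 ia2 c2. have c9 := mulr_ge0 ia2 c3.
have e8 : 8 / a ^+ 2 * (dl ^+ 2 * G) = 2 * (4 / a ^+ 2 * dl ^+ 2 * G) by field; rewrite gt_eqF.
have e2 : 2 / a * (dl ^+ 2 * (s * G)) = 2 / a * dl ^+ 2 * (s * G) by ring.
have -> : (4 + 8 / a ^+ 2 + 2 / a) * dl ^+ 2 * (G + s * G + s * (s * G)) =
  4 * (dl ^+ 2 * G) + 4 * (dl ^+ 2 * (s * G)) + 4 * (dl ^+ 2 * (s * (s * G)))
  + 8 / a ^+ 2 * (dl ^+ 2 * G) + 8 / a ^+ 2 * (dl ^+ 2 * (s * G))
  + 8 / a ^+ 2 * (dl ^+ 2 * (s * (s * G)))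
  + 2 / a * (dl ^+ 2 * G) + 2 / a * (dl ^+ 2 * (s * G)) + 2 / a * (dl ^+ 2 * (s * (s * G))).
  by ring.
lra.
Qed.

Definition LT (m : R) (z : C) : C := cint mu `[0, +oo[ (cgam m z).

(** On a bounded set the Lipschitz clause follows from the bounds on derivative and remainder,
    because |z' - z|^2 <= 2 |B| |z' - z|. *)
Lemma T2_intro (V : normedModType C) (P : set C) (f df : C -> V) (L B : R) :
  (forall z, P z -> nr z <= B) -> (forall z, P z -> nr (f z) <= L) ->
  (forall z, P z -> nr (df z) <= L) ->
  (forall z z', P z -> P z' ->
     nr (f z' - f z - (z' - z) *: df z) <= L * nr (z' - z) ^+ 2) -> T2 P f df.
Proof.
move=> hB h1 h2 h3; pose b := `|B|; pose l := `|L|.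
have b0 : 0 <= b by exact: normr_ge0.
have l0 : 0 <= l by exact: normr_ge0.
have Ll : L <= l by exact: ler_norm.
have lb : 0 <= l * (2 * b) by rewrite mulr_ge0 // mulr_ge0.
exists (l + l * (2 * b)); first by rewrite addr_ge0.
move=> z z' Pz Pz'; set d := nr (z' - z).
have d0 : 0 <= d by exact: nr_ge0.
have db : d <= 2 * b.
  rewrite (le_trans (nrB _ _)) // mulr_natl mulr2n.
  by apply: lerD; [have := hB _ Pz'|have := hB _ Pz] => /le_trans; apply; exact: ler_norm.
have h : nr (f z' - f z - (z' - z) *: df z) <= l * d ^+ 2.
  by rewrite (le_trans (h3 _ _ Pz Pz')) // ler_wpM2r // exprn_ge0.
split.
- by rewrite (le_trans (h1 _ Pz)) // (le_trans Ll) // lerDl.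
- by rewrite (le_trans (h2 _ Pz)) // (le_trans Ll) // lerDl.
- rewrite (le_trans (nr_le_dist _ ((z' - z) *: df z))) // nrZ -/d.
  have : d * nr (df z) <= d * l by rewrite ler_wpM2l // (le_trans (h2 _ Pz)).
  have : l * d ^+ 2 <= l * (2 * b) * d by rewrite expr2 -mulrA ler_wpM2l // ler_wpM2r.
  lra.
- rewrite (le_trans h) // ler_wpM2r ?exprn_ge0 // lerDl.
  by [].
Qed.

(** Differentiation under the integral: the pointwise bound [cgam_taylor] is integrated over s. *)
Lemma T2_LT (m a B : R) : 0 < m -> 0 < a ->
  T2 (rhp a B) (LT m : C -> C^o) (fun z => - LT (m + 1) z).
Proof.
move=> m0 a0; have m10 : 0 < m + 1 by rewrite addr_gt0.
have m20 : 0 < m + 1 + 1 by rewrite addr_gt0.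
have a20 : 0 < a / 2 by rewrite divr_gt0.
have mI : measurable (`[0, +oo[ : set (measurableTypeR R)) by exact: measurable_itv.
pose I k := Rintegral mu `[0, +oo[ (gam k a).
have I0 k : 0 <= I k by apply: Rintegral_ge0 => s _; exact: gam_ge0.
have LTb k z : 0 < k -> a <= complex.Re z -> nr (LT k z) <= 2 * I k.
  move=> k0 az; apply: nr_cint_le => //.
  - by apply: cgam_integrable => //; exact: lt_le_trans az.
  - exact: gam_integrable.
  - by move=> s /=; rewrite in_itv /= andbT => s0; rewrite nr_cgam gam_le.
pose G s := 1 * (1 * gam m (a / 2) s + 1 * gam (m + 1) (a / 2) s) + 1 * gam (m + 1 + 1) (a / 2) s.
have iG : mu.-integrable `[0, +oo[ (EFin \o G).
  by apply: integrable_lin => //; [apply: integrable_lin => //|]; exact: gam_integrable.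
pose K := 4 + 8 / a ^+ 2 + 2 / a.
have K0 : 0 <= K.
  by rewrite !addr_ge0 // divr_ge0 // ?exprn_ge0 // ltW.
pose J := 2 * K * Rintegral mu `[0, +oo[ G.
have J0 : 0 <= J.
  rewrite !mulr_ge0 //; apply: Rintegral_ge0 => s _.
  by rewrite /G !mul1r !addr_ge0 // gam_ge0.
apply: (@T2_intro _ _ _ _ (2 * I m + 2 * I (m + 1) + J) B).
- by move=> z [].
- move=> z [az _]; apply: le_trans (LTb _ _ m0 az) _.
  by rewrite -addrA lerDl addr_ge0 // mulr_ge0.
- move=> z [az _]; rewrite [nr _]nrN; apply: le_trans (LTb _ _ m10 az) _.
  by rewrite -addrA [X in _ <= X]addrCA lerDl addr_ge0 // mulr_ge0.
move=> z z' [az _] [az' _]; set d := nr (z' - z).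
have Rz := lt_le_trans a0 az; have Rz' := lt_le_trans a0 az'.
have i1 := cgam_integrable m0 Rz; have i1' := cgam_integrable m0 Rz'.
have i2 := cgam_integrable m10 Rz.
have i3 := cintegrableZ (- 1) mI i1.
have i4 := cintegrableZ (z' - z) mI i2.
have i5 := cintegrableD mI i1' i3.
have -> : LT m z' - LT m z - (z' - z) *: (- LT (m + 1) z : C^o) =
    cint mu `[0, +oo[ (fun s => cgam m z' s + - 1 * cgam m z s + (z' - z) * cgam (m + 1) z s).
  rewrite cintD // cintD // cintZ // cintZ // mulN1r.
  by rewrite -[(z' - z) *: _]/((z' - z) * _) mulrN opprK.
apply: (@le_trans _ _ (J * d ^+ 2)); last first.
  rewrite ler_wpM2r ?exprn_ge0 ?nr_ge0 //.
  by rewrite lerDr addr_ge0 // mulr_ge0.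
have iKG := integrable_scale (K * d ^+ 2) mI iG.
have -> : J * d ^+ 2 = 2 * Rintegral mu `[0, +oo[ (fun s => K * d ^+ 2 * G s).
  by rewrite RintegralZl // /J; ring.
apply: nr_cint_le => //; first exact: cintegrableD.
move=> s /=; rewrite in_itv /= andbT => s0.
by rewrite mulN1r /G !mul1r; exact: cgam_taylor.
Qed.

End GammaIntegral.

(** * Evaluation of the Laplace transform of a power *)

Section LaplaceOfPower.
Context {R : realType}.
Local Notation C := R[i].
Local Notation mu := (@lebesgue_measure R).

Section ByParts.
Variables (m x y th : R).
Hypotheses (m0 : 0 < m) (m1 : m <= 1) (x0 : 0 < x).

(** The real part of e^(-i th) s^m e^(-(x + i y) s). The phases th = 0 and th = - pi / 2 yield the
    two real equations of the complex integration by parts. *)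
Let H (s : R) : R := s `^ m * expR (- (x * s)) * cos (y * s + th).
Let h (s : R) : R := m * (gam m x s * cos (y * s + th)) +
  (- x) * (gam (m + 1) x s * cos (y * s + th)) +
  (- y) * (gam (m + 1) x s * sin (y * s + th)).

Let dH (s : R) : 0 < s -> is_derive s (1 : R) H (h s).
Proof.
move=> s0.
have h1 : is_derive s (1 : R) (fun u : R => u `^ m) (m * s `^ (m - 1)) by exact: is_derive1_powR.
have h2 : is_derive s (1 : R) (fun u : R => expR (- (x * u))) (- x * expR (- (x * s))).
  have e1 : is_derive s (1 : R) (fun u : R => - (x * u)) (- x).
    have -> : (fun u : R => - (x * u)) = (- x) \*: (id : R -> R).
      by apply/funext => u /=; rewrite /GRing.scale /= mulNr.
    by apply: is_derive_eq; rewrite /GRing.scale /= mulr1.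
  by apply: is_derive_eq; rewrite mulrC.
have e3 : is_derive s (1 : R) (fun u : R => y * u + th) y.
  have -> : (fun u : R => y * u + th) = (y \*: (id : R -> R)) + cst th.
    by apply/funext => u /=.
  by apply: is_derive_eq; rewrite /GRing.scale /= mulr1 addr0.
have h3 : is_derive s (1 : R) (fun u : R => cos (y * u + th)) (- y * sin (y * s + th)).
  have hc := @is_derive1_comp _ cos (fun u : R => y * u + th) s _ _ (is_derive_cos (y * s + th)) e3.
  by apply: (is_derive_eq hc); rewrite mulNr mulrC mulNr.
have h12 := is_deriveM h1 h2.
have h123 := is_deriveM h12 h3.
have -> : H = ((fun u : R => u `^ m) * (fun u : R => expR (- (x * u)))) *
    (fun u : R => cos (y * u + th)) by apply/funext.
apply: (is_derive_eq h123).
rewrite [X in X *: _ + _](_ : _ = s `^ m * expR (- (x * s))) //.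
by rewrite /h /gam addrK /GRing.scale /=; ring.
Qed.

Let ih : mu.-integrable `]0, +oo[ (EFin \o h).
Proof.
have mI : measurable (`]0, +oo[ : set (measurableTypeR R)) by exact: measurable_itv.
have aux k (f : R -> R) : 0 < k -> measurable_fun setT f -> (forall s, `|f s| <= 1) ->
    mu.-integrable `]0, +oo[ (EFin \o (fun s => gam k x s * f s)).
  move=> k0 mf f1; apply: (integrable_le mI) => [||s _].
  - by apply: measurable_funM; [exact: measurable_gam|exact: measurable_funTS].
  - apply: (@integrableS _ _ _ mu `[0, +oo[%classic) (gam_integrable k0 x0).
    + exact: measurable_itv.
    + exact: measurable_itv.
    + by apply: subset_itvr; rewrite bnd_simp.
  - by rewrite normrM (ger0_norm (gam_ge0 _ _ _)) ler_piMr ?gam_ge0.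
have ml : measurable_fun setT (fun s : R => y * s + th).
  by apply: measurable_funD => //; exact: mulrl_measurable.
have mc : measurable_fun setT (fun s : R => cos (y * s + th)).
  apply: (measurableT_comp (f := cos)) => //.
  by apply: continuous_measurable_fun; exact: continuous_cos.
have ms : measurable_fun setT (fun s : R => sin (y * s + th)).
  apply: (measurableT_comp (f := sin)) => //.
  by apply: continuous_measurable_fun; exact: continuous_sin.
have m10 : 0 < m + 1 by rewrite addr_gt0.
have i1 := aux m _ m0 mc (fun s => cos_max _).
have i2 := aux (m + 1) _ m10 mc (fun s => cos_max _).
have i3 := aux (m + 1) _ m10 ms (fun s => sin_max _).
have i12 := integrable_lin m (- x) mI i1 i2.
have := integrable_lin 1 (- y) mI i12 i3.
by apply: eq_integrable => // s _ /=; rewrite mul1r.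
Qed.

Let Hsmall (e : R) : 0 < e -> exists n0 : nat, forall n, (n0 <= n)%N ->
  `|H n.+1%:R - H (n.+1%:R^-1)| <= e.
Proof.
move=> e0; have e20 : 0 < e / 2 by rewrite divr_gt0.
have [n1 h1] := natr_mul_expR_small x0 e20.
(* [q] solves q^m = e / 2, so 1/(n+1) <= q makes the boundary term near 0 small. *)
pose q := (e / 2) `^ m^-1; have q0 : 0 < q by rewrite powR_gt0.
exists (maxn n1 (Num.bound q^-1)) => n hn.
have N1 : 1 <= (n.+1%:R : R) by rewrite ler1n.
have nH s : 0 <= s -> `|H s| <= s `^ m * expR (- (x * s)).
  move=> s0; rewrite /H normrM ger0_norm ?mulr_ge0 ?powR_ge0 ?expR_ge0 //.
  by rewrite ler_piMr ?mulr_ge0 ?powR_ge0 ?expR_ge0 // cos_max.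
rewrite (le_trans (ler_normB _ _)) // [leRHS]splitr; apply: lerD.
  rewrite (le_trans (nH _ _)) //.
  have hn1 : (n1 <= n.+1)%N by apply: (leq_trans (leq_maxl n1 (Num.bound q^-1))); exact: leqW.
  apply: le_trans (h1 _ hn1); rewrite ler_wpM2r ?expR_ge0 //.
  exact: ler1_powR.
have i0 : 0 <= n.+1%:R^-1 :> R by rewrite invr_ge0.
rewrite (le_trans (nH _ i0)) //.
apply: (@le_trans _ _ (n.+1%:R^-1 `^ m)).
  by rewrite ler_piMr ?powR_ge0 // expR_le1 oppr_le0 mulr_ge0 // ltW.
have -> : e / 2 = q `^ m.
  by rewrite /q -powRrM mulVf ?gt_eqF // powRr1 // ltW.
apply: ge0_ler_powR; rewrite ?nnegrE ?(ltW m0) ?(ltW q0) //.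
rewrite -[q]invrK lef_pV2 ?posrE ?invr_gt0 //.
rewrite natr_bound_le ?invr_ge0 ?(ltW q0) //.
by apply: (leq_trans (leq_maxr n1 (Num.bound q^-1))); exact: leqW.
Qed.

Let En (n : nat) : set R := `[n.+1%:R^-1, n.+1%:R]%classic.

Let int_En n : (\int[mu]_(s in En n) (h s)%:E)%E = (H n.+1%:R - H n.+1%:R^-1)%:E.
Proof.
have i0 : 0 < n.+1%:R^-1 :> R by rewrite invr_gt0.
have : n.+1%:R^-1 <= n.+1%:R :> R.
  by rewrite (le_trans (_ : _ <= 1)) ?ler1n // invf_le1 // ler1n.
rewrite /En le_eqVlt => /predU1P[->|lt].
  by rewrite set_itv1 integral_set1 subrr.
have cH s : 0 < s -> {for s, continuous H}.
  move=> s0; apply/differentiable_continuous/derivable1_diffP.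
  by case: (dH s0).
rewrite (@continuous_FTC2 _ h H) //.
- apply: continuous_in_subspaceT => s; rewrite inE /= in_itv /= => /andP[es _].
  have s0 : 0 < s by exact: lt_le_trans es.
  have cl : {for s, continuous (fun u : R => y * u + th)}.
    by apply: cvgD; [apply: cvgM; [exact: cvg_cst|exact: cvg_id]|exact: cvg_cst].
  have cc : {for s, continuous (fun u : R => cos (y * u + th))}.
    by apply: continuous_comp cl _; exact: continuous_cos.
  have cs : {for s, continuous (fun u : R => sin (y * u + th))}.
    by apply: continuous_comp cl _; exact: continuous_sin.
  have cg k : {for s, continuous (gam k x)}.
    have cp : {for s, continuous (fun u : R => u `^ (k - 1))}.
      apply/differentiable_continuous/derivable1_diffP.
      by case: (is_derive1_powR (k - 1) s0).
    apply: cvgM; first exact: cp.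
    apply: (@continuous_comp _ _ _ (fun u : R => - (x * u)) expR).
      by apply: cvgN; apply: cvgM; [exact: cvg_cst|exact: cvg_id].
    exact: continuous_expR.
  apply: cvgD; first apply: cvgD.
  + by apply: cvgM; [exact: cvg_cst|apply: cvgM; [exact: cg|exact: cc]].
  + by apply: cvgM; [exact: cvg_cst|apply: cvgM; [exact: cg|exact: cc]].
  + by apply: cvgM; [exact: cvg_cst|apply: cvgM; [exact: cg|exact: cs]].
- split.
  + move=> s; rewrite in_itv /= => /andP[es _].
    by case: (dH (lt_trans i0 es)).
  + by apply: cvg_at_right_filter; apply: cH.
  + by apply: cvg_at_left_filter; apply: cH; exact: lt_trans lt.
- move=> s; rewrite in_itv /= => /andP[es _].
  by have [_] := dH (lt_trans i0 es); rewrite derive1E.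
Qed.

(** [h] is the derivative of [H]. Its integrals over [1/(n+1), n+1] are boundary terms that vanish
    in the limit, at 0 because m > 0 and at infinity by exponential decay; dominated convergence
    identifies the limit. *)
Lemma gam_by_parts : Rintegral mu `[0, +oo[ h = 0.
Proof.
have mD : measurable (`]0, +oo[ : set (measurableTypeR R)) by exact: measurable_itv.
have mE n : measurable (En n : set (measurableTypeR R)) by exact: measurable_itv.
rewrite -Rintegral_itv_obnd_cbnd //.
pose f_ (n : nat) : measurableTypeR R -> \bar R := (EFin \o h) \_ (En n).
have mh : measurable_fun (`]0, +oo[ : set (measurableTypeR R)) (EFin \o h).
  by case/integrableP: ih.
have EnS n : En n `<=` `]0, +oo[.
  move=> s; rewrite /En /= !in_itv /= andbT => /andP[es _].
  by apply: lt_le_trans es; rewrite invr_gt0.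
have ih' : mu.-integrable `]0, +oo[ (abse \o (EFin \o h)) by exact: integrable_abse.
have mf n : measurable_fun (`]0, +oo[ : set (measurableTypeR R)) (f_ n).
  by apply/(measurable_restrict _ (mE n) mD); apply: measurable_funS mh.
have f_in n s : En n s -> f_ n s = (h s)%:E by move=> Es; rewrite /f_ patchE mem_set.
have cf : {ae mu, forall s, `]0, +oo[%classic s -> f_ ^~ s @ \oo --> (EFin \o h) s}.
  apply: aeW => s; rewrite /= in_itv /= andbT => s0; apply: cvg_near_cst.
  exists (maxn (Num.bound s) (Num.bound s^-1)) => // n /= hn; rewrite f_in // /En /= in_itv /=.
  apply/andP; split.
    rewrite -[s]invrK lef_pV2 ?posrE ?invr_gt0 // natr_bound_le ?invr_ge0 ?(ltW s0) //.
    by apply: (leq_trans (leq_maxr (Num.bound s) (Num.bound s^-1))); exact: leqW.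
  rewrite natr_bound_le ?(ltW s0) //.
  by apply: (leq_trans (leq_maxl (Num.bound s) (Num.bound s^-1))); exact: leqW.
have bf : {ae mu, forall s n, `]0, +oo[%classic s -> (`|f_ n s| <= (abse \o (EFin \o h)) s)%E}.
  apply: aeW => s n _; rewrite /f_ patchE; case: ifP => _ //.
  by rewrite abse0 /= lee_fin.
have [_ _ hc] := dominated_convergence mD mf mh cf ih' bf.
have iE n : (\int[mu]_(s in `]0%R, +oo[) f_ n s)%E = (H n.+1%:R - H n.+1%:R^-1)%:E.
  rewrite -int_En /f_ -integral_mkcondr; congr (integral _ _ _).
  by apply/setIidPr; exact: EnS.
pose I := Rintegral mu `]0, +oo[ h.
have EI : (\int[mu]_(s in `]0%R, +oo[) (EFin \o h) s)%E = I%:E.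
  by rewrite /I /Rintegral fineK //; exact: integrable_fin_num.
rewrite EI in hc; rewrite -/I.
have hb (e : R) : 0 < e -> `|I| <= e.
  move=> e0; have [n0 hn0] := Hsmall e0; rewrite ler_norml; apply/andP; split.
    rewrite -lee_fin; apply: (cvge_ge _ hc); exists n0 => // n /= hn.
    by rewrite iE lee_fin; have := hn0 n hn; rewrite ler_norml => /andP[].
  rewrite -lee_fin; apply: (cvge_le _ hc); exists n0 => // n /= hn.
  by rewrite iE lee_fin; have := hn0 n hn; rewrite ler_norml => /andP[].
apply/eqP; rewrite -normr_le0; apply/ler_addgt0Pl => e e0.
by rewrite addr0 hb.
Qed.

End ByParts.

Lemma LT_by_parts (m : R) (z : C) : 0 < m -> m <= 1 -> 0 < complex.Re z ->
  z * LT (m + 1) z = m%:C%C * LT m z.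
Proof.
move=> m0 m1; case: z => x y /= x0.
have mI : measurable (`[0, +oo[ : set (measurableTypeR R)) by exact: measurable_itv.
have m10 : 0 < m + 1 by rewrite addr_gt0.
have [c1 s1] : cintegrable mu `[0, +oo[ (cgam m (x +i* y)%C) by exact: cgam_integrable.
have [c2 s2] : cintegrable mu `[0, +oo[ (cgam (m + 1) (x +i* y)%C) by exact: cgam_integrable.
have h0 := gam_by_parts y 0 m0 m1 x0.
have h1 := gam_by_parts y (- (pi / 2)) m0 m1 x0.
have lin3 (a b c : R) (f1 f2 f3 h : R -> R) :
    mu.-integrable `[0, +oo[ (EFin \o f1) -> mu.-integrable `[0, +oo[ (EFin \o f2) ->
    mu.-integrable `[0, +oo[ (EFin \o f3) -> Rintegral mu `[0, +oo[ h = 0 ->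
    (forall s, h s = a * f1 s + b * f2 s + c * f3 s) ->
    a * Rintegral mu `[0, +oo[ f1 + b * Rintegral mu `[0, +oo[ f2 +
    c * Rintegral mu `[0, +oo[ f3 = 0.
  move=> i1 i2 i3 h00 hE; have i12 := integrable_lin a b mI i1 i2.
  rewrite -Rintegral_lin // -[X in X + _]mul1r -Rintegral_lin // -[RHS]h00.
  by apply: eq_Rintegral => s _; rewrite hE mul1r.
have e0 := lin3 m (- x) y _ _ _ _ c1 c2 s2 h0.
have e1 := lin3 (- m) x y _ _ _ _ s1 s2 c2 h1.
lapply e0 => [{}e0|s]; last by rewrite cgam_Re cgam_Re cgam_Im /= addr0; ring.
lapply e1 => [{}e1|s]; last first.
  by rewrite cgam_Re !cgam_Im /= cosBpihalf sinBpihalf; ring.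
move: e0 e1; rewrite /LT /cint.
set p1 := Rintegral _ _ _; set p2 := Rintegral _ _ _; set p3 := Rintegral _ _ _.
set p4 := Rintegral _ _ _.
clearbody p1 p2 p3 p4 => e0 e1.
have e2 : x * p2 - y * p3 = m * p1 by lra.
have e3 : x * p3 + y * p2 = m * p4 by lra.
by apply/eqP; rewrite eq_complex /= !mul0r subr0 addr0 e2 e3 !eqxx.
Qed.

(** The product rule gives the derivative (- LT (m+1) z + m LT m z / z) z^m, which is 0 by
    [LT_by_parts]. *)
Lemma LT_ext (m a B : R) : 0 < m -> m <= 1 -> 0 < a ->
  T2 (rhp a B) (fun z => LT m z * zpow m z : C^o) (fun _ => 0).
Proof.
move=> m0 m1 a0.
have h := T2_scale (T2_LT B m0 a0) (T2_zpow m B a0).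
apply: T2_ext h => // z [az _]; have z0 := lt_le_trans a0 az.
rewrite -[LHS]/(- LT (m + 1) z * zpow m z + LT m z * (m%:C%C * zpow m z / z)).
have := LT_by_parts m0 m1 z0.
have zn0 : z != 0 by rewrite -nr_gt0 Re_gt0_nr.
move=> e; have -> : LT (m + 1) z = m%:C%C * LT m z / z by rewrite -e mulrC mulKf.
by field.
Qed.

Lemma zpow1l (m : R) : zpow m (1 : C) = 1.
Proof.
have e : @clog R 1 = 0 by rewrite /clog /carg nr1 ln1 mul0r atan0.
by rewrite /zpow e mulr0 cexp0.
Qed.

Lemma Gamma_gt0 (m : R) : 0 < m -> 0 < Gamma m.
Proof.
move=> m0.
have i1 := gam_integrable m0 (@ltr01 R).
have mI : measurable (`[0, +oo[ : set (measurableTypeR R)) by exact: measurable_itv.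
have mJ : measurable (`[1, 2] : set (measurableTypeR R)) by exact: measurable_itv.
have -> : Gamma m = Rintegral mu `[0, +oo[ (gam m 1).
  by apply: eq_Rintegral => s _; rewrite /gam mul1r.
have sub : `[1, 2]%classic `<=` (`[0, +oo[%classic : set R).
  by move=> s /=; rewrite !in_itv /= andbT => /andP[h _]; rewrite (le_trans _ h).
pose c : R := Num.min 1 (2 `^ (m - 1)) * expR (- 2).
have c0 : 0 < c by rewrite mulr_gt0 ?expR_gt0 // lt_min ltr01 powR_gt0.
have hc s : `[1, 2]%classic s -> c <= gam m 1 s.
  rewrite /= in_itv /= => /andP[s1 s2]; have s0 := lt_le_trans ltr01 s1.
  rewrite /gam mul1r /c ler_pM ?expR_ge0 //; last by rewrite ler_expR lerN2.
  case: (leP 1 m) => hm.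
    have : 1 `^ (m - 1) <= s `^ (m - 1).
      by rewrite ge0_ler_powR ?nnegrE ?subr_ge0 ?(ltW s0).
    by rewrite powR1 ge_min => ->.
  rewrite ge_min; apply/orP; right.
  rewrite -(opprB 1 m) !powRN lef_pV2 ?posrE ?powR_gt0 //.
  by rewrite ge0_ler_powR ?nnegrE ?subr_ge0 ?(ltW s0) // ltW.
apply: (lt_le_trans c0).
apply: (@le_trans _ _ (Rintegral mu `[1, 2] (gam m 1))).
  have -> : c = Rintegral mu `[1, 2] (cst c).
    rewrite Rintegral_cst // [X in fine X](_ : _ = lebesgue_measure (`[1, 2]%classic : set R)) // lebesgue_measure_itv /= lte_fin ltr1n /=.
    by rewrite -(natrB _ (isT : (1 <= 2)%N)) mulr1.
  apply: le_Rintegral => //; last exact: integrableS i1.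
  have ijg : mu.-integrable `[1, 2] (EFin \o gam m 1) by exact: integrableS i1.
  apply: (integrable_le mJ _ ijg) => // s hs.
  by rewrite ger0_norm ?(ltW c0) // hc.
rewrite /Rintegral fine_le //.
- by apply: integrable_fin_num => //; exact: integrableS i1.
- exact: integrable_fin_num.
apply: ge0_subset_integral => //.
  by apply/measurable_EFinP; exact: measurable_gam.
by move=> s _; rewrite lee_fin gam_ge0.
Qed.

(** This replaces the usual rotation of the contour: the left-hand side has zero derivative, so it
    is constant along the segment from 1 to z, and at 1 it is the Gamma integral. *)
Lemma LT_Gamma (m : R) (z : C) : 0 < m -> m <= 1 -> 0 < complex.Re z ->
  LT m z * zpow m z = (Gamma m)%:C%C.
Proof.
move=> m0 m1 z0.
have -> : (Gamma m)%:C%C = LT m 1 * zpow m 1.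
  rewrite zpow1l mulr1 /LT /cint /Gamma; congr Complex.
    apply: eq_Rintegral => s _; rewrite cgam_Re /gam /= mul0r cos0 mulr1 mul1r //.
  transitivity (Rintegral mu `[0, +oo[ (cst 0)); first by rewrite /Rintegral integral0.
  by apply: eq_Rintegral => s _; rewrite cgam_Im /= mul0r sin0 mulr0 oppr0.
pose a := Num.min 1 (complex.Re z).
have a0 : 0 < a by rewrite lt_min ltr01.
apply: (T2_der0 _ (LT_ext (1 + nr (z - 1)) m0 m1 a0)) => s /andP[s0 s1]; split.
  have -> : complex.Re (1 + s%:C%C * (z - 1)) = 1 - s + s * complex.Re z.
    by case: (z) => x y /=; ring.
  have : (1 - s) * a <= (1 - s) * 1 by rewrite ler_wpM2l ?subr_ge0 // ge_min lexx.
  have : s * a <= s * complex.Re z by rewrite ler_wpM2l // ge_min lexx orbT.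
  lra.
rewrite (le_trans (nrD _ _)) // nr1 lerD2l nrM nrR ger0_norm //.
by rewrite ler_piMl ?nr_ge0.
Qed.
End LaplaceOfPower.

(** * The kernel 1 + 1 * kappa *)

Section Kernel.
Context {R : realType}.
Local Notation C := R[i].
Local Notation lm := (@lebesgue_measure R).

Lemma small_mul (c e : R) : 0 <= c -> 0 < e ->
  exists2 d : R, 0 < d & forall x : R, 0 <= x -> x <= d -> c * x <= e.
Proof.
move=> c0 e0; have c1 : 0 < 1 + c by rewrite (lt_le_trans ltr01) // lerDl.
exists (e / (1 + c)); first by rewrite divr_gt0.
move=> x x0 xd; apply: (@le_trans _ _ ((1 + c) * (e / (1 + c)))).
  by rewrite ler_pM // lerDr.
by rewrite mulrC divfK // gt_eqF.
Qed.

Lemma ReMr (u : C) (r : R) : complex.Re (u * r%:C%C) = complex.Re u * r.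
Proof. by case: u => x y /=; rewrite mulr0 subr0. Qed.

Lemma gam_integrable_fin (m x T : R) : 0 < m -> 0 <= x ->
  lm.-integrable `[0, T] (EFin \o gam m x).
Proof.
move=> m0 x0; have i1 := gam_integrable m0 (@ltr01 R).
have mJ : measurable (`[0, T] : set (measurableTypeR R)) by exact: measurable_itv.
have i2 : lm.-integrable `[0, T] (EFin \o gam m 1).
  apply: integrableS i1 => //.
  by move=> s /=; rewrite !in_itv /= andbT => /andP[].
apply: (integrable_le mJ _ (integrable_scale (expR T) mJ i2)).
  exact: measurable_gam.
move=> s /=; rewrite in_itv /= => /andP[s0 sT]; rewrite ger0_norm ?gam_ge0 //.
rewrite /gam mulrCA ler_wpM2l ?powR_ge0 // -expRD ler_expR mul1r.
have : 0 <= x * s by rewrite mulr_ge0.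
lra.
Qed.

(** Absolute continuity of the integral; a bound on the integrand would not do, as s^(m-1) is
    unbounded near 0 for m < 1. *)
Lemma gam_itv_small (m x T : R) : 0 < m -> 0 <= x -> forall e : R, 0 < e -> exists2 d : R, 0 < d &
  forall t t' : R, 0 <= t -> t <= t' -> t' <= T -> t' - t < d ->
    Rintegral lm `]t, t'] (gam m x) <= e.
Proof.
move=> m0 x0 e e0.
have mJ : measurable (`[0, T] : set (measurableTypeR R)) by exact: measurable_itv.
have i1 := gam_integrable_fin T m0 x0.
have i2 : lm.-integrable setT (EFin \o ((gam m x) \_ `[0, T])).
  by rewrite -restrict_EFin; apply/(integrable_mkcond _ mJ).
have [d [d0 hd]] := integral_normr_continuous i2 e0.
exists d => // t t' t0 tt' t'T h.
have mI : measurable (`]t, t'] : set (measurableTypeR R)) by exact: measurable_itv.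
have {}hd := hd _ mI _; apply/ltW; apply: le_lt_trans (hd _).
  rewrite le_eqVlt; apply/orP; left; apply/eqP; apply: eq_Rintegral => s.
  rewrite inE /= in_itv /= => /andP[ts st'].
  rewrite patchE mem_set /= ?in_itv /= ?(le_trans st') ?(le_trans t0) ?(ltW ts) //.
  by rewrite ger0_norm // gam_ge0.
rewrite [X in (X < _)%E](_ : _ = lebesgue_measure (`]t, t']%classic : set R)) // lebesgue_measure_itv /= lte_fin.
by case: ifP => _; rewrite -?EFinB lte_fin.
Qed.

Lemma cint_itvB (f : R -> C) (a b : itv_bound R) (x : R) :
  cintegrable lm [set` Interval a b] f ->
  (a <= BRight x)%O -> (BRight x <= b)%O ->
  cint lm [set` Interval a b] f - cint lm [set` Interval a (BRight x)] f =
  cint lm [set` Interval (BRight x) b] f.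
Proof.
move=> [i1 i2] ax xb; rewrite /cint -(Rintegral_itvB i1 ax xb) -(Rintegral_itvB i2 ax xb).
by [].
Qed.

Variables (alpha beta mu : R).
Hypotheses (beta0 : 0 <= beta) (mu0 : 0 < mu) (mu1 : mu <= 1).

Let A : R := alpha / Gamma mu.
Let k (t : R) : R := 1 + one_conv_kappa alpha beta mu t.

Lemma one_conv_kappaE t : one_conv_kappa alpha beta mu t =
  A * Rintegral lm `[0, t] (gam mu beta).
Proof.
have mJ : measurable (`[0, t] : set (measurableTypeR R)) by exact: measurable_itv.
have i1 := gam_integrable_fin t mu0 beta0.
rewrite -RintegralZl //; apply: eq_Rintegral => s _.
by rewrite /kappa /gam /A; ring.
Qed.

Lemma kernel_increment t t' : 0 <= t -> t <= t' ->
  k t' - k t = A * Rintegral lm `]t, t'] (gam mu beta).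
Proof.
move=> t0 tt'; have i1 := gam_integrable_fin t' mu0 beta0.
rewrite -(Rintegral_itvB (x := t) i1) ?bnd_simp // mulrBr -!one_conv_kappaE.
by rewrite /k opprD addrACA subrr add0r.
Qed.

Lemma kernel_unif_cont (T : R) : forall e : R, 0 < e -> exists2 d : R, 0 < d &
  forall t t' : R, 0 <= t <= T -> 0 <= t' <= T -> `|t' - t| < d ->
    `|k t' - k t| <= e.
Proof.
move=> e e0; have A1 : 0 < 1 + `|A| by rewrite (lt_le_trans ltr01) // lerDl.
have e1 : 0 < e / (1 + `|A|) by rewrite divr_gt0.
have [d d0 hd] := gam_itv_small T mu0 beta0 e1.
exists d => //.
have key t t' : 0 <= t -> t <= t' -> t' <= T -> `|t' - t| < d -> `|k t' - k t| <= e.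
  move=> t0 tt' t'T; rewrite ger0_norm ?subr_ge0 // => h.
  have I0 : 0 <= Rintegral lm `]t, t'] (gam mu beta).
    by apply: Rintegral_ge0 => s _; exact: gam_ge0.
  rewrite kernel_increment // normrM (ger0_norm I0).
  have {}hd := hd _ _ t0 tt' t'T h.
  apply: (@le_trans _ _ ((1 + `|A|) * (e / (1 + `|A|)))).
    by rewrite ler_pM // lerDr.
  by rewrite mulrC divfK // gt_eqF.
move=> t t' /andP[t0 tT] /andP[t'0 t'T] h; case: (leP t t') => [|/ltW] tt'; first exact: key.
by rewrite distrC; apply: key; rewrite // distrC.
Qed.

Lemma kernel_bounded (T : R) : exists2 K : R, 0 <= K &
  forall t, 0 <= t <= T -> `|k t| <= K.
Proof.
exists (1 + `|A| * Rintegral lm `[0, T] (gam mu beta)).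
  by rewrite addr_ge0 // mulr_ge0 //; apply: Rintegral_ge0 => s _; exact: gam_ge0.
move=> t /andP[t0 tT]; rewrite (le_trans (ler_normD _ _)) // normr1 lerD2l.
rewrite one_conv_kappaE normrM ler_wpM2l // ger0_norm; last first.
  by apply: Rintegral_ge0 => s _; exact: gam_ge0.
have i1 := gam_integrable_fin T mu0 beta0.
rewrite -subr_ge0 (Rintegral_itvB (x := t) i1) ?bnd_simp //.
by apply: Rintegral_ge0 => s _; exact: gam_ge0.
Qed.

Lemma cexp_sub1_le (p : C) (B r : R) : 0 <= r -> nr p * r <= B ->
  nr (cexp (p * r%:C%C) - 1) <= (1 + 4 * expR B * B) * nr p * r.
Proof.
move=> r0 h; have := @cexp_sub1 _ B (p * r%:C%C).
by rewrite nrM nrR ger0_norm // !mulrA => h2; exact: h2.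
Qed.

(* [kp t] is the Laplace transform at [p] of the kernel [k] translated by [t], that is
   [\int_0^oo expR (- p s) k (t + s) ds]; it solves [kp' = p kp - k]. *)
Lemma kernel_transform (T : R) : 0 < T -> exists2 Ck : R, 0 <= Ck &
  forall p : C, 1 <= complex.Re p -> exists kp : R -> C,
  [/\ kp 0 = (1 + alpha%:C%C * zpow (- mu) (p + beta%:C%C)) / p,
      forall t, 0 <= t <= T -> nr (kp t) <= Ck &
      forall e : R, 0 < e -> exists2 d : R, 0 < d &
        forall t dl : R, 0 <= t -> 0 <= dl -> dl < d -> t + dl <= T ->
        nr (kp (t + dl) - cexp (p * dl%:C%C) * kp t + (dl * k t)%:C%C) <= dl * e].
Proof.
move=> T0; have [K K0 hK] := kernel_bounded T.
have G0 := Gamma_gt0 mu0.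
pose J := Rintegral lm `[0, +oo[ (gam mu 1).
have J0 : 0 <= J by apply: Rintegral_ge0 => s _; exact: gam_ge0.
(* The constant must not depend on [p]: it enters the error constant that [inversion_bound] wants
   common to all points. *)
pose Ck := K + `|A| * (2 * (expR T * J)).
have Ck0 : 0 <= Ck by rewrite addr_ge0 // !mulr_ge0 // expR_ge0.
exists Ck => // p p1; set z := p + beta%:C%C.
have p0 : 0 < complex.Re p := lt_le_trans ltr01 p1.
have z1 : 1 <= complex.Re z.
  by rewrite (le_trans p1) // ReD /= lerDl.
have z0 : 0 < complex.Re z := lt_le_trans ltr01 z1.
have pn0 : p != 0 by rewrite -nr_gt0 Re_gt0_nr.
have np1 : 1 <= nr p by rewrite (le_trans p1) // (le_trans _ (Re_le_nr p)) ?ler_norm.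
have iz := cgam_integrable mu0 z0.
have mI a b : measurable ([set` Interval a b] : set (measurableTypeR R)) by exact: measurable_itv.
have sub t : 0 <= t -> `]t, +oo[%classic `<=` (`[0, +oo[%classic : set R).
  by move=> t0 s /=; rewrite !in_itv /= !andbT => ts; rewrite (le_trans t0) // ltW.
have izt t : 0 <= t -> cintegrable lm `]t, +oo[ (cgam mu z).
  by move=> t0; apply: cintegrableS iz; [exact: mI|exact: mI|exact: sub].
pose L t := cint lm `]t, +oo[ (cgam mu z).
have L0 : L 0 = LT mu z.
  have [i1 i2] := izt 0 (lexx 0).
  by rewrite /L /LT /cint (Rintegral_itv_obnd_cbnd i1) (Rintegral_itv_obnd_cbnd i2).
(* The translated transform after one integration by parts: k' is [A] times the integrand
   [gam mu beta], and e^(pt) times the integral of e^(-ps) k'(s) over s > t involves the rate z = p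
   + beta. *)
pose kp t := ((k t)%:C%C + A%:C%C * (cexp (p * t%:C%C) * L t)) / p.
exists kp; split.
- have := LT_Gamma mu0 mu1 z0.
  rewrite /kp L0 mulr0 cexp0 mul1r /k one_conv_kappaE set_itv1 Rintegral_set1 mulr0 addr0 => e.
  have e2 : zpow mu z * zpow (- mu) z = 1.
    by rewrite -zpowD subrr /zpow mul0r cexp0.
  have gn : (Gamma mu)%:C%C != 0 :> C by rewrite -nr_gt0 nrR (gtr0_norm G0).
  have -> : LT mu z = (Gamma mu)%:C%C * zpow (- mu) z by rewrite -e -mulrA e2 mulr1.
  rewrite /A rmorphM /= fmorphV /=; congr (_ / _); congr (_ + _).
  by rewrite -mulrA mulKf.
- move=> t /andP[t0 tT]; have p10 : 0 < nr p := lt_le_trans ltr01 np1.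
  rewrite /kp nrM nrV ler_pdivrMr // (le_trans (nrD _ _)) //.
  apply: (@le_trans _ _ Ck); last by rewrite ler_peMr.
  rewrite nrR /Ck lerD ?hK ?t0 // nrM nrR ler_wpM2l //.
  have iG := gam_integrable mu0 (@ltr01 R).
  have iGt : lm.-integrable `]t, +oo[ (EFin \o gam mu 1).
    by apply: integrableS iG; [exact: mI|exact: mI|exact: sub].
  have iGt' := integrable_scale (expR T) (mI _ _) iGt.
  rewrite -cintZ //; last exact: izt.
  apply: le_trans (nr_cint_le (mI _ _) (cintegrableZ _ (mI _ _) (izt _ t0)) iGt' _) _.
    move=> s /=; rewrite in_itv /= andbT => ts.
    rewrite nrM nr_cexp nr_cgam /gam mulrCA [leRHS]mulrCA ler_wpM2l ?powR_ge0 //.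
    rewrite -!expRD ler_expR /z ReD ReMr /= mul1r.
    have h1 : (complex.Re p - 1) * t <= (complex.Re p - 1) * s.
      by rewrite ler_wpM2l ?subr_ge0 // ltW.
    have h2 : 0 <= beta * s by rewrite mulr_ge0 // (le_trans t0) // ltW.
    lra.
  rewrite ler_wpM2l // (RintegralZl _ (mI _ _) iGt) ler_wpM2l ?expR_ge0 //.
  have hJ := Rintegral_itvB (x := t) iG; rewrite !bnd_simp in hJ.
  rewrite -hJ // gerBl.
  by apply: Rintegral_ge0 => s _; exact: gam_ge0.
move=> e e0.
pose B := nr p * T; have B0 : 0 <= B by rewrite mulr_ge0 ?nr_ge0 // ltW.
pose c1 := K * (4 * expR B * nr p ^+ 2).
have c10 : 0 <= c1 by rewrite !mulr_ge0 ?expR_ge0 ?exprn_ge0 ?nr_ge0.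
pose c3 : R := (1 + 4 * expR B * B) * nr p.
have c30 : 0 <= c3.
  apply: mulr_ge0; last exact: nr_ge0.
  by apply: addr_ge0 => //; rewrite mulr_ge0 // mulr_ge0 // expR_ge0.
pose c2 : R := `|A| * (2 * c3).
have c20 : 0 <= c2 by rewrite mulr_ge0 // mulr_ge0.
have e20 : 0 < e / 2 by rewrite divr_gt0.
have [e1 e10 he1] := small_mul c20 e20; have [d1 d10 hd1] := small_mul c10 e20.
have [d d0 hd] := gam_itv_small T mu0 beta0 e10.
exists (Num.min d d1); first by rewrite lt_min d0.
move=> t dl t0 dl0; rewrite lt_min => /andP[hdl1 hdl2] tT.
have tt' : t <= t + dl by rewrite lerDl.
have t'0 : 0 <= t + dl by rewrite addr_ge0.
have E1 : (k (t + dl))%:C%C = (k t)%:C%C + A%:C%C * (Rintegral lm `]t, (t + dl)] (gam mu beta))%:C%C.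
  by rewrite -rmorphM /= -kernel_increment // -rmorphD /= [k t + _]addrC subrK.
have E2 : L t = cint lm `]t, (t + dl)] (cgam mu z) + L (t + dl).
  have h := cint_itvB (x := t + dl) (izt _ t0).
  by rewrite {2}/L -h ?bnd_simp // addrC subrK.
have E3 : cexp (p * (t + dl)%:C%C) = cexp (p * dl%:C%C) * cexp (p * t%:C%C).
  by rewrite -cexpD -mulrDr -rmorphD /= addrC.
have ig1 := gam_integrable_fin (t + dl) mu0 beta0.
have ig : lm.-integrable `]t, (t + dl)] (EFin \o gam mu beta).
  apply: integrableS ig1 => // s /=; rewrite !in_itv /= => /andP[ts ->].
  by rewrite (le_trans t0) // ltW.
(* What remains of the singular part over one step. The bracket is O(dl), and the integral of the
   other factor over the step tends to 0 with dl, uniformly in t, so the contribution is dl times a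
   small quantity. *)
pose w s : C := cgam mu beta%:C%C s * (1 - cexp (p * (t + dl - s)%:C%C)).
have iz2 : cintegrable lm `]t, (t + dl)] (cgam mu z).
  apply: cintegrableS (izt _ t0) => // s /=; rewrite !in_itv /= andbT => /andP[ts _] //.
have cgb s : cgam mu beta%:C%C s = (gam mu beta s)%:C%C.
  apply/eqP; rewrite eq_complex cgam_Re cgam_Im /= mul0r cos0 sin0 mulr1 mulr0 oppr0.
  by rewrite !eqxx.
have iz3 : cintegrable lm `]t, (t + dl)] (cgam mu beta%:C%C).
  rewrite (funext cgb); split; first exact: ig.
  by apply: integrable0; exact: mI.
have wE s : w s = cgam mu beta%:C%C s + (- cexp (p * (t + dl)%:C%C)) * cgam mu z s.
  rewrite /w mulrBr mulr1; congr (_ + _); rewrite mulNr; congr (- _).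
  rewrite /cgam -mulrA -cexpD [RHS]mulrCA -cexpD; congr (_ * cexp _).
  by rewrite /z rmorphB rmorphD /=; ring.
have iz4 := cintegrableZ (- cexp (p * (t + dl)%:C%C)) (mI _ _) iz2.
have iw : cintegrable lm `]t, (t + dl)] w.
  by rewrite (funext wE); apply: cintegrableD.
have Ew : cint lm `]t, (t + dl)] w = (Rintegral lm `]t, (t + dl)] (gam mu beta))%:C%C
   - cexp (p * (t + dl)%:C%C) * cint lm `]t, (t + dl)] (cgam mu z).
  rewrite (funext wE) cintD // cintZ // mulNr; congr (_ - _).
  rewrite (funext cgb) /cint /=; congr Complex.
  by rewrite /Rintegral integral0.
have -> : kp (t + dl) - cexp (p * dl%:C%C) * kp t + (dl * k t)%:C%C =
   (- ((k t)%:C%C * (cexp (p * dl%:C%C) - 1 - p * dl%:C%C)) + A%:C%C * cint lm `]t, (t + dl)] w) / p.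
  rewrite Ew /kp E1 E2 E3 (_ : (dl * k t)%:C%C = dl%:C%C * (k t)%:C%C); last by rewrite -rmorphM.
  move: (A%:C%C) (cint _ _ _) (L (t + dl)) (k t)%:C%C (Rintegral _ _ _)%:C%C => AA c1' c2' c3' c4'.
  by field; exact: pn0.
have p10 : 0 < nr p := lt_le_trans ltr01 np1.
rewrite nrM nrV ler_pdivrMr //.
apply: (@le_trans _ _ (dl * e)); last by rewrite ler_peMr // mulr_ge0 // ltW.
rewrite (le_trans (nrD _ _)) // nrN !nrM !nrR.
have dlT : dl <= T by rewrite (le_trans _ tT) // lerDr.
have hB : nr (p * dl%:C%C) <= B by rewrite nrM nrR ger0_norm // ler_wpM2l ?nr_ge0.
pose I := Rintegral lm `]t, (t + dl)] (gam mu beta).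
have I0 : 0 <= I by apply: Rintegral_ge0 => s _; exact: gam_ge0.
have hI : I <= e1 by apply: hd => //; rewrite addrAC subrr add0r.
have hW : nr (cint lm `]t, (t + dl)] w) <= 2 * (c3 * dl * I).
  have := nr_cint_le (mI _ _) iw (integrable_scale (c3 * dl) (mI _ _) ig).
  rewrite RintegralZl // => h; apply: h => s /=; rewrite in_itv /= => /andP[ts st].
  rewrite /w nrM nr_cgam /= mulrC ler_wpM2r ?gam_ge0 // nrC.
  have r0 : 0 <= t + dl - s by rewrite subr_ge0.
  have rdl : t + dl - s <= dl by rewrite lerBlDr addrC lerD2l ltW.
  have hB2 : nr p * (t + dl - s) <= B by rewrite ler_wpM2l ?nr_ge0 // (le_trans rdl).
  apply: le_trans (cexp_sub1_le r0 hB2) _.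
  by rewrite ler_wpM2l.
have h1 : `|k t| * nr (cexp (p * dl%:C%C) - 1 - p * dl%:C%C) <= dl * (c1 * dl).
  apply: (@le_trans _ _ (K * (4 * expR B * (nr p * dl) ^+ 2))).
    apply: ler_pM; rewrite ?nr_ge0 ?hK ?t0 ?(le_trans tt') //.
    have := cexp_sub1id hB; rewrite nrM nrR ger0_norm //.
  by rewrite le_eqVlt; apply/orP; left; apply/eqP; rewrite /c1; ring.
have h2 : `|A| * nr (cint lm `]t, (t + dl)] w) <= dl * (c2 * I).
  apply: (@le_trans _ _ (`|A| * (2 * (c3 * dl * I)))); first by rewrite ler_wpM2l.
  by rewrite le_eqVlt; apply/orP; left; apply/eqP; rewrite /c2; ring.
rewrite (le_trans (lerD h1 h2)) // -mulrDr ler_wpM2l // [e]splitr.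
exact: lerD (hd1 _ dl0 (ltW hdl2)) (he1 _ I0 hI).
Qed.

End Kernel.

(** * Discrete transform of a Volterra equation *)

Section DiscreteTransform.
Context {R : realType}.
Local Notation C := R[i].

(* Reduces an identity between vectors to identities between coefficients, which [ring] proves. *)
Lemma lincomb6 (V : lmodType C) (v1 v2 v3 v4 v5 v6 : V) :
  exists lc : C -> C -> C -> C -> C -> C -> V,
  [/\ [/\ v1 = lc 1 0 0 0 0 0, v2 = lc 0 1 0 0 0 0 & v3 = lc 0 0 1 0 0 0],
      [/\ v4 = lc 0 0 0 1 0 0, v5 = lc 0 0 0 0 1 0 & v6 = lc 0 0 0 0 0 1],
      forall a b c d e f a' b' c' d' e' f', lc a b c d e f + lc a' b' c' d' e' f' =
        lc (a + a') (b + b') (c + c') (d + d') (e + e') (f + f'),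
      forall a b c d e f, - lc a b c d e f = lc (- a) (- b) (- c) (- d) (- e) (- f) &
      forall x a b c d e f, x *: lc a b c d e f =
        lc (x * a) (x * b) (x * c) (x * d) (x * e) (x * f)].
Proof.
exists (fun a b c d e f => a *: v1 + b *: v2 + c *: v3 + d *: v4 + e *: v5 + f *: v6).
split; rewrite ?scale1r ?scale0r ?addr0 ?add0r //.
- by move=> *; rewrite !scalerDl; do 5!(rewrite addrACA; congr (_ + _)).
- by move=> *; rewrite !scaleNr -!opprD.
- by move=> *; rewrite !scalerDr !scalerA.
Qed.

(** To be used with q = (1 - z dl) e^(ga dl) and ep = e^(p dl), where z = p + ga. Then q ep - 1 =
    O(dl^2), so every term of the last sum except that of [eta] is at least of second order in dl,
    and kh times the discrete transform of [u] is close to B 0 - q^N B N. *)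
Lemma discrete_telescoping (V : lmodType C) (B r u eta : nat -> V) (kh q ep dl : C) (N : nat) :
  (forall j, (j < N)%N ->
     B j.+1 = ep *: (B j + dl *: (r j - kh *: u j)) - dl *: r j + dl *: eta j) ->
  kh *: (\sum_(j < N) (dl * q ^+ j) *: u j) = B 0%N - q ^+ N *: B N +
    \sum_(j < N) q ^+ j *: ((q * ep - 1) *: B j + (dl * (q * ep - q)) *: r j
       - (dl * kh * (q * ep - 1)) *: u j + (dl * q) *: eta j).
Proof.
elim: N => [|N IH] hB; first by rewrite !big_ord0 scaler0 addr0 expr0 scale1r subrr.
rewrite !big_ord_recr /= scalerDr IH; last by move=> j jN; apply: hB; exact: ltnW.
rewrite hB // exprS; set S := \sum_(j < N) _; set b0 := B 0%N.
rewrite [RHS]addrA [RHS]addrAC [LHS]addrAC; congr (_ + _).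
rewrite -!addrA; congr (b0 + _).
have [lc [[-> -> ->] [-> _ _] D NN Z]] := lincomb6 (B N) (r N) (u N) (eta N) 0 0.
by rewrite !(D, NN, Z); congr lc; ring.
Qed.

(** The admissible mesh in [is_riemann_integral] depends on [f] and on the end point, whereas here
    [dl] is given. Each step is cut into M equal pieces fine enough for that definition, and the
    refinement changes the sum by at most t e, a bound that depends only on the oscillation of [f]
    over [dl]. *)
Lemma riemann_sum_approx (X : completeNormedModType C) (f : R -> X) (t dl e : R) (j : nat) (v : X) :
  0 < dl -> j%:R * dl = t -> is_riemann_integral f 0 t v ->
  (forall s s' : R, 0 <= s -> s <= s' -> s' <= t -> s' - s <= dl -> nr (f s' - f s) <= e) ->
  nr (\sum_(i < j) dl%:C%C *: f (i%:R * dl) - v) <= t * e.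
Proof.
move=> dl0 jt hf hm; apply/ler_addgt0Pr => e1 e10.
have [d d0 hd] := hf _ e10.
pose M := (Num.bound (dl / d)).+1; pose h := dl / M%:R.
have M0 : 0 < (M%:R : R) by rewrite ltr0n.
have h0 : 0 < h by rewrite divr_gt0.
have hMd : M%:R * h = dl by rewrite /h mulrC divfK // gt_eqF.
have hd' : h < d.
  rewrite /h ltr_pdivrMr // mulrC -ltr_pdivrMr //.
  rewrite (le_lt_trans (natr_bound_le (n := Num.bound (dl / d)) _ _)) ?divr_ge0 ?(ltW d0) ?(ltW dl0) //.
  by rewrite ltr_nat.
have h1 : nr (\sum_(i < j * M) h%:C%C *: f (i%:R * h) - v) < e1.
  rewrite -ltcR -nrE; have := hd (j * M)%N (fun i => i%:R * h) (fun i => i%:R * h).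
  have E i : i.+1%:R * h - i%:R * h = h by rewrite -mulrBl -natrB // subSnn mul1r.
  move=> hh; have {}hh := hh (mul0r _).
  rewrite (eq_bigr (fun i : 'I_(j * M) => h%:C%C *: f (i%:R * h))) in hh; last first.
    by move=> i _; rewrite E.
  apply: hh; first by rewrite natrM -mulrA hMd.
  by move=> i _; rewrite lexx E hd' ler_pM2r // ler_nat leqnSn.
have h2 (l : nat) : (l <= j)%N ->
    nr (\sum_(i < l) dl%:C%C *: f (i%:R * dl) - \sum_(i < l * M) h%:C%C *: f (i%:R * h))
      <= l%:R * dl * e.
  elim: l => [|l IH] lj; first by rewrite !big_ord0 subrr nr0 !mul0r.
  rewrite big_ord_recr mulSnr big_split_ord /= opprD addrACA (le_trans (nrD _ _)) //.
  rewrite -(natr1 l) !mulrDl mul1r; apply: lerD; first by apply: IH; exact: ltnW.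
  have -> : dl%:C%C *: f (l%:R * dl) = \sum_(i < M) h%:C%C *: f (l%:R * dl).
    rewrite sumr_const card_ord scalerMnl; congr (_ *: _).
    by rewrite -hMd mulr_natl rmorphMn.
  rewrite -sumrB (le_trans (nr_sum _ _ _)) //.
  apply: (@le_trans _ _ (\sum_(i < M) h * e)); last first.
    by rewrite sumr_const card_ord -mulr_natl mulrA hMd.
  apply: ler_sum => i _; rewrite -scalerBr nrZ nrR gtr0_norm // ler_wpM2l ?(ltW h0) // nrC.
  have E : (l * M + i)%:R * h = l%:R * dl + i%:R * h by rewrite natrD natrM mulrDl -mulrA hMd.
  have ih : i%:R * h <= dl by rewrite -hMd ler_pM2r // ler_nat ltnW.
  have l1 : l%:R * dl + dl <= t.
    by rewrite -jt -{2}[dl]mul1r -mulrDl natr1 ler_pM2r // ler_nat.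
  have ih0 : 0 <= i%:R * h by rewrite mulr_ge0 // ltW.
  rewrite E; apply: hm.
  - by rewrite mulr_ge0 // ltW.
  - by rewrite lerDl.
  - by rewrite (le_trans _ l1) // lerD2l.
  - by rewrite addrAC subrr add0r.
rewrite (le_trans (nrBD (\sum_(i < j * M) h%:C%C *: f (i%:R * h)) _ _)) //.
by apply: lerD; [rewrite -jt; exact: h2|exact: ltW].
Qed.

(** The linear terms of 1 - x and e^x cancel: the difference is - x^2 + (1 - x)(e^x - 1 - x). *)
Lemma one_sub_mul_cexp (B : R) (x : C) : nr x <= B ->
  nr ((1 - x) * cexp x - 1) <= (1 + (1 + B) * (4 * expR B)) * nr x ^+ 2.
Proof.
move=> xB; have -> : (1 - x) * cexp x - 1 = - x ^+ 2 + (1 - x) * (cexp x - 1 - x) by ring.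
rewrite (le_trans (nrD _ _)) // nrN nrX [leRHS]mulrDl mul1r lerD2l nrM -mulrA.
apply: ler_pM; rewrite ?nr_ge0 //; last exact: cexp_sub1id.
by rewrite (le_trans (nrB _ _)) // nr1 lerD2l.
Qed.

(** From |1 - z dl|^2 = 1 - 2 dl Re z + dl^2 |z|^2 and 1 + y <= e^y. *)
Lemma nr_one_sub_pow (z : C) (dl : R) (N : nat) : 0 <= dl ->
  nr (1 - z * dl%:C%C) ^+ N <=
  expR (- (N%:R * dl * complex.Re z)) * expR (N%:R * dl * (dl * nr z ^+ 2 / 2)).
Proof.
move=> dl0.
have h : nr (1 - z * dl%:C%C) <= expR (- (dl * complex.Re z) + dl * (dl * nr z ^+ 2 / 2)).
  rewrite -(@ler_pXn2r _ 2) // ?nnegrE ?nr_ge0 ?expR_ge0 // nr_sqr nr_sqr.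
  rewrite -expRM_natl; apply: le_trans (expR_ge1Dx _).
  rewrite le_eqVlt; apply/orP; left; apply/eqP.
  by case: z => x y /=; rewrite !mulr0 subr0 add0r; field.
rewrite -expRD; apply: (@le_trans _ _ (expR (- (dl * complex.Re z) + dl * (dl * nr z ^+ 2 / 2)) ^+ N)).
  by rewrite lerXn2r ?nnegrE ?nr_ge0 ?expR_ge0.
by rewrite -expRM_natl le_eqVlt; apply/orP; left; apply/eqP; congr expR; ring.
Qed.

(** * Error of the discretised Laplace transform *)

Section TransformError.
Variables (V : normedModType C) (T : R) (k : R -> R) (kp : R -> C).
Variables (u m r : R -> V) (r0 : V) (p kh z : C) (ga K Ck Bm Bu Br : R).
Hypotheses (T0 : 0 < T) (K0 : 0 <= K) (Ck0 : 0 <= Ck) (Bm0 : 0 <= Bm).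
Hypotheses (Bu0 : 0 <= Bu) (Br0 : 0 <= Br) (p0 : p != 0) (kh0 : kh != 0).
Hypothesis pE : p + ga%:C%C = z.
Hypothesis hK : forall t, 0 <= t <= T -> `|k t| <= K.
Hypothesis hCk : forall t, 0 <= t <= T -> nr (kp t) <= Ck.
Hypothesis kp0 : kp 0 = kh.
Hypothesis hkp : forall e : R, 0 < e -> exists2 d : R, 0 < d &
  forall t dl : R, 0 <= t -> 0 <= dl -> dl < d -> t + dl <= T ->
  nr (kp (t + dl) - cexp (p * dl%:C%C) * kp t + (dl * k t)%:C%C) <= dl * e.
Hypothesis hm : forall t, 0 <= t <= T -> nr (m t) <= Bm.
Hypothesis hu : forall t, 0 <= t <= T -> nr (u t) <= Bu.
Hypothesis hr : forall t, 0 <= t <= T -> nr (r t) <= Br.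
Hypothesis mE : forall t, 0 <= t <= T -> kh *: m t = r t - kh *: u t.
Hypothesis hR : forall e : R, 0 < e -> exists2 d : R, 0 < d &
  forall (dl : R) (j : nat), 0 < dl -> dl < d -> j%:R * dl <= T ->
  nr (\sum_(i < j) (dl * k (j%:R * dl - i%:R * dl))%:C%C *: m (i%:R * dl) - (r (j%:R * dl) - r0)) <= e.

(* A discrete form of [\int_0^t kp (t - s) m s ds + r0 / p]: the equation
   [kp' = p kp - k] and the Volterra equation for [r] turn it into a first order
   recurrence, which the weights [q ^+ j] telescope. *)
Let B (dl : R) (j : nat) : V :=
  \sum_(i < j) (dl%:C%C * kp (j%:R * dl - i%:R * dl)) *: m (i%:R * dl) + p^-1 *: r0.

Let B_bound dl j : 0 <= dl -> j%:R * dl <= T ->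
  nr (B dl j) <= T * Ck * Bm + nr r0 / nr p.
Proof.
move=> dl0 jT; rewrite (le_trans (nrD _ _)) // nrZ nrV [(nr p)^-1 * _]mulrC lerD2r.
rewrite (le_trans (nr_sum _ _ _)) //.
apply: (@le_trans _ _ (\sum_(i < j) dl * (Ck * Bm))).
  apply: ler_sum => i _; have ij : i%:R * dl <= j%:R * dl by rewrite ler_wpM2r // ler_nat ltnW.
  have i0 : 0 <= i%:R * dl by rewrite mulr_ge0.
  rewrite nrZ nrM nrR ger0_norm // -mulrA ler_wpM2l //.
  apply: ler_pM; rewrite ?nr_ge0 //; first apply: hCk; last apply: hm.
    by apply/andP; split; lra.
  by rewrite i0 (le_trans ij).
rewrite sumr_const card_ord -mulr_natl mulrA -[leRHS]mulrA.
by rewrite ler_wpM2r // mulr_ge0.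
Qed.

(** The term i = j brings in kp 0 = kh, and [mE] turns it into r - kh u. The other terms evolve by
    the equation for kp, with local errors summed in [S3]. The kernel sum [S2] is close to r - r0 by
    [hR], and the part r0 / p leaves only the remainder ep - 1 - p dl. *)
Let B_step (c e1 e2 dl : R) j : 0 <= c -> 0 <= e1 -> 0 < dl -> j.+1%:R * dl <= T ->
  nr (cexp (p * dl%:C%C) - 1 - p * dl%:C%C) <= c * dl ^+ 2 ->
  (forall t : R, 0 <= t -> t + dl <= T ->
     nr (kp (t + dl) - cexp (p * dl%:C%C) * kp t + (dl * k t)%:C%C) <= dl * e1) ->
  nr (\sum_(i < j) (dl * k (j%:R * dl - i%:R * dl))%:C%C *: m (i%:R * dl) - (r (j%:R * dl) - r0)) <= e2 ->
  nr (B dl j.+1 - (cexp (p * dl%:C%C) *: (B dl j + dl%:C%C *: (r (j%:R * dl) - kh *: u (j%:R * dl)))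
        - dl%:C%C *: r (j%:R * dl))) <=
  dl * (T * e1 * Bm + e2 + dl * (K * Bm + c * (nr r0 / nr p))).
Proof.
move=> c0 e10 dl0 jT hc h1 h2.
set tj := j%:R * dl; set ep := cexp _.
have tj0 : 0 <= tj by rewrite mulr_ge0 // ltW.
have tjT : tj + dl <= T by rewrite /tj -{2}[dl]mul1r -mulrDl natr1.
have tjT' : tj <= T by rewrite (le_trans _ tjT) // lerDl ltW.
have S1 : j.+1%:R * dl = tj + dl by rewrite -natr1 mulrDl mul1r.
have ti i : (i < j.+1)%N -> 0 <= tj - i%:R * dl /\ tj - i%:R * dl + dl <= T.
  rewrite ltnS => ij; have i0 : 0 <= i%:R * dl by rewrite mulr_ge0 // ltW.
  have : i%:R * dl <= tj by rewrite ler_pM2r // ler_nat.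
  by move=> h; split; lra.
pose E t := kp (t + dl) - ep * kp t + (dl * k t)%:C%C.
pose S2 := \sum_(i < j) (dl * k (tj - i%:R * dl))%:C%C *: m (i%:R * dl).
pose S3 := \sum_(i < j.+1) (dl%:C%C * E (tj - i%:R * dl)) *: m (i%:R * dl).
have -> : B dl j.+1 - (ep *: (B dl j + dl%:C%C *: (r tj - kh *: u tj)) - dl%:C%C *: r tj) =
   S3 + - (dl%:C%C *: (S2 - (r tj - r0))) + - ((dl * dl * k 0)%:C%C *: m tj) +
   - (((ep - 1 - p * dl%:C%C) / p) *: r0).
  have -> : B dl j.+1 = S3 + ep *: (\sum_(i < j.+1) (dl%:C%C * kp (tj - i%:R * dl)) *: m (i%:R * dl))
      - dl%:C%C *: (\sum_(i < j.+1) (dl * k (tj - i%:R * dl))%:C%C *: m (i%:R * dl)) + p^-1 *: r0.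
    rewrite /B S1; congr (_ + _); rewrite /S3 !scaler_sumr -big_split /= -sumrB.
    apply: eq_bigr => i _; rewrite !scalerA -scalerDl -scalerBl; congr (_ *: _).
    by rewrite /E addrAC; ring.
  rewrite [\sum_(i < j.+1) (dl%:C%C * _) *: _]big_ord_recr [\sum_(i < j.+1) (dl * _)%:C%C *: _]big_ord_recr /=.
  rewrite -/tj -/S2 subrr kp0 -[(dl%:C%C * kh) *: _]scalerA (mE (t := tj)) ?tj0 //.
  rewrite /B -/tj; set S4 := \sum_(i < j) (dl%:C%C * _) *: _.
  move: (m tj) (r tj) (u tj) => mt rt ut; rewrite -!addrA; congr (S3 + _).
  have [lc [[-> -> ->] [-> -> ->] D NN Z]] := lincomb6 S4 S2 mt rt ut r0.
  rewrite !(D, NN, Z) (_ : (dl * k 0)%:C%C = dl%:C%C * (k 0)%:C%C); last by rewrite -rmorphM.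
  rewrite (_ : (dl * dl * k 0)%:C%C = dl%:C%C * dl%:C%C * (k 0)%:C%C); last by rewrite -!rmorphM.
  by congr lc; first [ring | field].
have b3 : nr S3 <= dl * (T * e1 * Bm).
  rewrite (le_trans (nr_sum _ _ _)) //.
  apply: (@le_trans _ _ (\sum_(i < j.+1) dl * (dl * e1 * Bm))).
    apply: ler_sum => i _; have [q1 q2] := ti i (ltn_ord i).
    have i0 : 0 <= i%:R * dl by rewrite mulr_ge0 // ltW.
    rewrite nrZ nrM nrR gtr0_norm // -mulrA ler_wpM2l ?(ltW dl0) //.
    apply: ler_pM; rewrite ?nr_ge0 //; first exact: h1.
    by apply: hm; apply/andP; split; lra.
  rewrite sumr_const card_ord -mulr_natl.
  have -> : j.+1%:R * (dl * (dl * e1 * Bm)) = dl * (j.+1%:R * dl * e1 * Bm) by ring.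
  rewrite ler_wpM2l ?(ltW dl0) // ler_wpM2r // ler_wpM2r //.
have b2 : nr (dl%:C%C *: (S2 - (r tj - r0))) <= dl * e2.
  by rewrite nrZ nrR gtr0_norm // ler_wpM2l ?(ltW dl0).
have b4 : nr ((dl * dl * k 0)%:C%C *: m tj) <= dl * (dl * (K * Bm)).
  rewrite nrZ nrR normrM normrM gtr0_norm // -!mulrA ler_wpM2l ?(ltW dl0) // ler_wpM2l ?(ltW dl0) //.
  apply: ler_pM; rewrite ?nr_ge0 //; first by rewrite hK // lexx ltW.
  by rewrite hm // tj0.
have b5 : nr (((ep - 1 - p * dl%:C%C) / p) *: r0) <= dl * (dl * (c * (nr r0 / nr p))).
  rewrite nrZ nrM nrV -mulrA [(nr p)^-1 * _]mulrC.
  rewrite (le_trans (ler_wpM2r _ hc)) ?divr_ge0 ?nr_ge0 //.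
  by rewrite expr2 le_eqVlt; apply/orP; left; apply/eqP; ring.
rewrite (le_trans (nrD _ _)) // nrN (le_trans (lerD (nrD _ _) (lexx _))) // nrN.
rewrite (le_trans (lerD (lerD (nrD _ _) (lexx _)) (lexx _))) // nrN.
lra.
Qed.

Lemma transform_error (e : R) : 0 < e -> exists N0 : nat, forall N, (N0 <= N)%N ->
  nr (disc_laplace (fun s => (expR (ga * s))%:C%C *: u s) T N z - (kh^-1 / p) *: r0) <=
  nr kh^-1 * (expR 1 * expR (ga * T) * (T * Ck * Bm + nr r0 / nr p)) *
    expR (- (T * complex.Re z)) + e.
Proof.
move=> e0; have e30 : 0 < e / 3 by rewrite divr_gt0.
have T0' := ltW T0.
pose BB : R := T * Ck * Bm + nr r0 / nr p.
have np0 : 0 <= nr p by exact: nr_ge0.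
have nrp0 : 0 <= nr r0 / nr p by rewrite divr_ge0 // nr_ge0.
have BB0 : 0 <= BB by rewrite addr_ge0 // !mulr_ge0.
have Bz0 : 0 <= nr z * T by rewrite mulr_ge0 ?nr_ge0.
have Bp0 : 0 <= nr p * T by rewrite mulr_ge0.
pose EB : R := expR ((nr z + `|ga|) * T); have EB0 : 0 <= EB by exact: expR_ge0.
pose c1 : R := 4 * expR (nr p * T) * nr p ^+ 2.
have c10 : 0 <= c1 by rewrite !mulr_ge0 ?expR_ge0 ?exprn_ge0.
pose c2 : R := (1 + 4 * expR (nr p * T) * (nr p * T)) * nr p.
have c20 : 0 <= c2 by rewrite mulr_ge0 // addr_ge0 // mulr_ge0 // mulr_ge0 ?expR_ge0.
pose c3 : R := (1 + (1 + nr z * T) * (4 * expR (nr z * T))) * nr z ^+ 2.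
have c30 : 0 <= c3.
  rewrite mulr_ge0 ?exprn_ge0 ?nr_ge0 // addr_ge0 // mulr_ge0 ?addr_ge0 //.
have nkh0 : 0 <= nr kh by exact: nr_ge0.
(* [W] collects all error terms of order dl. The tolerances [e1] and [e2] are kept apart, since they
   are fixed before the step bounds [d2] and [d3] that they require. *)
pose W : R := c3 * BB + EB * c2 * Br + nr kh * c3 * T * Bu + EB * (K * Bm + c1 * (nr r0 / nr p)).
have W0 : 0 <= W.
  have w1 := mulr_ge0 c30 BB0; have w2 := mulr_ge0 (mulr_ge0 EB0 c20) Br0.
  have w3 := mulr_ge0 (mulr_ge0 (mulr_ge0 nkh0 c30) T0') Bu0.
  have w4 := mulr_ge0 EB0 (addr_ge0 (mulr_ge0 K0 Bm0) (mulr_ge0 c10 nrp0)).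
  exact: addr_ge0 (addr_ge0 (addr_ge0 w1 w2) w3) w4.
have ik0 : 0 <= nr kh^-1 by exact: nr_ge0.
have TE0 : 0 <= nr kh^-1 * (T * EB) by rewrite mulr_ge0 // mulr_ge0.
have [d1 d10 h1] := small_mul (mulr_ge0 TE0 W0) e30.
have D20 : 0 <= nr kh^-1 * (T * EB) * (EB * (T * Bm)) by rewrite mulr_ge0 // !mulr_ge0.
have [e1 e10 h2] := small_mul D20 e30.
have D30 : 0 <= nr kh^-1 * (T * EB) * EB by rewrite mulr_ge0.
have [e2 e20 h3] := small_mul D30 e30.
have D40 : 0 <= T * (nr z ^+ 2 / 2) by rewrite mulr_ge0 // divr_ge0 // exprn_ge0 // nr_ge0.
(* Below [d4] the second factor in [nr_one_sub_pow] is at most e, the [expR 1] of the statement. *)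
have [d4 d40 h4] := small_mul D40 ltr01.
have [d2 d20 hd2] := hkp e10.
have [d3 d30 hd3] := hR e20.
pose d : R := Num.min (Num.min d1 d2) (Num.min d3 d4).
have d0 : 0 < d by rewrite !lt_min d10 d20 d30 d40.
exists (Num.bound (T / d)).+1 => N hN.
have N0 : 0 < (N%:R : R) by rewrite ltr0n (leq_trans _ hN).
set dl := T / N%:R; have dl0 : 0 < dl by rewrite divr_gt0.
have NdT : N%:R * dl = T by rewrite /dl mulrC divfK // gt_eqF.
have dld : dl < d.
  rewrite /dl ltr_pdivrMr // mulrC -ltr_pdivrMr //.
  rewrite (le_lt_trans (natr_bound_le (n := Num.bound (T / d)) _ _)) ?divr_ge0 ?(ltW d0) //.
  by rewrite ltr_nat.
move: dld; rewrite !lt_min => /andP[/andP[dl1 dl2] /andP[dl3 dl4]].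
have dlT : dl <= T by rewrite -NdT ler_peMl ?(ltW dl0) // ler1n (leq_trans _ hN).
have jT j : (j <= N)%N -> j%:R * dl <= T by move=> jN; rewrite -NdT ler_pM2r // ler_nat.
have jT2 j : (j <= N)%N -> 0 <= j%:R * dl <= T.
  by move=> jN; rewrite jT // mulr_ge0 // ltW.
pose w : C := 1 - z * dl%:C%C; pose g : R := expR (ga * dl).
pose q : C := w * g%:C%C; pose ep := cexp (p * dl%:C%C).
pose rho := q * ep.
have hrho : nr (rho - 1) <= c3 * dl ^+ 2.
  have -> : rho = (1 - z * dl%:C%C) * cexp (z * dl%:C%C).
    rewrite /rho /q -mulrA /g -cexpR -cexpD; congr (_ * cexp _).
    by rewrite -pE mulrDl rmorphM /= addrC.
  have hz : nr (z * dl%:C%C) <= nr z * T by rewrite nrM nrR gtr0_norm // ler_wpM2l ?nr_ge0.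
  have := one_sub_mul_cexp hz; rewrite nrM nrR gtr0_norm // exprMn => /le_trans; apply.
  by rewrite le_eqVlt; apply/orP; left; apply/eqP; rewrite /c3; ring.
have hzp : nr (p * dl%:C%C) <= nr p * T by rewrite nrM nrR gtr0_norm // ler_wpM2l.
have hep1 : nr (ep - 1 - p * dl%:C%C) <= c1 * dl ^+ 2.
  have := cexp_sub1id hzp; rewrite nrM nrR gtr0_norm // exprMn => /le_trans; apply.
  by rewrite le_eqVlt; apply/orP; left; apply/eqP; rewrite /c1; ring.
have hep : nr (ep - 1) <= c2 * dl.
  have := cexp_sub1 hzp; rewrite nrM nrR gtr0_norm // => /le_trans; apply.
  by rewrite le_eqVlt; apply/orP; left; apply/eqP; rewrite /c2; ring.
have hq j : (j <= N)%N -> nr (q ^+ j) <= EB.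
  move=> jN; have hq1 : nr q <= expR ((nr z + `|ga|) * dl).
    rewrite nrM nrR ger0_norm ?expR_ge0 // mulrDl expRD ler_pM ?nr_ge0 ?expR_ge0 //.
      rewrite (le_trans (nrB _ _)) // nr1 nrM nrR gtr0_norm //; exact: expR_ge1Dx.
    by rewrite ler_expR ler_wpM2r ?(ltW dl0) // ler_norm.
  rewrite nrX (le_trans (y := expR ((nr z + `|ga|) * dl) ^+ j)) //.
    by rewrite lerXn2r ?nnegrE ?nr_ge0 ?expR_ge0.
  rewrite -expRM_natl ler_expR mulrCA ler_wpM2l ?addr_ge0 ?nr_ge0 //.
  exact: jT.
pose rj (j : nat) := r (j%:R * dl); pose uj (j : nat) := u (j%:R * dl).
pose step j := ep *: (B dl j + dl%:C%C *: (rj j - kh *: uj j)) - dl%:C%C *: rj j.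
pose eta j := dl%:C%C^-1 *: (B dl j.+1 - step j).
have dln0 : dl%:C%C != 0 :> C by rewrite -nr_gt0 nrR gtr0_norm.
have hB j : (j < N)%N -> B dl j.+1 = step j + dl%:C%C *: eta j.
  by move=> _; rewrite /eta scalerA divff // scale1r addrC subrK.
pose th : R := T * e1 * Bm + e2 + dl * (K * Bm + c1 * (nr r0 / nr p)).
have heta j : (j < N)%N -> nr (eta j) <= th.
  move=> jN; rewrite /eta nrZ nrV nrR gtr0_norm // mulrC ler_pdivrMr // mulrC.
  apply: B_step => //; first exact: ltW.
  - by apply: jT.
  - by move=> t t0 tT; apply: hd2 => //; exact: ltW.
  - by apply: hd3 => //; apply: jT; exact: ltnW.
have tele := @discrete_telescoping V (B dl) rj uj eta kh q ep dl%:C%C N hB.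
rewrite -/rho in tele.
have -> : disc_laplace (fun s => (expR (ga * s))%:C%C *: u s) T N z =
    \sum_(j < N) (dl%:C%C * q ^+ j) *: uj j.
  apply: eq_bigr => j _; rewrite scalerA -/dl -mulrA; congr ((_ * _) *: _).
  rewrite /q exprMn /g -rmorphXn /= -expRM_natl; congr (_ * (expR _)%:C%C).
  by rewrite mulrCA.
set err := (\sum_(j < N) _ *: (_ + _)) in tele.
set U := (\sum_(j < N) _) in tele *.
have -> : U - (kh^-1 / p) *: r0 = kh^-1 *: (- (q ^+ N *: B dl N) + err).
  have -> : U = kh^-1 *: (kh *: U) by rewrite scalerA mulVf // scale1r.
  rewrite tele (_ : B dl 0 = p^-1 *: r0); last by rewrite /B big_ord0 add0r.
  rewrite -scalerA -scalerBr; congr (_ *: _).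
  by rewrite -!addrA addrC -!addrA addNr addr0.
have herr : nr err <= T * EB * (W * dl + EB * (T * Bm) * e1 + EB * e2).
  rewrite (le_trans (nr_sum _ _ _)) //.
  apply: (@le_trans _ _ (\sum_(j < N) dl * (EB * (W * dl + EB * (T * Bm) * e1 + EB * e2)))); last first.
    by rewrite sumr_const card_ord -mulr_natl mulrA NdT mulrA.
  apply: ler_sum => j _; have jN := ltn_ord j; have jN' := ltnW jN.
  have N1 : (1 <= N)%N by rewrite (leq_trans _ hN).
  have q1 : nr q <= EB by rewrite -[q]expr1 hq.
  have dl00 := ltW dl0; have jb := jT2 _ jN'.
  have t1 : nr ((rho - 1) *: B dl j) <= c3 * dl ^+ 2 * BB.
    rewrite nrZ; apply: ler_pM; rewrite ?nr_ge0 //.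
    by apply: B_bound => //; exact: jT.
  have t2 : nr ((dl%:C%C * (rho - q)) *: rj j) <= dl * (EB * (c2 * dl) * Br).
    have -> : rho - q = q * (ep - 1) by rewrite /rho mulrBr mulr1.
    rewrite nrZ nrM nrR gtr0_norm // nrM -mulrA ler_wpM2l //.
    apply: ler_pM; rewrite ?mulr_ge0 ?nr_ge0 //; last exact: hr.
    by apply: ler_pM; rewrite ?nr_ge0.
  have t3 : nr ((dl%:C%C * kh * (rho - 1)) *: uj j) <= dl * (nr kh * (c3 * (dl * T)) * Bu).
    rewrite nrZ nrM nrM nrR gtr0_norm // -mulrA -mulrA ler_wpM2l // mulrA.
    apply: ler_pM; rewrite ?mulr_ge0 ?nr_ge0 //; last exact: hu.
    rewrite ler_wpM2l // (le_trans hrho) // ler_wpM2l //.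
    by rewrite expr2 ler_wpM2l.
  have t4 : nr ((dl%:C%C * q) *: eta j) <= dl * (EB * th).
    rewrite nrZ nrM nrR gtr0_norm // -mulrA ler_wpM2l //.
    by apply: ler_pM; rewrite ?nr_ge0 // heta.
  have -> : dl * (EB * (W * dl + EB * (T * Bm) * e1 + EB * e2)) =
     EB * (c3 * dl ^+ 2 * BB + dl * (EB * (c2 * dl) * Br) + dl * (nr kh * (c3 * (dl * T)) * Bu)
       + dl * (EB * th)) by rewrite /th /W; ring.
  rewrite nrZ; apply: ler_pM; rewrite ?nr_ge0 ?hq //.
  rewrite (le_trans (nrD _ _)) // lerD // (le_trans (nrB _ _)) // lerD //.
  by rewrite (le_trans (nrD _ _)) // lerD.
rewrite nrZ (le_trans (ler_wpM2l ik0 (nrD _ _))) // nrN mulrDr.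
apply: lerD.
  rewrite -mulrA ler_wpM2l // nrZ mulrAC; apply: ler_pM; rewrite ?nr_ge0 //; last first.
    by apply: B_bound; [exact: ltW|rewrite jT].
  rewrite /q exprMn nrM -rmorphXn /= nrR ger0_norm ?exprn_ge0 ?expR_ge0 // nrX.
  rewrite /g -expRM_natl mulrCA NdT mulrAC ler_wpM2r ?expR_ge0 //.
  apply: le_trans (nr_one_sub_pow _ _ (ltW dl0)) _.
  rewrite NdT mulrC ler_wpM2r ?expR_ge0 // ler_expR.
  have h5 := h4 dl (ltW dl0) (ltW dl4); apply: le_trans h5.
  by rewrite le_eqVlt; apply/orP; left; apply/eqP; ring.
apply: (le_trans (ler_wpM2l ik0 herr)).
have k1 := h1 dl (ltW dl0) (ltW dl1); have k2 := h2 e1 (ltW e10) (lexx _).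
have k3 := h3 e2 (ltW e20) (lexx _).
apply: (@le_trans _ _ (e / 3 + e / 3 + e / 3)); last first.
  by rewrite le_eqVlt; apply/orP; left; apply/eqP; field.
apply: le_trans (lerD (lerD k1 k2) k3).
by rewrite le_eqVlt; apply/orP; left; apply/eqP; ring.
Qed.

End TransformError.
End DiscreteTransform.

(** * Convex cones *)

Section Cones.
Context {R : realType}.
Local Notation C := R[i].

Definition cis (t : R) : C := (cos t +i* sin t)%C.

Lemma cis0 : cis 0 = 1.
Proof. by rewrite /cis cos0 sin0. Qed.

Lemma cisD s t : cis (s + t) = cis s * cis t.
Proof.
by rewrite /cis cosD sinD; apply/eqP; rewrite eq_complex /= eqxx /= addrC.
Qed.

Lemma nr_cis t : nr (cis t) = 1.
Proof.
apply/eqP; rewrite -(@eqrXn2 _ 2) ?nr_ge0 // nr_sqr /= cos2Dsin2 expr1n.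
by rewrite eqxx.
Qed.

Lemma polar (z : C) : 0 < complex.Re z -> z = (nr z)%:C%C * cis (carg z).
Proof.
move=> z0; apply/eqP; rewrite eq_complex /= !mul0r subr0 addr0.
by rewrite cos_carg // sin_carg // !eqxx.
Qed.

Lemma zpow_polar m (z : C) : 0 < complex.Re z ->
  zpow m z = (nr z `^ m)%:C%C * cis (m * carg z).
Proof.
move=> z0; rewrite zpowE /powR gt_eqF ?Re_gt0_nr //.
by apply/eqP; rewrite eq_complex /= !mul0r subr0 addr0 !eqxx.
Qed.

Lemma carg_ltpi2 (z : C) : carg z < pi / 2.
Proof. by rewrite /carg atan_ltpi2. Qed.

Lemma carg_gtNpi2 (z : C) : - (pi / 2) < carg z.
Proof. by rewrite /carg atan_gtNpi2. Qed.

Lemma carg_ge0 (z : C) : 0 < complex.Re z -> 0 <= complex.Im z -> 0 <= carg z.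
Proof.
move=> z0 i0; rewrite leNgt; apply/negP => h.
have : sin (- carg z) > 0.
  by apply: sin_gt0_pihalf; have := carg_gtNpi2 z; lra.
rewrite sinN oppr_gt0 => s0; have := sin_carg z0.
have := Re_gt0_nr z0 => n0 e.
by have := pmulr_rlt0 (sin (carg z)) n0; rewrite e s0 ltNge i0.
Qed.

Lemma Re_conj (z : C) : complex.Re (z^*)%C = complex.Re z.
Proof. by case: z. Qed.

Lemma nr_conj (z : C) : nr (z^*)%C = nr z.
Proof.
apply/eqP; rewrite -(@eqrXn2 _ 2) ?nr_ge0 // !nr_sqr.
by case: z => x y /=; rewrite sqrrN.
Qed.

Lemma zpow_conj m (z : C) : zpow m (z^*)%C = ((zpow m z)^*)%C.
Proof.
have e : carg (z^*)%C = - carg z.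
  by case: z => x y; rewrite /carg /= mulNr atanN.
by rewrite !zpowE nr_conj e /= mulrN sinN cosN mulrN.
Qed.

(* The sector [0 <= arg w <= Th], written with linear inequalities so that its
   stability under addition is immediate. *)
Definition cone (Th : R) (w : C) : Prop :=
  `|complex.Im (w * cis (- (Th / 2)))| * cos (Th / 2) <=
  sin (Th / 2) * complex.Re (w * cis (- (Th / 2))).

Section ConeTheory.
Variable Th : R.
Hypotheses (Th0 : 0 < Th) (Thpi : Th < pi).

Let c0 : 0 < cos (Th / 2).
Proof. by apply: cos_gt0_pihalf; move: Th0 Thpi => h1 h2; lra. Qed.
Let s0 : 0 < sin (Th / 2).
Proof. by apply: sin_gt0_pihalf; move: Th0 Thpi => h1 h2; lra. Qed.

Lemma cos_half_gt0 : 0 < cos (Th / 2). Proof. exact: c0. Qed.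

Lemma cone_cis (r psi : R) : 0 <= r -> 0 <= psi -> psi <= Th -> cone Th (r%:C%C * cis psi).
Proof.
move=> r0 p0 pT; rewrite /cone -mulrA -cisD /= !mul0r subr0 addr0.
rewrite normrM ger0_norm // -mulrA [leRHS]mulrCA ler_wpM2l //.
have [phi ephi] : exists phi, phi = psi - Th / 2 by exists (psi - Th / 2).
rewrite -ephi.
have h1 : 0 <= sin (Th / 2 - phi) by apply: sin_ge0_pi; move: Th0 Thpi => *; lra.
have h2 : 0 <= sin (Th / 2 + phi) by apply: sin_ge0_pi; move: Th0 Thpi => *; lra.
move: h1 h2; rewrite sinB sinD; set c := cos _; set s := sin _; set c' := cos _; set s' := sin _.
move=> h1 h2; have [h|h] := ger0P s'; move: h1 h2; lra.
Qed.

Lemma coneD w1 w2 : cone Th w1 -> cone Th w2 -> cone Th (w1 + w2).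
Proof.
rewrite /cone => h1 h2; rewrite mulrDl ReD ImD.
rewrite (le_trans (ler_wpM2r (ltW c0) (ler_normD _ _))) // mulrDl mulrDr.
exact: lerD.
Qed.

Lemma cone_Re w : cone Th w -> cos (Th / 2) * nr w <= complex.Re (w * cis (- (Th / 2))).
Proof.
rewrite /cone => h; set v := w * cis _ in h *.
have <- : nr v = nr w by rewrite nrM nr_cis mulr1.
have R0 : 0 <= complex.Re v.
  by rewrite -(pmulr_rge0 _ s0) (le_trans _ h) // mulr_ge0 // ltW.
rewrite -(@ler_pXn2r _ 2) // ?nnegrE ?mulr_ge0 ?nr_ge0 ?(ltW c0) //.
rewrite exprMn nr_sqr.
have : (`|complex.Im v| * cos (Th / 2)) ^+ 2 <= (sin (Th / 2) * complex.Re v) ^+ 2.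
  by rewrite lerXn2r ?nnegrE // ?mulr_ge0 // ltW.
rewrite !exprMn real_normK ?num_real //.
have := cos2Dsin2 (Th / 2); set cc := cos _ ^+ 2; set ss := sin _ ^+ 2 => e.
have -> : cc = 1 - ss by lra.
lra.
Qed.

(** Both summands have a nonnegative component along the bisector, and that of [w1] is at least cos
    (Th / 2) |w1|. All lower bounds on [symN] come from here. *)
Lemma cone_nr_ge w1 w2 : cone Th w1 -> cone Th w2 -> cos (Th / 2) * nr w1 <= nr (w1 + w2).
Proof.
move=> h1 h2; apply: (@le_trans _ _ (complex.Re ((w1 + w2) * cis (- (Th / 2))))).
  rewrite mulrDl ReD (le_trans (cone_Re h1)) // lerDl (le_trans _ (cone_Re h2)) //.
  by rewrite mulr_ge0 ?nr_ge0 // ltW.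
rewrite (le_trans (ler_norm _)) // (le_trans (Re_le_nr _)) //.
by rewrite nrM nr_cis mulr1.
Qed.

Lemma cone_polar w : w != 0 -> cone Th w ->
  exists2 psi : R, 0 <= psi <= Th & w = (nr w)%:C%C * cis psi.
Proof.
move=> w0 hw; have hR := cone_Re hw; have n0 : 0 < nr w by rewrite nr_gt0.
move: hw; rewrite /cone; set v := w * cis _ in hR * => hv.
have v0 : 0 < complex.Re v by rewrite (lt_le_trans _ hR) // mulr_gt0.
have nv : nr v = nr w by rewrite nrM nr_cis mulr1.
have nv0 : 0 < nr v by rewrite nv.
have eI := sin_carg v0; have eR := cos_carg v0.
have a1 := carg_ltpi2 v; have a2 := carg_gtNpi2 v.
exists (carg v + Th / 2); last first.
  by rewrite cisD mulrA -nv -polar // /v -mulrA -cisD addNr cis0 mulr1.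
have hI := ler_norm (complex.Im v); have hI' := ler_norm (- complex.Im v); rewrite normrN in hI'.
have u1 : complex.Im v * cos (Th / 2) <= sin (Th / 2) * complex.Re v.
  by rewrite (le_trans _ hv) // ler_wpM2r // ltW.
have u2 : - complex.Im v * cos (Th / 2) <= sin (Th / 2) * complex.Re v.
  by rewrite (le_trans _ hv) // ler_wpM2r // ltW.
apply/andP; split.
  rewrite leNgt; apply/negP => h.
  have : 0 < sin (- carg v - Th / 2) by apply: sin_gt0_pi; move: Th0 Thpi => *; lra.
  rewrite sinB sinN cosN -(pmulr_rgt0 _ nv0) mulrBr mulNr mulrN !mulrA eI eR.
  by move: u2; lra.
rewrite leNgt; apply/negP => h.
have : 0 < sin (carg v - Th / 2) by apply: sin_gt0_pi; move: Th0 Thpi => *; lra.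
rewrite sinB -(pmulr_rgt0 _ nv0) mulrBr !mulrA eI eR.
by move: u1; lra.
Qed.

End ConeTheory.

Lemma cone_quadrant (Th : R) (w : C) : pi / 2 <= Th -> Th < pi ->
  0 <= complex.Re w -> 0 <= complex.Im w -> cone Th w.
Proof.
move=> T1 T2 hR hI.
have p0 : 0 < pi :> R by exact: pi_gt0.
have -> : w = (complex.Re w)%:C%C * cis 0 + (complex.Im w)%:C%C * cis (pi / 2).
  rewrite cis0 /cis cos_pihalf sin_pihalf; case: (w) => x y /=.
  by apply/eqP; rewrite eq_complex /=; apply/andP; split; apply/eqP; ring.
have T0 : 0 < Th by rewrite (lt_le_trans _ T1) // divr_gt0.
by apply: (coneD T0 T2); apply: (cone_cis T0 T2) => //; lra.
Qed.

(** The difference vanishes at 0 and has derivative m (sin x - sin (m x)), nonnegative on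
    [0, pi/2]. *)
Lemma sub1_cos_mul (m f : R) : 0 <= m -> m <= 1 -> 0 <= f -> f <= pi / 2 ->
  1 - cos (m * f) <= m * (1 - cos f).
Proof.
move=> m0 m1 f0 fpi.
pose g (x : R) := m * (1 - cos x) - (1 - cos (m * x)).
pose dg (x : R) := m * sin x - m * sin (m * x).
have hd (x : R) : is_derive x (1 : R) g (dg x).
  have e1 : is_derive x (1 : R) (fun x : R => m * x) m.
    have -> : (fun x : R => m * x) = m \*: (id : R -> R) by apply/funext.
    by apply: is_derive_eq; rewrite /GRing.scale /= mulr1.
  have e2 := @is_derive1_comp _ cos (fun x : R => m * x) x _ _ (is_derive_cos (m * x)) e1.
  have -> : g = (m \*: (cst 1 - (cos : R -> R))) - (cst 1 - (cos \o (fun x : R => m * x))).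
    by apply/funext.
  apply: is_derive_eq; rewrite /dg /GRing.scale /=; ring.
have gf : g 0 <= g f.
  have cg : {within `[0, f], continuous g}.
    apply: continuous_subspaceT => u; apply: differentiable_continuous.
    by apply/derivable1_diffP; case: (hd u).
  have [c] := MVT_segment f0 (fun x _ => hd x) cg.
  rewrite in_itv /= => /andP[hc1 hc2] e; rewrite -subr_ge0 e subr0 mulr_ge0 //.
  rewrite /dg -mulrBr mulr_ge0 // subr_ge0.
  have mc0 : 0 <= m * c by rewrite mulr_ge0.
  have mc : m * c <= c by rewrite ler_piMl.
  rewrite leNgt ltr_sin ?in_itv /=; first by rewrite -leNgt.
    by apply/andP; split; lra.
  by apply/andP; split; lra.
by move: gf; rewrite /g mulr0 cos0 !subrr mulr0 subrr; lra.
Qed.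

(** Concavity of the power: at m ln x the tangent to the exponential lies below its values at ln x
    and at 0; these two bounds are averaged with weights m and 1 - m. *)
Lemma powR_bernoulli (m x : R) : 0 <= m -> m <= 1 -> 0 < x -> x `^ m <= 1 + m * (x - 1).
Proof.
move=> m0 m1 x0; rewrite /powR gt_eqF //; set y := ln x.
have ex : x = expR y by rewrite /y lnK.
set E := expR (m * y); have E0 : 0 <= E by exact: expR_ge0.
have h1 : E * (1 + (1 - m) * y) <= x.
  rewrite ex (_ : expR y = E * expR ((1 - m) * y)); last by rewrite -expRD; congr expR; ring.
  by rewrite ler_wpM2l // expR_ge1Dx.
have h2 : E * (1 - m * y) <= 1.
  rewrite [leRHS](_ : 1 = E * expR (- (m * y))); last by rewrite -expRD subrr expR0.
  by rewrite ler_wpM2l // (le_trans _ (expR_ge1Dx _)).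
have := ler_wpM2l m0 h1; have : (1 - m) * (E * (1 - m * y)) <= (1 - m) * 1.
  by rewrite ler_wpM2l // subr_ge0.
lra.
Qed.

(** With f = arg z the two preceding bounds give (cos f)^m <= cos (m f), hence (Re z)^m <= Re
    (z^m). *)
Lemma Re_zpow_ge (m : R) (z : C) (b : R) : 0 < m -> m <= 1 -> 0 <= b -> 0 < complex.Re z ->
  b <= complex.Re z -> b `^ m <= complex.Re (zpow m z).
Proof.
move=> m0 m1 b0 z0 bz.
wlog i0 : z z0 bz / 0 <= complex.Im z.
  move=> H; case: (leP 0 (complex.Im z)) => [|/ltW] iz; first exact: H.
  rewrite -[complex.Re _]/(complex.Re (zpow m z)) -Re_conj -zpow_conj; apply: H.
  - by rewrite Re_conj.
  - by rewrite Re_conj.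
  - by case: (z) iz => x y /= iz; rewrite oppr_ge0.
have n0 := Re_gt0_nr z0; have f0 := carg_ge0 z0 i0; have fpi := carg_ltpi2 z.
rewrite zpow_polar // /= mul0r subr0.
have c0 : 0 < cos (carg z) by rewrite -(pmulr_rgt0 _ n0) cos_carg.
apply: (@le_trans _ _ (complex.Re z `^ m)).
  by rewrite ge0_ler_powR ?nnegrE ?(ltW m0) // ltW.
rewrite -cos_carg // powRM ?(ltW n0) ?(ltW c0) // ler_wpM2l ?powR_ge0 //.
have := powR_bernoulli (ltW m0) m1 c0.
have := sub1_cos_mul (ltW m0) m1 f0 (ltW fpi).
lra.
Qed.

End Cones.

(** * The symbol *)

Section Symbol.
Context {R : realType}.
Local Notation C := R[i].
Variables (alpha beta mu mu' omega : R).

(* [symh z] is the point at which the resolvent of [A] occurs in the Laplace transform of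
   [exp (beta t) S t], and [symh z - omega = symN z / symQ z]. *)
Definition symQ (z : C) : C := zpow mu z + alpha%:C%C.
Definition symN (z : C) : C :=
  zpow mu z * (z + (- omega - beta)%:C%C) - (omega * alpha)%:C%C.
Definition symg (z : C) : C := zpow mu z / symQ z.
Definition symh (z : C) : C := (z - beta%:C%C) * symg z.

Lemma symh_omega z : symQ z != 0 -> symh z - omega%:C%C = symN z / symQ z.
Proof.
move=> Q0; apply: (mulIf Q0); rewrite divfK // mulrBl /symh /symg.
rewrite -mulrA divfK // /symQ /symN rmorphM rmorphB rmorphN /=; ring.
Qed.

Lemma symQ_conj z : symQ (z^*)%C = ((symQ z)^*)%C.
Proof. by rewrite /symQ zpow_conj rmorphD /= oppr0. Qed.

Lemma symN_conj z : symN (z^*)%C = ((symN z)^*)%C.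
Proof.
rewrite /symN zpow_conj; move: (zpow mu z) => w; case: z w => [x y] [u v].
by apply/eqP; rewrite eq_complex /=; apply/andP; split; apply/eqP; ring.
Qed.

Hypotheses (beta0 : 0 <= beta) (mu0 : 0 < mu) (mumu' : mu < mu') (mu'1 : mu' <= 1).
Hypotheses (omega0 : omega < 0) (c0 : beta + omega <= 0).

(** The bound on the argument of z^mu z in the upper right quadrant. It is below pi because mu < 1,
    as convexity of the cone requires. *)
Let Th : R := (1 + mu) * (pi / 2).
Let mu1 : mu < 1. Proof. exact: lt_le_trans mu'1. Qed.
Let pi20 : 0 < pi / 2 :> R. Proof. by rewrite divr_gt0 ?pi_gt0. Qed.
Let Th1 : pi / 2 < Th. Proof. by rewrite /Th ltr_pMl // ltrDl. Qed.
Let Th2 : Th < pi.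
Proof. by rewrite /Th [ltRHS]splitr -mulr2n -[ltRHS]mulr_natl ltr_pM2r // -[2]/(1 + 1)  ltrD2l. Qed.
Let Th0 : 0 < Th. Proof. exact: lt_trans Th1. Qed.
Let pi2pi : pi / 2 < pi :> R. Proof. exact: lt_trans Th2. Qed.
Let kap : R := cos (Th / 2).
Let kap0 : 0 < kap. Proof. exact: cos_half_gt0. Qed.

(** The quotient has its argument between - pi / 2 and [Th], and mu < mu' makes [Th] strictly
    smaller than the half-opening of the sector. *)
Lemma sector_of_cones z : symQ z != 0 -> symN z != 0 ->
  cone (pi / 2) (symQ z) -> cone Th (symN z) -> 
  exists2 psi : R, `|psi| < mu' * (pi / 2) + pi / 2 &
    symh z - omega%:C%C = (nr (symN z) / nr (symQ z))%:C%C * cis psi.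
Proof.
move=> Q0 N0 cQ cN; rewrite symh_omega //.
have [p1 /andP[p10 p11] e1] := cone_polar pi20 pi2pi Q0 cQ.
have [p2 /andP[p20 p21] e2] := cone_polar Th0 Th2 N0 cN.
exists (p2 - p1).
  have : Th < mu' * (pi / 2) + pi / 2.
    by rewrite /Th mulrDl mul1r addrC ltrD2r ltr_pM2r.
  by rewrite ltr_norml => h; apply/andP; split; move: pi20 Th1; lra.
rewrite {1}e1 {1}e2 rmorphM fmorphV /= cisD.
have n1 : (nr (symQ z))%:C%C != 0 :> C by rewrite -nr_gt0 nrR gtr0_norm nr_gt0.
have n2 : cis p1 != 0 by rewrite -nr_gt0 nr_cis.
have -> : cis (- p1) = (cis p1)^-1.
  by apply: (mulfI n2); rewrite -cisD subrr cis0 divff.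
by field; rewrite n1 n2.
Qed.

Lemma in_sector_polar l (r psi : R) : 0 < r -> `|psi| < mu' * (pi / 2) + pi / 2 ->
  l - omega%:C%C = r%:C%C * cis psi -> in_sector omega (mu' * (pi / 2)) l.
Proof.
move=> r0 hp e; exists r, psi; split => //; split => //.
by rewrite e /cis; apply/eqP; rewrite eq_complex /= !mul0r subr0 addr0 !eqxx.
Qed.

Definition symbol_half_bounds (b k : R) (z : C) : Prop :=
  [/\ cone (pi / 2) (symQ z), k <= nr (symQ z), cone Th (symN z) &
      kap * (nr z `^ mu * nr (z - b%:C%C)) <= nr (symN z)].

Lemma symbol_sector (b k : R) z : 0 <= b -> 0 < k ->
  (forall z, b < complex.Re z -> 0 <= complex.Im z -> symbol_half_bounds b k z) ->
  b < complex.Re z ->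
  [/\ k <= nr (symQ z), kap * (nr z `^ mu * nr (z - b%:C%C)) <= nr (symN z) &
      in_sector omega (mu' * (pi / 2)) (symh z)].
Proof.
move=> b0 k0 h.
have half w : b < complex.Re w -> symbol_half_bounds b k w ->
    symQ w != 0 /\ exists2 psi : R, `|psi| < mu' * (pi / 2) + pi / 2 &
     [/\ 0 < nr (symN w) / nr (symQ w) & 
    symh w - omega%:C%C = (nr (symN w) / nr (symQ w))%:C%C * cis psi].
  move=> bw [cQ kQ cN kN]; have Q0 : 0 < nr (symQ w) := lt_le_trans k0 kQ.
  have N0 : 0 < nr (symN w).
    apply: lt_le_trans kN; rewrite !mulr_gt0 //.
      by rewrite powR_gt0 // Re_gt0_nr // (le_lt_trans b0).
    by rewrite Re_gt0_nr // ReD /= subr_gt0.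
  have Qn : symQ w != 0 by rewrite -nr_gt0.
  split => //; have Nn : symN w != 0 by rewrite -nr_gt0.
  have [psi h1 h2] := sector_of_cones Qn Nn cQ cN; exists psi => //.
  by rewrite divr_gt0.
move=> bz; case: (leP 0 (complex.Im z)) => iz.
  have hz := h z bz iz; have [_ [psi h1 [h2 h3]]] := half z bz hz.
  by case: hz => _ ? _ ?; split => //; exact: in_sector_polar h3.
have bz' : b < complex.Re (z^*)%C by case: (z) bz.
have hz := h (z^*)%C bz' _; have {}hz : symbol_half_bounds b k (z^*)%C.
  by apply: hz; case: (z) iz => x y /= iz; rewrite oppr_ge0 ltW.
have [Q0 [psi h1 [h2 h3]]] := half _ bz' hz; case: hz => _ k1 _ k2.
move: k1 k2 h2 h3 Q0; rewrite !symQ_conj !symN_conj !nr_conj => k1 k2 h2 h3 Q0.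
split => //.
  by rewrite (_ : z - b%:C%C = (((z^*)%C - b%:C%C)^*)%C) ?nr_conj // rmorphB /= conjcK oppr0.
apply: (@in_sector_polar _ _ (- psi) h2); first by rewrite normrN.
have Q0' : symQ z != 0 by rewrite -(conjc_eq0 (symQ z)).
rewrite symh_omega //; rewrite symh_omega ?symQ_conj // symN_conj in h3.
have conj_div (x y : C) : x / y = (((x^*)%C / (y^*)%C)^*)%C.
  by rewrite -conjc_inv -rmorphM conjcK.
rewrite conj_div.
rewrite h3; move: (_ / _) => r.
by rewrite /cis cosN sinN; apply/eqP; rewrite eq_complex /=; apply/andP; split; apply/eqP; ring.
Qed.

Lemma zpow_polar_mul (z w : C) : 0 < complex.Re z -> 0 < complex.Re w ->
  zpow mu z * w = (nr z `^ mu * nr w)%:C%C * cis (mu * carg z + carg w).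
Proof.
move=> z0 w0; rewrite zpow_polar // {1}(polar w0) cisD rmorphM /=; ring.
Qed.

(** The numerator is z^mu z + (- omega - beta) z^mu + (- omega alpha) with nonnegative coefficients,
    so all three terms lie in the cone. Keeping the first gives growth, and keeping the constant one
    gives the second bound, which matters near z = 0. *)
Lemma symbol_half_pos (z : C) : 0 < alpha -> 0 < complex.Re z -> 0 <= complex.Im z ->
  symbol_half_bounds 0 alpha z /\ kap * (- omega * alpha) <= nr (symN z).
Proof.
move=> al0 z0 iz; have f0 := carg_ge0 z0 iz; have fpi := carg_ltpi2 z.
have mf0 : 0 <= mu * carg z by rewrite mulr_ge0 // ltW.
have mfpi : mu * carg z <= pi / 2 by rewrite (le_trans _ (ltW fpi)) // ler_piMl // ltW.
have hT : mu * carg z + carg z <= Th.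
  rewrite /Th addrC mulrDl mul1r; apply: lerD; first exact: ltW.
  by rewrite ler_wpM2l ?(ltW mu0) // ltW.
have p0 : 0 <= nr z `^ mu by exact: powR_ge0.
have c1 : 0 <= - omega - beta by move: c0; lra.
have oa : 0 <= - omega * alpha by rewrite mulr_ge0 ?oppr_ge0 ?(ltW omega0) ?(ltW al0).
have cw1 : cone Th (zpow mu z * z).
  rewrite zpow_polar_mul //; apply: (cone_cis Th0 Th2) => //; last exact: addr_ge0.
  by rewrite mulr_ge0 ?nr_ge0.
have cw2 : cone Th ((- omega - beta)%:C%C * zpow mu z).
  rewrite zpow_polar // mulrA -rmorphM /=; apply: (cone_cis Th0 Th2) => //.
    by rewrite mulr_ge0.
  by rewrite (le_trans mfpi) // ltW.
have cw3 : cone Th (- omega * alpha)%:C%C.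
  by rewrite -[_%:C%C]mulr1 -cis0; apply: (cone_cis Th0 Th2) => //; exact: ltW.
have NE : symN z = zpow mu z * z + ((- omega - beta)%:C%C * zpow mu z + (- omega * alpha)%:C%C).
  by rewrite /symN mulNr rmorphN /=; ring.
have cN : cone Th (symN z) by rewrite NE; do 2?apply: (coneD Th0 Th2).
have RQ : alpha <= complex.Re (symQ z).
  rewrite /symQ ReD (_ : complex.Re alpha%:C%C = alpha) // lerDr zpow_polar //.
  rewrite /= mul0r subr0 mulr_ge0 //.
  by apply: cos_ge0_pihalf; move: pi20; lra.
split; first split => //.
- rewrite /symQ; apply: (coneD pi20 pi2pi).
    by rewrite zpow_polar //; exact: (cone_cis pi20 pi2pi).
  by rewrite -[_%:C%C]mulr1 -cis0; apply: (cone_cis pi20 pi2pi) => //; exact: ltW.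
- by rewrite (le_trans RQ) // (le_trans _ (Re_le_nr _)) // ler_norm.
- have := cone_nr_ge Th0 Th2 cw1 (coneD Th0 Th2 cw2 cw3).
  by rewrite -NE nrM nr_zpow // subr0.
have := cone_nr_ge Th0 Th2 cw3 (coneD Th0 Th2 cw2 cw1).
rewrite addrA [X in X + _]addrC addrC -NE nrR ger0_norm //.
Qed.

(* Here [symN z = z^mu (z - b) + b (z^mu - b^mu) - (omega + beta) z^mu]. *)
Lemma symbol_half_neg (b : R) (z : C) : alpha < 0 -> 0 < b -> b `^ mu * b = alpha * omega ->
  - alpha < b `^ mu -> b < complex.Re z -> 0 <= complex.Im z ->
  symbol_half_bounds b (b `^ mu + alpha) z.
Proof.
move=> al0 b0 bE hb bz iz; have z0 : 0 < complex.Re z := lt_trans b0 bz.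
have f0 := carg_ge0 z0 iz; have fpi := carg_ltpi2 z.
have mf0 : 0 <= mu * carg z by rewrite mulr_ge0 // ltW.
have mfpi : mu * carg z <= pi / 2 by rewrite (le_trans _ (ltW fpi)) // ler_piMl // ltW.
have zb0 : 0 < complex.Re (z - b%:C%C) by rewrite ReD /= subr_gt0.
have izb : 0 <= complex.Im (z - b%:C%C) by rewrite ImD /= oppr0 addr0.
have g0 := carg_ge0 zb0 izb; have gpi := carg_ltpi2 (z - b%:C%C).
have hT : mu * carg z + carg (z - b%:C%C) <= Th.
  rewrite /Th addrC mulrDl mul1r; apply: lerD; first exact: ltW.
  by rewrite ler_wpM2l ?(ltW mu0) // ltW.
have p0 : 0 <= nr z `^ mu by exact: powR_ge0.
have c1 : 0 <= - omega - beta by move: c0; lra.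
(* This puts z^mu - b^mu in the first quadrant, hence b (z^mu - b^mu) in the cone; it also bounds
   the real part of [symQ] below. *)
have hRe : b `^ mu <= complex.Re (zpow mu z) by apply: Re_zpow_ge; rewrite ?ltW.
have hIm : 0 <= complex.Im (zpow mu z).
  rewrite zpow_polar // /= mul0r addr0 mulr_ge0 // sin_ge0_pi //.
  by apply/andP; split => //; rewrite (le_trans mfpi) // ltW.
have cw1 : cone Th (zpow mu z * (z - b%:C%C)).
  rewrite zpow_polar_mul //; apply: (cone_cis Th0 Th2) => //; last exact: addr_ge0.
  by rewrite mulr_ge0 ?nr_ge0.
have cw2 : cone Th ((- omega - beta)%:C%C * zpow mu z + b%:C%C * (zpow mu z - (b `^ mu)%:C%C)).
  apply: cone_quadrant => //; first exact: ltW.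
    move: hRe hIm; case: (zpow mu z) => x y /= hx hy.
    have x0 : 0 <= x := le_trans (powR_ge0 _ _) hx.
    rewrite !mul0r !subr0; apply: addr_ge0; first exact: mulr_ge0.
    by apply: mulr_ge0; [exact: ltW|rewrite subr_ge0].
  move: hRe hIm; case: (zpow mu z) => x y /= hx hy.
  by rewrite !mul0r !addr0 oppr0 addr0 addr_ge0 // mulr_ge0 // ltW.
have NE : symN z = zpow mu z * (z - b%:C%C) +
    ((- omega - beta)%:C%C * zpow mu z + b%:C%C * (zpow mu z - (b `^ mu)%:C%C)).
  rewrite /symN [omega * alpha]mulrC -bE rmorphM /=; ring.
have cN : cone Th (symN z) by rewrite NE; apply: (coneD Th0 Th2).
have RQ : b `^ mu + alpha <= complex.Re (symQ z) by rewrite /symQ ReD /= lerD2r.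
split => //.
- apply: cone_quadrant => //.
    by rewrite (le_trans _ RQ) //; move: hb; lra.
  by rewrite /symQ ImD /= addr0.
- by rewrite (le_trans RQ) // (le_trans _ (Re_le_nr _)) // ler_norm.
- have := cone_nr_ge Th0 Th2 cw1 cw2.
  by rewrite -NE nrM nr_zpow.
Qed.

(** The last clause is tailored to the term of the derivative in which g' appears multiplied by z -
    beta: there |z - beta| / |z| is unbounded near 0 when b = 0 < beta, and has to be compensated by
    the numerator. *)
Definition symbol_bounds (b k K : R) : Prop := forall z, b < complex.Re z ->
  [/\ k <= nr (symQ z), k * (nr z `^ mu * nr (z - b%:C%C)) <= nr (symN z),
      in_sector omega (mu' * (pi / 2)) (symh z) &
      nr (z - beta%:C%C) * (nr z `^ mu * nr (z - b%:C%C)) ^+ 2 <= K * (nr z * nr (symN z) ^+ 2)].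

Lemma symbol_bounds_pos : 0 < alpha ->
  exists k K : R, [/\ 0 < k, 0 <= K & symbol_bounds 0 k K].
Proof.
move=> al0; pose w := - omega * alpha.
have w0 : 0 < w by rewrite mulr_gt0 // oppr_gt0.
(* From |z - beta| <= |z| + beta: the first summand serves |z|, the second serves beta for |z| >= 1,
   and the third serves beta for |z| < 1, where |symN z| >= kap w. *)
pose K : R := (kap ^+ 2)^-1 + beta * (kap ^+ 2)^-1 + beta * ((kap * w) ^+ 2)^-1.
exists (Num.min alpha kap), K; split.
- by rewrite lt_min al0 kap0.
- have i1 : 0 <= (kap ^+ 2)^-1 by rewrite invr_ge0 exprn_ge0 // ltW.
  have i2 : 0 <= ((kap * w) ^+ 2)^-1 by rewrite invr_ge0 sqr_ge0.
  exact: addr_ge0 (addr_ge0 i1 (mulr_ge0 beta0 i1)) (mulr_ge0 beta0 i2).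
move=> z z0; have [h1 h2 h3] := symbol_sector (lexx 0) al0
  (fun z z0 iz => (symbol_half_pos al0 z0 iz).1) z0.
have h4 : kap * w <= nr (symN z).
  case: (leP 0 (complex.Im z)) => iz; first by case: (symbol_half_pos al0 z0 iz).
  have zc : 0 < complex.Re (z^*)%C by case: (z) z0.
  have ic : 0 <= complex.Im (z^*)%C by case: (z) iz => x y /= iz; rewrite oppr_ge0 ltW.
  by have [_] := symbol_half_pos al0 zc ic; rewrite symN_conj nr_conj.
split => //.
- by rewrite (le_trans _ h1) // ge_min lexx.
- apply: le_trans h2; rewrite ler_wpM2r ?mulr_ge0 ?powR_ge0 ?nr_ge0 //.
  by rewrite ge_min lexx orbT.
have r0 : 0 < nr z by exact: Re_gt0_nr.
move: h2; rewrite subr0; set r := nr z in r0 *; set n := nr (symN z) in h4 * => h2.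
have n0 : 0 <= n by exact: nr_ge0.
have hb : nr (z - beta%:C%C) <= r + beta.
  by rewrite (le_trans (nrB _ _)) // nrR ger0_norm.
have k20 : 0 < kap ^+ 2 by rewrite exprn_gt0.
have kw20 : 0 < (kap * w) ^+ 2 by rewrite exprn_gt0 // mulr_gt0.
set s := r `^ mu * r in h2 *; have s0 : 0 <= s by rewrite mulr_ge0 ?powR_ge0 // ltW.
have hs : s ^+ 2 <= (kap ^+ 2)^-1 * n ^+ 2.
  rewrite mulrC ler_pdivlMr // -exprMn mulrC.
  by rewrite lerXn2r ?nnegrE // mulr_ge0 // ltW.
have hs2 : s ^+ 2 <= r * ((kap ^+ 2)^-1 * n ^+ 2) + r * (((kap * w) ^+ 2)^-1 * n ^+ 2).
  have nn0 : 0 <= (kap ^+ 2)^-1 * n ^+ 2 by rewrite mulr_ge0 ?invr_ge0 ?exprn_ge0 // ltW.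
  have nn1 : 0 <= ((kap * w) ^+ 2)^-1 * n ^+ 2 by rewrite mulr_ge0 ?invr_ge0 ?exprn_ge0 // ltW // mulr_gt0.
  case: (leP 1 r) => r1.
    rewrite (le_trans hs) // (le_trans (y := r * ((kap ^+ 2)^-1 * n ^+ 2))) //.
      by rewrite ler_peMl.
    by rewrite lerDl mulr_ge0 // ltW.
  apply: (@le_trans _ _ (r * 1)).
    have hr : r `^ mu <= 1 `^ mu by rewrite ge0_ler_powR ?nnegrE ?(ltW mu0) ?(ltW r0) ?(ltW r1).
    rewrite powR1 in hr; have : s <= r by rewrite /s ler_piMl // ltW.
    move=> sr; rewrite mulr1 expr2 (le_trans (ler_wpM2l s0 sr)) // ler_piMl ?(ltW r0) //.
    by rewrite (le_trans sr) // ltW.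
  have : 1 <= ((kap * w) ^+ 2)^-1 * n ^+ 2.
    by rewrite mulrC ler_pdivlMr // mul1r lerXn2r ?nnegrE // mulr_ge0 // ltW.
  move=> h; rewrite (le_trans (ler_wpM2l (ltW r0) h)) // lerDr mulr_ge0 // ltW //.
apply: (@le_trans _ _ ((r + beta) * s ^+ 2)); first by rewrite ler_wpM2r // exprn_ge0.
have q1 := ler_wpM2l (ltW r0) hs; have q2 := ler_wpM2l beta0 hs2.
rewrite /K; move: q1 q2; lra.
Qed.

Lemma symbol_bounds_neg (b : R) : alpha < 0 -> 0 < b -> b `^ mu * b = alpha * omega ->
  - alpha < b `^ mu -> exists k K : R, [/\ 0 < k, 0 <= K & symbol_bounds b k K].
Proof.
move=> al0 b0 bE hb.
have k0 : 0 < b `^ mu + alpha by move: hb; lra.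
(* Here |z| >= b > 0, so |z - beta| <= (1 + beta / b) |z|. *)
exists (Num.min (b `^ mu + alpha) kap), ((1 + beta / b) / kap ^+ 2); split.
- by rewrite lt_min k0 kap0.
- by rewrite divr_ge0 ?exprn_ge0 ?addr_ge0 ?divr_ge0 ?(ltW b0) ?(ltW kap0).
move=> z bz; have [h1 h2 h3] := symbol_sector (ltW b0) k0
  (fun z bz iz => symbol_half_neg al0 b0 bE hb bz iz) bz.
split => //.
- by rewrite (le_trans _ h1) // ge_min lexx.
- apply: le_trans h2; rewrite ler_wpM2r ?mulr_ge0 ?powR_ge0 ?nr_ge0 //.
  by rewrite ge_min lexx orbT.
have br : b <= nr z by rewrite (le_trans (ltW bz)) // (le_trans _ (Re_le_nr z)) ?ler_norm.
have hz : nr (z - beta%:C%C) <= (1 + beta / b) * nr z.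
  rewrite (le_trans (nrB _ _)) // nrR ger0_norm // mulrDl mul1r lerD2l.
  by rewrite mulrAC ler_pdivlMr // ler_wpM2l.
set s := nr z `^ mu * _ in h2 *; set n := nr (symN z) in h2 *.
have s0 : 0 <= s by rewrite mulr_ge0 ?powR_ge0 ?nr_ge0.
have hs : s ^+ 2 <= n ^+ 2 / kap ^+ 2.
  rewrite ler_pdivlMr ?exprn_gt0 // -exprMn mulrC.
  by rewrite lerXn2r ?nnegrE ?nr_ge0 // mulr_ge0 // ltW.
apply: (le_trans (ler_pM _ _ hz hs)); rewrite ?nr_ge0 ?exprn_ge0 //.
by rewrite le_eqVlt; apply/orP; left; apply/eqP; ring.
Qed.

End Symbol.

(** * Resolvents and resolvent families *)

Section ContinuityOnHalfLine.
Context {R : realType} {X : normedModType R[i]}.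
Local Notation C := R[i].

Definition half_line_continuous (f : R -> X) : Prop :=
  forall t : R, 0 <= t -> forall e : R, 0 < e -> exists2 d : R, 0 < d &
    forall s : R, 0 <= s -> `|s - t| < d -> nr (f s - f t) <= e.

Lemma within_half_line_continuous (f : R -> X) :
  {within `[0%R, +oo[%classic, continuous f} -> half_line_continuous f.
Proof.
move=> /subspace_continuousP hf t t0 e e0.
have ht : `[0%R, +oo[%classic t by rewrite /= in_itv /= t0.
have /cvgrPdistC_le := hf t ht.
have ec : 0 < e%:C%C :> C by rewrite ltcR.
move=> /(_ _ ec); rewrite near_withinE => /nbhs_ballP [d /= d0 hd].
exists d => // s s0 st; rewrite -lecR -nrE; apply: hd => //.
  by rewrite /ball /= distrC.
by rewrite /= in_itv /= s0.
Qed.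

(** Compactness of [0, T] in its near-covering form; [s'] may lie beyond T. *)
Lemma half_line_uniform (f : R -> X) (T : R) : half_line_continuous f ->
  forall e : R, 0 < e -> exists2 d : R, 0 < d &
    forall s s' : R, 0 <= s <= T -> 0 <= s' -> `|s' - s| < d -> nr (f s' - f s) <= e.
Proof.
move=> hf e e0.
pose P (n : nat) (s : R) := forall s' : R, 0 <= s' -> 0 <= s -> `|s' - s| < n.+1%:R^-1 ->
  nr (f s' - f s) <= e.
have /compact_near_coveringP hc := @segment_compact R 0 T.
have [] := hc nat \oo P _; last first.
  move=> N _ hN; exists (N.+1%:R^-1); first by rewrite invr_gt0.
  move=> s s' /andP[s0 sT] s'0 h; apply: (hN N) => //=.
  by rewrite in_itv /= s0.
move=> t; rewrite /= in_itv /= => /andP[t0 _].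
have e20 : 0 < e / 2 by rewrite divr_gt0.
have [d d0 hd] := hf t t0 _ e20.
have d20 : 0 < d / 2 by rewrite divr_gt0.
exists (ball t (d / 2), [set n | (Num.bound (d / 2)^-1 <= n)%N]).
  split => /=; first by apply: nbhsx_ballx.
  by exists (Num.bound (d / 2)^-1).
move=> [s n] /= [hs hn] s' s'0 s0 ss'.
have hs1 : `|s - t| < d / 2 by move: hs; rewrite /ball /= distrC.
have hn1 : n.+1%:R^-1 <= d / 2.
  rewrite -[d / 2]invrK lef_pV2 ?posrE ?invr_gt0 //.
  by rewrite natr_bound_le ?invr_ge0 ?(ltW d20) // (leq_trans hn).
have h1 : `|s - t| < d by rewrite (lt_le_trans hs1) //; move: d0; lra.
have h2 : `|s' - t| < d.
  rewrite -(subrK s s') -addrA (le_lt_trans (ler_normD _ _)) // [d]splitr.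
  by rewrite ltrD // (lt_le_trans ss').
rewrite (le_trans (nrBD (f t) _ _)) // [e]splitr (nrC (f t)).
by apply: lerD; apply: hd.
Qed.

Lemma half_line_bounded (f : R -> X) (T : R) : half_line_continuous f ->
  exists2 B : R, 0 <= B & forall s : R, 0 <= s <= T -> nr (f s) <= B.
Proof.
move=> hf.
pose P (n : nat) (s : R) := 0 <= s -> nr (f s) <= n%:R.
have /compact_near_coveringP hc := @segment_compact R 0 T.
have [] := hc nat \oo P _; last first.
  move=> N _ hN; exists N%:R => // s /andP[s0 sT]; apply: (hN N) => //=.
  by rewrite in_itv /= s0.
move=> t; rewrite /= in_itv /= => /andP[t0 _].
have [d d0 hd] := hf t t0 _ (@ltr01 R).
exists (ball t d, [set n | (Num.bound (nr (f t) + 1) <= n)%N]).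
  split => /=; first by apply: nbhsx_ballx.
  by exists (Num.bound (nr (f t) + 1)).
move=> [s n] /= [hs hn] s0.
have hs1 : `|s - t| < d by move: hs; rewrite /ball /= distrC.
rewrite (le_trans (nr_le_dist _ (f t))) // (le_trans (y := nr (f t) + 1)) //.
  by rewrite lerD2l hd.
by rewrite natr_bound_le ?addr_ge0 ?nr_ge0.
Qed.

Lemma half_line_expR_scale (f : R -> X) (a : R) : half_line_continuous f ->
  half_line_continuous (fun s => (expR (a * s))%:C%C *: f s).
Proof.
move=> hf t t0 e e0; pose E : R := expR (a * t).
have E0 : 0 < E by exact: expR_gt0.
have [B B0 hB] := half_line_bounded (t + 1) hf.
have e1 : 0 < e / 2 / E by rewrite !divr_gt0.
have [d1 d10 hd1] := hf t t0 _ e1.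
pose c : R := E * (expR `|a| * `|a|) * B.
have c0 : 0 <= c by rewrite !mulr_ge0 ?expR_ge0.
have [d2 d20 hd2] := small_mul c0 (divr_gt0 e0 (@ltr0Sn R 1)).
exists (Num.min 1 (Num.min d1 d2)); first by rewrite !lt_min ltr01 d10 d20.
move=> s s0; rewrite !lt_min => /and3P[h1 h2 h3].
have -> : (expR (a * s))%:C%C *: f s - (expR (a * t))%:C%C *: f t =
    (E * (expR (a * (s - t)) - 1))%:C%C *: f s + E%:C%C *: (f s - f t).
  have -> : expR (a * s) = E * expR (a * (s - t)) by rewrite -expRD; congr expR; ring.
  rewrite -/E; set G := expR _; have -> : E * (G - 1) = E * G - E by ring.
  by rewrite rmorphB /= scalerBl scalerBr addrA subrK.
have st1 : s <= t + 1 by move: h1; rewrite ltr_norml => /andP[_]; lra.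
rewrite (le_trans (nrD _ _)) // [e]splitr; apply: lerD.
  apply: le_trans (hd2 `|s - t| _ (ltW h3)); last exact: normr_ge0.
  rewrite nrZ nrR normrM (gtr0_norm E0) /c [leRHS]mulrAC.
  apply: ler_pM; rewrite ?nr_ge0 ?mulr_ge0 ?(ltW E0) //; last by rewrite hB // s0.
  rewrite -mulrA ler_wpM2l ?(ltW E0) // -mulrA.
  have h4 : `|a * (s - t)| <= `|a| by rewrite normrM ler_piMr // ltW.
  by rewrite (le_trans (expR_sub1 h4)) // normrM.
rewrite nrZ nrR gtr0_norm // mulrC -ler_pdivlMr //; exact: hd1.
Qed.

End ContinuityOnHalfLine.

(** * The resolvent as a function of the spectral parameter *)

Section Resolvent.
Context {R : realType} {X : completeNormedModType R[i]}.
Local Notation C := R[i].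

Lemma lin_maps (T : X -> X) : (forall (c : C) x y, T (c *: x + y) = c *: T x + T y) ->
  [/\ T 0 = 0, forall c x, T (c *: x) = c *: T x, forall x y, T (x + y) = T x + T y,
    forall x y, T (x - y) = T x - T y &
    forall n (F : nat -> X), T (\sum_(i < n) F i) = \sum_(i < n) T (F i)].
Proof.
move=> hT.
have h0 : T 0 = 0.
  by apply: (addrI (T 0)); rewrite addr0 -{1}[T 0]scale1r -hT scaler0 addr0.
have hZ c x : T (c *: x) = c *: T x by rewrite -[c *: x]addr0 hT h0 addr0.
have hD x y : T (x + y) = T x + T y by rewrite -{1}[x]scale1r hT scale1r.
have hB x y : T (x - y) = T x - T y by rewrite hD -scaleN1r hZ scaleN1r.
split => // n F; elim: n => [|n IH]; first by rewrite !big_ord0.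
by rewrite !big_ord_recr /= hD IH.
Qed.

Variables (D : set X) (A : X -> X).

Lemma resolvent_identity l l' Rl Rl' x :
  is_resolvent D A l Rl -> is_resolvent D A l' Rl' ->
  Rl x - Rl' x = (l' - l) *: Rl (Rl' x).
Proof.
move=> [[hl _] [_ h2]] [_ [h3 _]].
have [_ hZ hD hB _] := lin_maps hl.
have [Dy ey] := h3 x; set y := Rl' x in Dy ey *.
rewrite -{1}ey; have -> : l' *: y - A y = (l *: y - A y) + (l' - l) *: y.
  by rewrite scalerBl [RHS]addrC addrA subrK.
by rewrite hD h2 // hZ addrC addKr.
Qed.

(** Two applications of the resolvent identity write the remainder as (l' - l)^2 times a product of
    three resolvents. *)
Lemma T2_resolvent (Rs : C -> X -> X) (P : set C) (L : R) (x : X) : 0 <= L ->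
  (forall l, P l -> is_resolvent D A l (Rs l)) ->
  (forall l y, P l -> nr (Rs l y) <= L * nr y) ->
  T2 P (fun l => Rs l x) (fun l => - Rs l (Rs l x)).
Proof.
move=> L0 hR hL; set n := nr x.
have n0 : 0 <= n by exact: nr_ge0.
have p1 : 0 <= L * n by rewrite mulr_ge0.
have p2 : 0 <= L * (L * n) by rewrite mulr_ge0.
have p3 : 0 <= L * (L * (L * n)) by rewrite mulr_ge0.
have b1 l : P l -> nr (Rs l x) <= L * n by move=> Pl; exact: hL.
have b2 l l' : P l -> P l' -> nr (Rs l (Rs l' x)) <= L * (L * n).
  by move=> Pl Pl'; rewrite (le_trans (hL _ _ Pl)) // ler_wpM2l // b1.
exists (L * n + L * (L * n) + L * (L * (L * n))); first by rewrite !addr_ge0.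
move=> l l' Pl Pl'; have rid := resolvent_identity x (hR _ Pl) (hR _ Pl').
have e1 : Rs l' x - Rs l x = - ((l' - l) *: Rs l (Rs l' x)) by rewrite -rid opprB.
split.
- by rewrite (le_trans (b1 _ Pl)) // -addrA lerDl addr_ge0.
- by rewrite nrN (le_trans (b2 _ _ Pl Pl)) // -addrA addrCA lerDl addr_ge0.
- rewrite e1 nrN nrZ mulrC ler_wpM2r ?nr_ge0 // (le_trans (b2 _ _ Pl Pl')) //.
  by rewrite -addrA addrCA lerDl addr_ge0.
have -> : Rs l' x - Rs l x - (l' - l) *: - Rs l (Rs l x) =
    (l' - l) *: ((l' - l) *: Rs l (Rs l (Rs l' x))).
  have [[hl _] _] := hR _ Pl; have [_ hZ _ hB _] := lin_maps hl.
  by rewrite e1 scalerN opprK addrC -scalerBr -hB rid hZ.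
rewrite !nrZ mulrA -expr2 mulrC ler_wpM2r ?exprn_ge0 ?nr_ge0 //.
rewrite (le_trans (hL _ _ Pl)) // (le_trans (ler_wpM2l L0 (b2 _ _ Pl Pl'))) //.
by rewrite lerDr addr_ge0.
Qed.

End Resolvent.

(** * The transform of the orbit, its derivative, and their bounds *)

Section SymbolResolvent.
Context {R : realType} {X : completeNormedModType R[i]}.
Local Notation C := R[i].
Variables (D : set X) (A : X -> X) (alpha beta mu mu' omega b k K M : R) (Rs : C -> X -> X).
Hypotheses (mu0 : 0 < mu) (b0 : 0 <= b) (k0 : 0 < k) (K0 : 0 <= K) (M0 : 0 < M).
Hypothesis hsym : symbol_bounds alpha beta mu mu' omega b k K.
Hypothesis hRs : forall l, in_sector omega (mu' * (pi / 2)) l ->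
  is_resolvent D A l (Rs l) /\ forall y, nr (Rs l y) <= M / nr (l - omega%:C%C) * nr y.

Local Notation Q := (symQ alpha mu).
Local Notation N := (symN alpha beta mu omega).
Local Notation g := (symg alpha mu).
Local Notation h := (symh alpha beta mu).

Lemma symQ_gt0 z : b < complex.Re z -> 0 < nr (Q z).
Proof. by move=> bz; have [h1 _ _ _] := hsym bz; exact: lt_le_trans h1. Qed.

Lemma Re_gt_nr_sub z : b < complex.Re z -> 0 < nr (z - b%:C%C).
Proof. by move=> bz; rewrite Re_gt0_nr // ReD /= subr_gt0. Qed.

Lemma symN_gt0 z : b < complex.Re z -> 0 < nr (N z).
Proof.
move=> bz; have [_ h2 _ _] := hsym bz; apply: lt_le_trans h2.
rewrite !mulr_gt0 ?Re_gt_nr_sub //.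
by rewrite powR_gt0 // Re_gt0_nr // (le_lt_trans b0).
Qed.

Lemma resolvent_symh z : b < complex.Re z -> is_resolvent D A (h z) (Rs (h z)).
Proof. by move=> bz; have [_ _ h3 _] := hsym bz; have [] := hRs h3. Qed.

Lemma resolvent_symh_le z y : b < complex.Re z ->
  nr (Rs (h z) y) <= M * (nr (Q z) / nr (N z)) * nr y.
Proof.
move=> bz; have [_ _ h3 _] := hsym bz; have [_ h4] := hRs h3.
rewrite (le_trans (h4 y)) // symh_omega; last by rewrite -nr_gt0 symQ_gt0.
by rewrite nrM nrV invf_div.
Qed.

Definition dsymg z : C := mu%:C%C * zpow mu z / z * alpha%:C%C / Q z ^+ 2.
Definition symF (x : X) z : X := g z *: Rs (h z) x.
Definition dsymF (x : X) z : X :=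
  dsymg z *: Rs (h z) x +
  g z *: ((g z + (z - beta%:C%C) * dsymg z) *: - Rs (h z) (Rs (h z) x)).

Lemma T2_symF a B x : 0 < a -> T2 (rhp (a + b) B) (symF x) (dsymF x).
Proof.
move=> a0; set P := rhp _ _.
have ab0 : 0 < a + b by rewrite ltr_wpDr.
have Pb z : P z -> b < complex.Re z.
  by move=> [h1 _]; rewrite (lt_le_trans _ h1) // ltrDr.
have PB z : P z -> nr z <= B by case.
have Tz := T2_zpow mu B ab0; rewrite -/P in Tz.
have TQ := T2_add Tz (T2_const P (alpha%:C%C : C^o)).
have hk z : P z -> k <= nr (Q z) by move=> /Pb bz; have [] := hsym bz.
have TV := T2_inv k0 hk TQ.
have Tg : T2 P (g : C -> C^o) dsymg.
  apply: T2_ext (T2_scale Tz TV) => // z Pz; have Q0 : Q z != 0.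
    by rewrite -nr_gt0 symQ_gt0 // Pb.
  have zn0 : z != 0 by rewrite -nr_gt0 Re_gt0_nr // (le_lt_trans b0) // Pb.
  rewrite -[LHS]/(mu%:C%C * zpow mu z / z * (Q z)^-1 +
     zpow mu z * (- (mu%:C%C * zpow mu z / z + 0) / Q z ^+ 2)) /dsymg.
  rewrite /symQ in Q0 *; field; rewrite ?zn0 ?Q0 ?andbT //=.
have Th : T2 P (h : C -> C^o) (fun z => g z + (z - beta%:C%C) * dsymg z).
  have T1 := T2_add (T2_id PB) (T2_const P (- beta%:C%C : C^o)).
  apply: T2_ext (T2_scale T1 Tg) => // z Pz.
  by rewrite -[LHS]/((1 + 0) * g z + (z - beta%:C%C) * dsymg z) addr0 mul1r.
(* On this truncated half-plane |symQ| is at most B^mu + |alpha| and |symN| at least k a^mu a, which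
   bounds the resolvents at all points h(z). *)
pose L := M * ((B `^ mu + `|alpha|) / (k * (a `^ mu * a))).
have a00 : 0 < k * (a `^ mu * a) by rewrite !mulr_gt0 // powR_gt0.
have L0 : 0 <= L by rewrite mulr_ge0 ?(ltW M0) // divr_ge0 ?(ltW a00) // addr_ge0 // powR_ge0.
pose P2 := [set l | exists2 z, P z & l = h z].
have TR : T2 P2 (fun l => Rs l x) (fun l => - Rs l (Rs l x)).
  apply: (@T2_resolvent R X D A Rs P2 L x L0) => l.
    by move=> [z Pz ->]; apply: resolvent_symh; exact: Pb.
  move=> y [z Pz ->]; have bz := Pb _ Pz; rewrite (le_trans (resolvent_symh_le _ bz)) //.
  rewrite ler_wpM2r ?nr_ge0 // /L ler_wpM2l ?(ltW M0) //.
  have az : a <= complex.Re (z - b%:C%C) by rewrite ReD /= lerBrDr; case: Pz.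
  have as_ : a <= nr (z - b%:C%C) by rewrite (le_trans az) // (le_trans _ (Re_le_nr _)) // ler_norm.
  have ar : a <= nr z.
    rewrite (le_trans _ (Re_le_nr _)) // (le_trans _ (ler_norm _)) //.
    by case: Pz => h1 _; rewrite (le_trans _ h1) // lerDl.
  have h2 : k * (a `^ mu * a) <= nr (N z).
    have [_ h2 _ _] := hsym bz; apply: le_trans h2; rewrite ler_wpM2l ?(ltW k0) //.
    apply: ler_pM; rewrite ?powR_ge0 ?(ltW a0) //.
    by rewrite ge0_ler_powR ?nnegrE ?(ltW mu0) ?(ltW a0) ?nr_ge0.
  apply: ler_pM; rewrite ?nr_ge0 ?invr_ge0 ?nr_ge0 //.
    rewrite (le_trans (nrD _ _)) // nrR lerD2r nr_zpow; last exact: le_lt_trans bz.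
    by rewrite ge0_ler_powR ?nnegrE ?(ltW mu0) ?nr_ge0 ?PB // (le_trans (nr_ge0 z)) ?PB.
  by rewrite lef_pV2 ?posrE ?symN_gt0.
have PP z : P z -> P2 (h z) by move=> Pz; exists z.
exact: T2_scale Tg (T2_comp PP Th TR).
Qed.

Lemma T2_symF_shift a B x : 0 < a ->
  T2 (rhp a B) (fun z => symF x (z + b%:C%C)) (fun z => dsymF x (z + b%:C%C)).
Proof.
move=> a0; have PB (z : C) : rhp a B z -> nr z <= B by case.
have Ts := T2_add (T2_id PB) (T2_const (rhp a B) (b%:C%C : C^o)).
have PP z : rhp a B z -> rhp (a + b) (B + b) (z + b%:C%C).
  move=> [h1 h2]; split; first by rewrite ReD /= lerD2r.
  by rewrite (le_trans (nrD _ _)) // nrR ger0_norm // lerD2r.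
apply: T2_ext (T2_comp PP Ts (T2_symF (B + b) x a0)) => // z _.
by rewrite addr0 scale1r.
Qed.

Lemma symF_le x z : b < complex.Re z -> nr (symF x z) <= M / (k * nr (z - b%:C%C)) * nr x.
Proof.
move=> bz; have s0 := Re_gt_nr_sub bz; have q0 := symQ_gt0 bz; have n0 := symN_gt0 bz.
have z0 := le_lt_trans b0 bz.
rewrite nrZ (le_trans (ler_wpM2l (nr_ge0 _) (resolvent_symh_le x bz))) // [leLHS]mulrA.
rewrite ler_wpM2r ?nr_ge0 // nrM nrV nr_zpow // [leLHS]mulrCA ler_wpM2l ?(ltW M0) //.
rewrite [leLHS]mulrA divfK ?gt_eqF // -[leRHS]mul1r ler_pdivlMr ?mulr_gt0 // mulrAC ler_pdivrMr // mul1r.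
by have [_ h2 _ _] := hsym bz; rewrite (le_trans _ h2) // mulrCA.
Qed.

(** Controls h R(h) uniformly far to the right, which the error constant of the discretised
    transform requires. *)
Lemma symh_resolvent_le y z : b < complex.Re z ->
  nr (h z) * nr (Rs (h z) y) <= nr (z - beta%:C%C) * (M / (k * nr (z - b%:C%C)) * nr y).
Proof.
move=> bz; have := symF_le y bz; rewrite nrZ => hF.
by rewrite /symh nrM -mulrA ler_wpM2l ?nr_ge0.
Qed.

(** One summand for each term of the derivative: g' R, g^2 R^2 and (z - beta) g g' R^2, with R taken
    at h(z). *)
Definition symF_const : R :=
  mu * `|alpha| * M / k ^+ 2 + M ^+ 2 / k ^+ 2 + mu * `|alpha| * M ^+ 2 * K / k.

Lemma symF_const_ge0 : 0 <= symF_const.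
Proof.
by rewrite !addr_ge0 // ?divr_ge0 ?mulr_ge0 ?exprn_ge0 ?(ltW mu0) ?(ltW M0) ?(ltW k0).
Qed.

Lemma dsymF_le x z : b < complex.Re z ->
  nr (dsymF x z) <= symF_const * nr x / nr (z - b%:C%C) ^+ 2.
Proof.
move=> bz; have s0 := Re_gt_nr_sub bz; have q0 := symQ_gt0 bz; have n0 := symN_gt0 bz.
have z0 := le_lt_trans b0 bz; have r0 := Re_gt0_nr z0.
have hR1 := resolvent_symh_le x bz; have hR2 := resolvent_symh_le (Rs (h z) x) bz.
have [h1 h2 _ h4] := hsym bz.
have sr : nr (z - b%:C%C) <= nr z.
  rewrite -(@ler_pXn2r _ 2) // ?nnegrE ?nr_ge0 // !nr_sqr.
  move: bz; case: (z) => x1 y1 /= bz; rewrite oppr0 addr0 lerD2r.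
  by rewrite lerXn2r ?nnegrE ?subr_ge0 ?(ltW bz) ?(le_trans b0 (ltW bz)) // gerBl.
have nw : 0 <= nr x by exact: nr_ge0.
have e0 : 0 < nr z `^ mu by rewrite powR_gt0.
have ng : nr (g z) = nr z `^ mu / nr (Q z) by rewrite nrM nrV nr_zpow.
have ndg : nr (dsymg z) = mu * nr z `^ mu / nr z * `|alpha| / nr (Q z) ^+ 2.
  by rewrite /dsymg !nrM !nrV nrX !nrR nr_zpow // ger0_norm // ltW.
set s := nr (z - b%:C%C) in s0 h2 h4 sr *; set r := nr z in r0 e0 h2 h4 sr ng ndg.
set q := nr (Q z) in q0 hR1 hR2 h1 ng ndg; set n := nr (N z) in n0 hR1 hR2 h2 h4.
set e := r `^ mu in e0 h2 h4 ng ndg; set d := nr (z - beta%:C%C) in h4.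
have d0 : 0 <= d by exact: nr_ge0.
have t1 : nr (dsymg z *: Rs (h z) x) <= mu * `|alpha| * M / k ^+ 2 / s ^+ 2 * nr x.
  rewrite nrZ ndg; apply: (le_trans (ler_wpM2l _ hR1)).
    by rewrite !mulr_ge0 ?invr_ge0 ?exprn_ge0 ?(ltW mu0) ?(ltW e0) ?(ltW r0) ?(ltW q0).
  rewrite [leLHS]mulrA ler_wpM2r //.
  have -> : mu * e / r * `|alpha| / q ^+ 2 * (M * (q / n)) =
      mu * `|alpha| * M * (r^-1 * q^-1 * (e / n)) by field; rewrite !gt_eqF.
  have -> : mu * `|alpha| * M / k ^+ 2 / s ^+ 2 =
      mu * `|alpha| * M * (s^-1 * k^-1 * (k * s)^-1) by field; rewrite !gt_eqF.
  rewrite ler_wpM2l ?mulr_ge0 ?(ltW mu0) ?(ltW M0) //.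
  apply: ler_pM; rewrite ?mulr_ge0 ?invr_ge0 ?(ltW r0) ?(ltW q0) ?(ltW e0) ?(ltW n0) //.
    apply: ler_pM; rewrite ?invr_ge0 ?(ltW r0) ?(ltW q0) //; first by rewrite lef_pV2.
    by rewrite lef_pV2.
  rewrite ler_pdivrMr // mulrC ler_pdivlMr ?mulr_gt0 //.
  by rewrite mulrCA.
have hRR : nr (Rs (h z) (Rs (h z) x)) <= (M * (q / n)) ^+ 2 * nr x.
  rewrite (le_trans hR2) // expr2 -[leRHS]mulrA ler_wpM2l //.
  by rewrite mulr_ge0 ?divr_ge0 ?(ltW M0) ?(ltW q0) ?(ltW n0).
have hes : e ^+ 2 / n ^+ 2 <= (k ^+ 2)^-1 / s ^+ 2.
  have -> : (k ^+ 2)^-1 / s ^+ 2 = ((k * s)^-1) ^+ 2 by field; rewrite !gt_eqF.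
  rewrite -expr_div_n lerXn2r ?nnegrE ?divr_ge0 ?invr_ge0 ?mulr_ge0 ?(ltW e0) ?(ltW n0) ?(ltW k0) ?(ltW s0) //.
  by rewrite ler_pdivrMr // mulrC ler_pdivlMr ?mulr_gt0 // mulrCA.
have hd : d * e ^+ 2 / (r * n ^+ 2) <= K / s ^+ 2.
  rewrite ler_pdivrMr ?mulr_gt0 ?exprn_gt0 // mulrAC ler_pdivlMr ?exprn_gt0 //.
  by rewrite -mulrA -exprMn.
have t2 : nr (g z *: ((g z + (z - beta%:C%C) * dsymg z) *: - Rs (h z) (Rs (h z) x))) <=
    (M ^+ 2 / k ^+ 2 + mu * `|alpha| * M ^+ 2 * K / k) / s ^+ 2 * nr x.
  rewrite !nrZ nrN [leLHS]mulrA.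
  have a1 : nr (g z + (z - beta%:C%C) * dsymg z) <= e / q + d * (mu * e / r * `|alpha| / q ^+ 2).
    by rewrite (le_trans (nrD _ _)) // nrM ng ndg.
  rewrite ng; apply: (@le_trans _ _ (e / q * (e / q + d * (mu * e / r * `|alpha| / q ^+ 2)) *
     ((M * (q / n)) ^+ 2 * nr x))).
    apply: ler_pM; rewrite ?nr_ge0 ?mulr_ge0 ?nr_ge0 ?invr_ge0 ?(ltW e0) ?(ltW q0) //.
    by rewrite ler_wpM2l // divr_ge0 ?(ltW e0) ?(ltW q0).
  rewrite [leLHS]mulrA ler_wpM2r //.
  have -> : e / q * (e / q + d * (mu * e / r * `|alpha| / q ^+ 2)) * (M * (q / n)) ^+ 2 =
     M ^+ 2 * (e ^+ 2 / n ^+ 2) + mu * `|alpha| * M ^+ 2 * (q^-1 * (d * e ^+ 2 / (r * n ^+ 2))).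
    by field; rewrite !gt_eqF.
  have -> : (M ^+ 2 / k ^+ 2 + mu * `|alpha| * M ^+ 2 * K / k) / s ^+ 2 =
     M ^+ 2 * ((k ^+ 2)^-1 / s ^+ 2) + mu * `|alpha| * M ^+ 2 * (k^-1 * (K / s ^+ 2)).
    by field; rewrite !gt_eqF.
  apply: lerD; first by rewrite ler_wpM2l // exprn_ge0 // ltW.
  rewrite ler_wpM2l ?mulr_ge0 ?exprn_ge0 ?(ltW mu0) ?(ltW M0) //.
  apply: ler_pM; rewrite ?invr_ge0 ?(ltW q0) // ?lef_pV2 //.
  by rewrite divr_ge0 // mulr_ge0 ?exprn_ge0 ?(ltW e0) ?(ltW n0) ?(ltW r0).
rewrite (le_trans (nrD _ _)) // (le_trans (lerD t1 t2)) //.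
rewrite le_eqVlt; apply/orP; left; apply/eqP; rewrite /symF_const.
by field; rewrite !gt_eqF.
Qed.

End SymbolResolvent.

(** * Decay of the resolvent family *)

Section Decay.
Context {R : realType} {X : completeNormedModType R[i]}.
Local Notation C := R[i].
Variables (D : set X) (A : X -> X) (S : R -> X -> X).
Variables (alpha beta mu mu' omega b k K M : R) (Rs : C -> X -> X).
Hypotheses (beta0 : 0 <= beta) (mu0 : 0 < mu) (mu1 : mu <= 1) (b0 : 0 <= b).
Hypotheses (k0 : 0 < k) (K0 : 0 <= K) (M0 : 0 < M).
Hypothesis hsym : symbol_bounds alpha beta mu mu' omega b k K.
Hypothesis hRs : forall l, in_sector omega (mu' * (pi / 2)) l ->
  is_resolvent D A l (Rs l) /\ forall y, nr (Rs l y) <= M / nr (l - omega%:C%C) * nr y.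
Hypothesis hS : resolvent_family alpha beta mu D A S.

Local Notation kk := (fun t => 1 + one_conv_kappa alpha beta mu t).

Lemma resolvent_family_continuous x : half_line_continuous (fun s => S s x).
Proof. by have [_ [_ [h _]]] := hS; exact: within_half_line_continuous. Qed.

(** On the domain A S(s) x = S(s) A x is continuous in s, and the kernel is uniformly continuous, so
    the Riemann sums converge at a rate common to all end points up to T; the bounded linear map
    [Rl] passes through them. *)
Lemma resolvent_riemann (Rl : X -> X) (L T : R) (x : X) : D x ->
  (forall (c : C) u v, Rl (c *: u + v) = c *: Rl u + Rl v) ->
  0 <= L -> 0 <= T -> (forall y, nr (Rl y) <= L * nr y) ->
  forall e : R, 0 < e -> exists2 d : R, 0 < d &
  forall (dl : R) (j : nat), 0 < dl -> dl < d -> j%:R * dl <= T ->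
  nr (\sum_(i < j) (dl * kk (j%:R * dl - i%:R * dl))%:C%C *: Rl (S (i%:R * dl) (A x))
      - (Rl (S (j%:R * dl) x) - Rl x)) <= e.
Proof.
move=> Dx hl L0 T0 hL e e0.
have [_ hZ _ hB hsum] := lin_maps hl.
have [Kk Kk0 hK] := kernel_bounded alpha beta0 mu0 T.
have [BA BA0 hBA] := half_line_bounded T (@resolvent_family_continuous (A x)).
have c0 : 0 <= L * (T * (BA + Kk)) by rewrite !mulr_ge0 // addr_ge0.
have [e1 e10 he1] := small_mul c0 e0.
have [d1 d10 hd1] := kernel_unif_cont alpha beta0 mu0 T e10.
have [d2 d20 hd2] := half_line_uniform T (@resolvent_family_continuous (A x)) e10.
exists (Num.min d1 d2); first by rewrite lt_min d10.
move=> dl j dl0; rewrite lt_min => /andP[dld1 dld2] jT.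
set tj := j%:R * dl; have tj0 : 0 <= tj by rewrite mulr_ge0 // ltW.
have [_ [_ [_ [hcom hint]]]] := hS.
have hri := hint tj x tj0 Dx.
pose f := fun s => (1 + one_conv_kappa alpha beta mu (tj - s))%:C%C *: A (S s x).
have fE s : 0 <= s -> f s = (kk (tj - s))%:C%C *: S s (A x).
  by move=> s0; have [_ ->] := hcom s x s0 Dx.
have hmod (s s' : R) : 0 <= s -> s <= s' -> s' <= tj -> s' - s <= dl ->
    nr (f s' - f s) <= e1 * BA + Kk * e1.
  move=> s0 ss' s'tj h; have s'0 := le_trans s0 ss'.
  have -> : f s' - f s = (kk (tj - s') - kk (tj - s))%:C%C *: S s' (A x) +
      (kk (tj - s))%:C%C *: (S s' (A x) - S s (A x)).
    by rewrite !fE // [(_ - _)%:C%C]rmorphB /= scalerBl scalerBr addrA subrK.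
  have sT : 0 <= s' <= T by rewrite s'0 (le_trans s'tj).
  have q1 : 0 <= tj - s' <= T by rewrite subr_ge0 s'tj lerBlDr (le_trans jT) // lerDl.
  have q2 : 0 <= tj - s <= T.
    by rewrite subr_ge0 (le_trans ss') // lerBlDr (le_trans jT) // lerDl.
  rewrite (le_trans (nrD _ _)) //; apply: lerD.
    rewrite nrZ nrR; apply: ler_pM; rewrite ?nr_ge0 ?hBA //.
    apply: hd1 => //; have -> : tj - s' - (tj - s) = - (s' - s) by ring.
    by rewrite normrN ger0_norm ?subr_ge0 // (le_lt_trans h).
  rewrite nrZ nrR; apply: ler_pM; rewrite ?nr_ge0 //; first exact: hK.
  apply: hd2 => //; first by rewrite s0 (le_trans ss') // (le_trans s'tj).
  by rewrite ger0_norm ?subr_ge0 // (le_lt_trans h).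
have hsumb := riemann_sum_approx dl0 (erefl tj) hri hmod.
have -> : \sum_(i < j) (dl * kk (tj - i%:R * dl))%:C%C *: Rl (S (i%:R * dl) (A x))
      - (Rl (S tj x) - Rl x) = Rl (\sum_(i < j) dl%:C%C *: f (i%:R * dl) - (S tj x - x)).
  rewrite !hB (hsum j (fun i => dl%:C%C *: f (i%:R * dl))); congr (_ - _).
  apply: eq_bigr => i _; rewrite fE ?mulr_ge0 ?(ltW dl0) // scalerA hZ; congr (_ *: _).
  by rewrite rmorphM.
rewrite (le_trans (hL _)) //; apply: le_trans (he1 e1 (ltW e10) (lexx _)).
rewrite -mulrA ler_wpM2l // (le_trans hsumb) // -mulrA.
have -> : (BA + Kk) * e1 = e1 * BA + Kk * e1 by ring.
by rewrite ler_wpM2r // addr_ge0 // mulr_ge0 // ltW.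
Qed.

Lemma resolvent_family_transform (x : X) (T : R) : D x -> 0 < T ->
  exists E0 x0 : R, 0 <= E0 /\ forall z : C, x0 <= complex.Re z -> forall e : R, 0 < e ->
    exists N0 : nat, forall N, (N0 <= N)%N ->
    nr (disc_laplace (fun s => (expR ((beta - b) * s))%:C%C *: S s x) T N z -
        symF alpha beta mu Rs x (z + b%:C%C)) <= E0 * expR (- (T * complex.Re z)) + e.
Proof.
move=> Dx T0; have T0' := ltW T0; set ga := beta - b.
have [Kk Kk0 hK] := kernel_bounded alpha beta0 mu0 T.
have [Bu Bu0 hBu] := half_line_bounded T (@resolvent_family_continuous x).
have [BA BA0 hBA] := half_line_bounded T (@resolvent_family_continuous (A x)).
have [Ck Ck0 hCk] := kernel_transform alpha beta0 mu0 mu1 T0.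
(* [H] bounds |h| |R(h) y| / |y| for every admissible [w], because |p| <= (1 + |ga|) |w| and |z - b|
   = |w|. As it does not depend on [w], neither does [E0]. *)
pose H : R := M * (1 + `|ga|) / k.
have H0 : 0 <= H by rewrite divr_ge0 ?mulr_ge0 ?addr_ge0 ?(ltW M0) ?(ltW k0).
pose E0 : R := expR 1 * expR (ga * T) * (T * Ck * BA * H + H * nr x).
(* The abscissa ensures Re p >= 1, as [kernel_transform] requires. *)
exists E0, (1 + `|ga|); split.
  have q1 : 0 <= expR 1 * expR (ga * T) by rewrite mulr_ge0 ?expR_ge0.
  have q2 := mulr_ge0 (mulr_ge0 (mulr_ge0 T0' Ck0) BA0) H0.
  exact: mulr_ge0 q1 (addr_ge0 q2 (mulr_ge0 H0 (nr_ge0 x))).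
move=> w hw e e0.
have w1 : 1 <= complex.Re w by rewrite (le_trans _ hw) // lerDl.
(* Three shifts of one variable: [w] belongs to v(s) = e^(ga s) S(s) x, [p] to the orbit itself, and
   z = p + beta to the symbol. *)
pose p : C := w - ga%:C%C; pose z : C := w + b%:C%C.
have pz : p + beta%:C%C = z by rewrite /p /z /ga rmorphB /=; ring.
have zb : z - b%:C%C = w by rewrite /z addrK.
have zbeta : z - beta%:C%C = p by rewrite -pz addrK.
have p1 : 1 <= complex.Re p.
  have -> : complex.Re p = complex.Re w - ga by rewrite /p ReD.
  by move: hw (ler_norm ga); lra.
have p0 : p != 0 by rewrite -nr_gt0 Re_gt0_nr // (lt_le_trans ltr01).
have bz : b < complex.Re z by rewrite /z ReD /= ltrDr (lt_le_trans ltr01).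
have z0 : 0 < complex.Re z := le_lt_trans b0 bz.
have [kp [kp0 hkp1 hkp2]] := hCk p p1.
have Q0 : symQ alpha mu z != 0 by rewrite -nr_gt0 (symQ_gt0 k0 hsym).
have zm0 : zpow mu z != 0 by rewrite -nr_gt0 nr_zpow //; apply: powR_gt0; exact: Re_gt0_nr.
set h := symh alpha beta mu z.
have hE : h = p * (zpow mu z / symQ alpha mu z) by rewrite /h /symh zbeta.
have h0 : h != 0 by rewrite hE !mulf_neq0 // invr_eq0.
(* The transform of the kernel at p is the reciprocal of the symbol; this is how [symh] arises. *)
have khE : kp 0 = h^-1.
  have zV : zpow (- mu) z = (zpow mu z)^-1.
    by apply: (mulfI zm0); rewrite -zpowD subrr divff // /zpow mul0r cexp0.
  rewrite kp0 pz zV hE; move: Q0; rewrite /symQ => Q0.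
  by field; rewrite zm0 p0 Q0.
have kh0 : kp 0 != 0 by rewrite khE invr_eq0.
have nh0 : 0 < nr h by rewrite nr_gt0.
pose L : R := H / nr h; have L0 : 0 <= L by rewrite divr_ge0 // ltW.
have hres := resolvent_symh hsym hRs bz; rewrite -/h in hres.
have hHR y : nr h * nr (Rs h y) <= H * nr y.
  have hh := symh_resolvent_le b0 k0 M0 hsym hRs y bz.
  apply: (le_trans hh); rewrite mulrA ler_wpM2r ?nr_ge0 // zbeta zb.
  have w0 : 0 < nr w by rewrite Re_gt0_nr // (lt_le_trans ltr01).
  have wn1 : 1 <= nr w by rewrite (le_trans w1) // (le_trans _ (Re_le_nr _)) // ler_norm.
  have hp : nr p <= (1 + `|ga|) * nr w.
    by rewrite (le_trans (nrB _ _)) // nrR mulrDl mul1r lerD2l ler_peMr.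
  have -> : H = (1 + `|ga|) * nr w * (M / (k * nr w)).
    by rewrite /H; field; rewrite !gt_eqF.
  by rewrite ler_wpM2r // divr_ge0 ?mulr_ge0 ?(ltW M0) ?(ltW k0) ?(ltW w0).
have hL y : nr (Rs h y) <= L * nr y.
  by rewrite /L mulrAC ler_pdivlMr // mulrC.
have [[hl _] [_ hres2]] := hres.
have [_ hZ _ hB _] := lin_maps hl.
have [_ [_ [_ [hcom _]]]] := hS.
have mE t : 0 <= t <= T -> kp 0 *: Rs h (S t (A x)) = Rs h (S t x) - kp 0 *: S t x.
  move=> /andP[t0 _]; have [Du ->] := hcom t x t0 Dx.
  have aux (a r u : X) : h *: r - a = u -> h^-1 *: a = r - h^-1 *: u.
    by move=> <-; rewrite scalerBr scalerA mulVf // scale1r opprB addrC subrK.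
  by rewrite khE; apply: aux; rewrite -hZ -hB; exact: hres2.
have hm t : 0 <= t <= T -> nr (Rs h (S t (A x))) <= L * BA.
  by move=> tT; rewrite (le_trans (hL _)) // ler_wpM2l // hBA.
have hr t : 0 <= t <= T -> nr (Rs h (S t x)) <= L * Bu.
  by move=> tT; rewrite (le_trans (hL _)) // ler_wpM2l // hBu.
have pE : p + ga%:C%C = w by rewrite /p subrK.
have hri := resolvent_riemann Dx hl L0 T0' hL.
have [N0 hN0] := transform_error T0 Kk0 Ck0 (mulr_ge0 L0 BA0) Bu0 (mulr_ge0 L0 Bu0)
  p0 kh0 pE hK hkp1 (erefl _) hkp2 hm hBu hr mE hri e0.
exists N0 => N hN; have -> : symF alpha beta mu Rs x (w + b%:C%C) = ((kp 0)^-1 / p) *: Rs h x.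
  rewrite /symF -/z -/h; congr (_ *: _).
  by rewrite khE invrK hE mulrAC divff // mul1r.
apply: (le_trans (hN0 N hN)); rewrite lerD2r ler_wpM2r ?expR_ge0 //.
rewrite khE invrK /E0 mulrCA ler_wpM2l ?mulr_ge0 ?expR_ge0 // mulrDr; apply: lerD.
  rewrite le_eqVlt; apply/orP; left; apply/eqP; rewrite /L; field.
  by rewrite gt_eqF.
rewrite mulrA (le_trans _ (hHR x)) // ler_pdivrMr ?nr_gt0 // ler_peMr ?mulr_ge0 ?nr_ge0 //.
by rewrite (le_trans p1) // (le_trans _ (Re_le_nr _)) // ler_norm.
Qed.

Lemma resolvent_family_domain_le (x : X) (t : R) : D x -> 0 < t ->
  nr (S t x) <= 12 * expR 1 * symF_const alpha mu k K M * expR (- ((beta - b) * t)) * nr x.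
Proof.
move=> Dx t0; set ga := beta - b.
have T0 : 0 < 2 * t by rewrite mulr_gt0.
have [E0 [x0 [E00 hU]]] := resolvent_family_transform Dx T0.
pose v s := (expR (ga * s))%:C%C *: S s x.
have hv : half_line_continuous v by apply: half_line_expR_scale; exact: resolvent_family_continuous.
have [B B0 hB] := half_line_bounded (2 * t) hv.
have Kc0 := symF_const_ge0 alpha mu0 k0 K0 M0.
have KX0 : 0 <= symF_const alpha mu k K M * nr x by rewrite mulr_ge0 ?nr_ge0.
have hT a B' : 0 < a -> T2 (rhp a B') (fun z => symF alpha beta mu Rs x (z + b%:C%C))
    (fun z => dsymF alpha beta mu Rs x (z + b%:C%C)).
  exact: (T2_symF_shift mu0 b0 k0 M0 hsym hRs B' x).
have hd z : 0 < complex.Re z -> nr (dsymF alpha beta mu Rs x (z + b%:C%C)) <=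
    symF_const alpha mu k K M * nr x / nr z ^+ 2.
  move=> z0; have bz : b < complex.Re (z + b%:C%C) by rewrite ReD /= ltrDr.
  by have := dsymF_le mu0 b0 k0 M0 hsym hRs x bz; rewrite addrK.
have hvt := inversion_bound t0 KX0 E00 hT hd hB (hv t (ltW t0)) hU.
move: hvt; rewrite /v nrZ nrR ger0_norm ?expR_ge0 // => hvt.
have -> : nr (S t x) = expR (- (ga * t)) * (expR (ga * t) * nr (S t x)).
  by rewrite mulrA -expRD addNr expR0 mul1r.
rewrite (le_trans (ler_wpM2l (expR_ge0 _) hvt)) //.
by rewrite le_eqVlt; apply/orP; left; apply/eqP; ring.
Qed.

Lemma resolvent_family_decay : densely_defined D -> exists2 c : R, 0 < c &
  forall t : R, 0 <= t -> forall x : X,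
    nr (S t x) <= c * expR (- ((beta - b) * t)) * nr x.
Proof.
move=> hD; have Kc0 := symF_const_ge0 alpha mu0 k0 K0 M0.
(* The summand 1 covers t = 0, where S(0) is the identity, and makes [c] positive. *)
pose c : R := 1 + 12 * expR 1 * symF_const alpha mu k K M.
have c1 : 1 <= c by rewrite lerDl !mulr_ge0 ?expR_ge0.
have c0 : 0 < c := lt_le_trans ltr01 c1.
exists c => // t; rewrite le_eqVlt => /predU1P[<- x|t0 x].
  have [hS0 _] := hS; rewrite hS0 mulr0 oppr0 expR0 mulr1 ler_peMl ?nr_ge0 //.
set E := expR _; have E0 : 0 <= E by exact: expR_ge0.
have hDx y : D y -> nr (S t y) <= c * E * nr y.
  move=> Dy; rewrite (le_trans (resolvent_family_domain_le Dy t0)) //.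
  by rewrite ler_wpM2r ?nr_ge0 // ler_wpM2r // lerDr.
(* The bound [c2] may depend on t; it serves only to pass from the dense domain to all of X. *)
have [_ [hbd _]] := hS; have [hlin [c2 hc2]] := hbd t (ltW t0).
have [_ _ _ hB _] := lin_maps hlin.
have hc2' y : nr (S t y) <= `|c2| * nr y.
  have := hc2 y; rewrite !nrE -rmorphM lecR => h; rewrite (le_trans h) //.
  by rewrite ler_wpM2r ?nr_ge0 // ler_norm.
apply/ler_addgt0Pr => e e0.
have cc0 : 0 <= c * E + `|c2| by rewrite addr_ge0 // mulr_ge0 // ltW.
have [d d0 hd] := small_mul cc0 e0.
have [y [Dy hy]] : exists y, D y /\ nr (x - y) <= d.
  have : closure D x by rewrite hD.
  have dc : 0 < d%:C%C :> C by rewrite ltcR.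
  move=> /(_ _ (nbhsx_ballx x d%:C%C dc)) [y [Dy hy]]; exists y; split => //.
  by move: hy; rewrite -ball_normE /= nrE ltcR => /ltW.
have := hd _ (nr_ge0 (x - y)) hy.
have h1 : nr (S t x) <= nr (S t y) + `|c2| * nr (x - y).
  by rewrite (le_trans (nr_le_dist _ (S t y))) // lerD2l -hB.
have h2 : nr y <= nr x + nr (x - y) by rewrite (le_trans (nr_le_dist _ x)) // lerD2l nrC.
have h3 := hDx y Dy; have cE0 : 0 <= c * E by rewrite mulr_ge0 // ltW.
have h4 := ler_wpM2l cE0 h2; lra.
Qed.

End Decay.

(** Choice turns the pointwise existence of resolvents into one family, so that it can be
    differentiated in the parameter; off the sector the value is arbitrary. *)
Lemma sectorial_resolvent (R : realType) (X : completeNormedModType R[i]) (omega theta : R)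
    (D : set X) (A : X -> X) : sectorial omega theta D A ->
  exists2 M : R, 0 < M & exists Rs : R[i] -> X -> X, forall l, in_sector omega theta l ->
    is_resolvent D A l (Rs l) /\ forall y, nr (Rs l y) <= M / nr (l - omega%:C%C) * nr y.
Proof.
move=> [M M0 hM]; exists M => //.
have hch l : exists Rl : X -> X, in_sector omega theta l ->
    is_resolvent D A l Rl /\ forall y, nr (Rl y) <= M / nr (l - omega%:C%C) * nr y.
  have [hl|hl] := pselect (in_sector omega theta l); last by exists id.
  have [Rl [h1 h2]] := hM l hl; exists Rl => _; split => // y.
  by have := h2 y; rewrite !nrE -fmorphV -!rmorphM lecR.
by have [Rs hRs] := choice hch; exists Rs.
Qed.

Unset Implicit Arguments.

Theorem theorem2p3 (R : realType) (X : completeNormedModType R[i])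
  (D : set X) (A : X -> X) (S : R -> X -> X)
  (alpha beta mu mu' omega : R) :
  alpha != 0 -> 0 <= beta -> 0 < mu -> mu < mu' -> mu' <= 1 ->
  omega < 0 -> beta + omega <= 0 ->
  linear_operator D A -> closed_operator D A -> densely_defined D ->
  resolvent_family alpha beta mu D A S ->
  (0 < alpha -> sectorial omega (mu' * (pi / 2)) D A ->
     exists2 C : R, 0 < C &
       forall t : R, 0 <= t -> forall x : X,
         `|S t x| <= ((C * expR (- (beta * t)))%:C)%C * `|x|) /\
  (alpha < 0 -> `|alpha| <= alpha + beta `^ mu ->
   sectorial omega (mu' * (pi / 2)) D A ->
     exists2 C : R, 0 < C &
       forall t : R, 0 <= t -> forall x : X,
         `|S t x| <=
           ((C * (1 + alpha * omega * t `^ (mu + 1))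
               * expR (- ((beta - (alpha * omega) `^ (1 / (mu + 1))) * t)))%:C)%C
           * `|x|).
Proof.
move=> _ beta0 mu0 mumu' mu'1 omega0 c0 _ _ hD hS.
have mu1 : mu <= 1 by rewrite (le_trans (ltW mumu')).
split => [al0 hsec|al0 hal hsec]; have [M M0 [Rs hRs]] := sectorial_resolvent hsec.
  have [k [K [k0 K0 hsym]]] := symbol_bounds_pos beta0 mu0 mumu' mu'1 omega0 c0 al0.
  have [C C0 hC] := resolvent_family_decay beta0 mu0 mu1 (lexx 0) k0 K0 M0 hsym hRs hS hD.
  exists C => // t t0 x; rewrite !nrE -rmorphM lecR.
  by have := hC t t0 x; rewrite subr0.
have ao0 : 0 < alpha * omega by rewrite nmulr_rgt0.
have m1 : 0 < mu + 1 by rewrite addr_gt0.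
set b := (alpha * omega) `^ (1 / (mu + 1)).
have b0 : 0 < b by rewrite powR_gt0.
have bE : b `^ mu * b = alpha * omega.
  have := powRr1 (ltW b0) => h1.
  rewrite -{2}h1 -powRD; last by rewrite gt_eqF ?implybT // (gt_eqF b0) implybT.
  by rewrite /b -powRrM mul1r mulVf ?gt_eqF // powRr1 // ltW.
(* If beta <= b, then b^mu >= beta^mu >= 2 |alpha|. If b < beta, then b < beta <= - omega, so b^mu b
   = |alpha| (- omega) > |alpha| b. *)
have hb : - alpha < b `^ mu.
  move: hal; rewrite ltr0_norm // => hal.
  case: (leP beta b) => hbb.
    have : beta `^ mu <= b `^ mu by rewrite ge0_ler_powR ?nnegrE ?(ltW mu0) ?(ltW b0).
    lra.
  have : 0 < - alpha * (- omega - b) by rewrite mulr_gt0 ?oppr_gt0 //; lra.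
  by move=> h; rewrite -(ltr_pM2r b0) bE; lra.
have [k [K [k0 K0 hsym]]] := symbol_bounds_neg beta0 mu0 mumu' mu'1 c0 al0 b0 bE hb.
have [C C0 hC] := resolvent_family_decay beta0 mu0 mu1 (ltW b0) k0 K0 M0 hsym hRs hS hD.
exists C => // t t0 x; rewrite !nrE -rmorphM lecR (le_trans (hC t t0 x)) //.
(* The factor 1 + alpha omega t^(mu+1) is at least 1, because alpha omega > 0. *)
rewrite ler_wpM2r ?nr_ge0 // ler_wpM2r ?expR_ge0 // ler_peMr ?(ltW C0) // lerDl.
by rewrite mulr_ge0 ?powR_ge0 // ltW.
Qed.
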